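(* Let $K$ and $\widetilde K$ be as in the context. For $x,y\in\mathbb{R}^m$ and $r\in\mathbb{R}_+$, \[ \int_{\mathbb{S}^{m-1}}\widetilde{K(r\eta,x)}\,K(y,r\eta)\,d\omega(\eta)=2^\lambda\Gamma(\lambda+1)\,u^{-\lambda}J_\lambda(u)\,e^{-\frac i2\cot\alpha(|x|^2-|y|^2)}, \] where $u=\frac{r}{\sin\alpha}\sqrt{|x|^2+|y|^2-2\langle x,y\rangle}=\frac{r}{\sin\alpha}|x-y|$, $\lambda=(m-2)/2$, and $d\omega$ is the rotation-invariant measure on the unit sphere $\mathbb{S}^{m-1}$ normalized so that $\int_{\mathbb{S}^{m-1}}d\omega=1$.
   Context: $\mathcal{C}l_{0,m}$ is the real Clifford algebra generated by $e_1,\dots,e_m$ with $e_ie_j+e_je_i=-2\delta_{ij}$, with complex coefficients allowed ($i$ commuting with the $e_j$). $\underline{x}=\sum x_je_j$, $\underline{x}\wedge\underline{y}=\sum_{j<k}e_je_k(x_jy_k-x_ky_j)$, $\alpha\in[-\pi,\pi]\setminus\{0,\pm\pi\}$, $\alpha_k,\beta_k\in\mathbb{C}$, $\beta_0=0$. $J_\nu$: Bessel function of the first kind; $C_k^\lambda$: Gegenbauer polynomial. $K(x,y)=(A+(\underline{x}\wedge\underline{y})B)e^{\frac i2\cot\alpha(|x|^2+|y|^2)}$ with $A=\sum_{k\ge0}\alpha_k\tilde z^{-\lambda}J_{k+\lambda}(\tilde z)C_k^\lambda(w)$, $B=\sum_{k\ge1}\beta_k\tilde z^{-\lambda-1}J_{k+\lambda}(\tilde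 z)C^{\lambda+1}_{k-1}(w)$, $\tilde z=|x||y|/\sin\alpha$, $w=\langle x,y\rangle/(|x||y|)$, $|A|,|B|$ polynomially bounded in $|x|,|y|$. $\widetilde{K(x,y)}=(\widetilde A+(\underline{x}\wedge\underline{y})\widetilde B)e^{-\frac i2\cot\alpha(|x|^2+|y|^2)}$ with $\widetilde A=\sum_{k\ge0}\frac{\alpha_k+\beta_k\sin\alpha}{N_k^\lambda}\tilde z^{-\lambda}J_{k+\lambda}(\tilde z)C_k^\lambda(w)$, $\widetilde B=-\sum_{k\ge1}\frac{\beta_k}{N_k^\lambda}\tilde z^{-\lambda-1}J_{k+\lambda}(\tilde z)C_{k-1}^{\lambda+1}(w)$, $N_k^\lambda=\frac{1}{2^{2\lambda}\Gamma(\lambda+1)^2}\big(\frac{\lambda}{\lambda+k}\alpha_k-\sin\alpha\frac{k}{2(\lambda+k)}\beta_k\big)\big(\frac{\lambda}{\lambda+k}\alpha_k+\sin\alpha\frac{k+2\lambda}{2(\lambda+k)}\beta_k\big)$ (this is the kernel of the inverse of the transform with kernel $K$). *)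

(* Defs.v *)
From HB Require Import structures.
From mathcomp Require Import all_boot all_order all_algebra.
From mathcomp Require Import all_classical all_reals all_analysis.
From mathcomp Require Import complex.

Set Implicit Arguments.
Unset Strict Implicit.
Unset Printing Implicit Defensive.

Import Order.TTheory GRing.Theory Num.Theory.
Import numFieldNormedType.Exports.
Local Open Scope ring_scope.
Local Open Scope complex_scope.

Section Defs.
Variable R : realType.

Definition dotE (m : nat) (x y : 'rV[R]_m) : R := \sum_(j < m) x 0 j * y 0 j.
Definition nrmE (m : nat) (x : 'rV[R]_m) : R := Num.sqrt (dotE x x).

Definition Gamma (s : R) : R :=
  Rintegral (@lebesgue_measure R) `]0%R, +oo[%classic
            (fun t => t `^ (s - 1) * expR (- t)).

Definition besselJ (nu z : R) : R :=
  limn (series (fun j => (-1) ^+ j / (j`!%:R * Gamma (j%:R + nu + 1))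
                       * (z / 2) `^ (2 * j%:R + nu))).

(* zJ lam s k z  :=  z^(-lam-s) J_(k+lam)(z), written through its power
   series  sum_j (-1)^j z^(2j+k-s) / (2^(2j+k+lam) j! Gamma(j+k+lam+1))
   (used with s <= k).  For z > 0 this is literally
   z `^ (-lam - s) * besselJ (k + lam) z ; the series is the (entire)
   continuation to all real z, which is how z^(-lam)J_(k+lam)(z) is read
   for z <= 0 (e.g. z~ = |x||y|/sin alpha with sin alpha < 0). *)
Definition zJ (lam : R) (s k : nat) (z : R) : R :=
  limn (series (fun j => (-1) ^+ j * z ^+ (2 * j + k - s)%N
      / (2 `^ ((2 * j + k)%:R + lam) * j`!%:R
         * Gamma (j%:R + k%:R + lam + 1)))).

(* Gegenbauer polynomials C_k^lam(w), via the three-term recurrence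
   C_0 = 1, C_1 = 2 lam w,
   n C_n = 2 w (n+lam-1) C_(n-1) - (n+2lam-2) C_(n-2).                 *)
Fixpoint gegen2 (lam w : R) (k : nat) : R * R :=
  match k with
  | 0 => (1, 2 * lam * w)
  | k'.+1 => let: (p, q) := gegen2 lam w k' in
             (q, (2 * w * (k'%:R + 1 + lam) * q - (k'%:R + 2 * lam) * p)
                   / (k'%:R + 2))
  end.
Definition gegen (lam : R) (k : nat) (w : R) : R := (gegen2 lam w k).1.

Definition ccvg (u : nat -> R[i]) : Prop :=
  cvgn (series (fun k => complex.Re (u k))) /\
  cvgn (series (fun k => complex.Im (u k))).
Definition csum (u : nat -> R[i]) : R[i] :=
  limn (series (fun k => complex.Re (u k)))
  +i* limn (series (fun k => complex.Im (u k))).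

Definition cexpi (t : R) : R[i] := cos t +i* sin t.

(* The complexified Clifford algebra Cl_{0,m} (x) C: an element is
   sum_A c_A e_A, A ranging over subsets of {1..m} (here 'I_m),
   e_A = e_(a1) ... e_(ap) for a1 < ... < ap.                          *)
Definition Cl (m : nat) := {ffun {set 'I_m} -> R[i]}.

Definition symdiff (m : nat) (A B : {set 'I_m}) : {set 'I_m} :=
  (A :\: B) :|: (B :\: A).

(* e_A e_B = clsign A B e_(A symdiff B), using e_i e_j = - e_j e_i (i<>j)
   and e_i e_i = -1. *)
Definition clsign (m : nat) (A B : {set 'I_m}) : R[i] :=
  (-1) ^+ (#|[set p : 'I_m * 'I_m | (p.1 \in A) && (p.2 \in B)
                                     && (p.2 < p.1)%N]| + #|A :&: B|).

Definition clmul (m : nat) (f g : Cl m) : Cl m :=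
  [ffun C => \sum_(A : {set 'I_m}) \sum_(B : {set 'I_m})
     (if symdiff A B == C then clsign A B * f A * g B else 0)].
Definition cladd (m : nat) (f g : Cl m) : Cl m := [ffun A => f A + g A].
Definition clscale (m : nat) (c : R[i]) (f : Cl m) : Cl m := [ffun A => c * f A].
Definition clzero (m : nat) : Cl m := [ffun _ => 0].
Definition clsc (m : nat) (c : R[i]) : Cl m :=
  [ffun A => if A == finset.set0 then c else 0].
Definition clgen (m : nat) (j : 'I_m) : Cl m :=
  [ffun A => if A == [set j]%SET then 1 else 0].

Definition wedge (m : nat) (x y : 'rV[R]_m) : Cl m :=
  \big[@cladd m/clzero m]_(j < m) \big[@cladd m/clzero m]_(k < m | (j < k)%N)
     clscale ((x 0 j * y 0 k - x 0 k * y 0 j)%:C) (clmul (clgen j) (clgen k)).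

(* Integration on R^m (iterated Lebesgue integrals) and the normalized
   rotation-invariant measure on S^(m-1), realised as the image of the
   normalized Lebesgue measure of the closed unit ball under x |-> x/|x|. *)
Fixpoint iter_int (n : nat) (f : (nat -> R) -> R) : R :=
  match n with
  | 0 => f (fun _ => 0)
  | n'.+1 => Rintegral (@lebesgue_measure R) setT
      (fun t => iter_int n' (fun v => f (fun i => if i is i'.+1 then v i' else t)))
  end.
Definition Rm_int (m : nat) (g : 'rV[R]_m -> R) : R :=
  iter_int m (fun v => g (\row_(i < m) v i)).
Definition ball_int (m : nat) (g : 'rV[R]_m -> R) : R :=
  Rm_int (fun x => if nrmE x <= 1 then g x else 0).
Definition sph_avg (m : nat) (g : 'rV[R]_m -> R) : R :=
  ball_int (fun x => g ((nrmE x)^-1 *: x)) / ball_int (fun _ : 'rV[R]_m => 1).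
Definition sph_int (m : nat) (F : 'rV[R]_m -> Cl m) : Cl m :=
  [ffun A => sph_avg (fun eta => complex.Re (F eta A))
             +i* sph_avg (fun eta => complex.Im (F eta A))].

Definition lamm (m : nat) : R := (m%:R - 2) / 2.
Definition cot (t : R) : R := cos t / sin t.

Definition ztil (m : nat) (alpha : R) (x y : 'rV[R]_m) : R :=
  nrmE x * nrmE y / sin alpha.
Definition wcos (m : nat) (x y : 'rV[R]_m) : R :=
  dotE x y / (nrmE x * nrmE y).

Definition Aterm (m : nat) (alpha : R) (c : nat -> R[i]) (x y : 'rV[R]_m)
  (k : nat) : R[i] :=
  c k * (zJ (lamm m) 0 k (ztil alpha x y) * gegen (lamm m) k (wcos x y))%:C.
(* terms (index shifted by one) of
   B = sum_(k>=1) c_k z^(-lam-1) J_(k+lam)(z) C_(k-1)^(lam+1)(w) *)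
Definition Bterm (m : nat) (alpha : R) (c : nat -> R[i]) (x y : 'rV[R]_m)
  (k : nat) : R[i] :=
  c k.+1 * (zJ (lamm m) 1 k.+1 (ztil alpha x y)
            * gegen (lamm m + 1) k (wcos x y))%:C.

Definition kernel_form (m : nat) (alpha s : R) (A B : R[i]) (x y : 'rV[R]_m)
  : Cl m :=
  clmul (cladd (clsc m A) (clmul (wedge x y) (clsc m B)))
        (clsc m (cexpi (s * (cot alpha / 2) * (nrmE x ^+ 2 + nrmE y ^+ 2)))).

Definition Kfun (m : nat) (alpha : R) (a b : nat -> R[i]) (x y : 'rV[R]_m)
  : Cl m :=
  kernel_form alpha 1 (csum (Aterm alpha a x y)) (csum (Bterm alpha b x y)) x y.

Definition Nk (m : nat) (alpha : R) (a b : nat -> R[i]) (k : nat) : R[i] :=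
  let lam := lamm m in
  (1 / (2 `^ (2 * lam) * Gamma (lam + 1) ^+ 2))%:C
  * ((lam / (lam + k%:R))%:C * a k
       - (sin alpha * k%:R / (2 * (lam + k%:R)))%:C * b k)
  * ((lam / (lam + k%:R))%:C * a k
       + (sin alpha * (k%:R + 2 * lam) / (2 * (lam + k%:R)))%:C * b k).

Definition atil (m : nat) (alpha : R) (a b : nat -> R[i]) (k : nat) : R[i] :=
  (a k + b k * (sin alpha)%:C) / Nk m alpha a b k.
Definition btil (m : nat) (alpha : R) (a b : nat -> R[i]) (k : nat) : R[i] :=
  b k / Nk m alpha a b k.

Definition Ktil (m : nat) (alpha : R) (a b : nat -> R[i]) (x y : 'rV[R]_m)
  : Cl m :=
  kernel_form alpha (-1) (csum (Aterm alpha (atil m alpha a b) x y))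
              (- csum (Bterm alpha (btil m alpha a b) x y)) x y.

End Defs.

(* Main.v *)
(** Polar coordinates identify the averages of monomials over the sphere with Gaussian moments;
    integrating these by parts gives, for a polynomial p,
      L(d_u p) = L(<u,eta> (E p + (m-1) p)),
    with L the average and E the Euler derivative. Together with the Gegenbauer equation, it yields
    the orthogonality and the reproducing property of C_k(<xi,.>) and of <u,.> C_k'(<xi,.>).
    On |eta| = 1 each kernel is a series in z^(-lam) J_(k+lam)(z) times such functions, and the
    convergence of the kernels at all arguments forces geometric decay of the terms, so that the
    product may be averaged term by term. In degree k the choice of N_k cancels the bivector part and
    leaves (k+lam)/lam g_k(z1) g_k(z2) C_k(w), where g_k is the normalised Bessel function. These terms
    sum to g_0(|z1 xi - z2 zeta|): expand the plane waves cos<z xi,eta>, sin<z xi,eta> in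
    Gegenbauer polynomials and average cos<z1 xi - z2 zeta,eta>. *)

Require Import Defs.
From HB Require Import structures.
From mathcomp Require Import all_boot all_order all_algebra.
From mathcomp Require Import all_classical all_reals all_analysis.
From mathcomp Require Import measurable_realfun complex.
From mathcomp Require Import ring lra zify.

Import Order.TTheory GRing.Theory Num.Theory.
Import numFieldNormedType.Exports.
Local Open Scope classical_set_scope.
Local Open Scope ring_scope.
Local Open Scope complex_scope.

Set Implicit Arguments.
Unset Strict Implicit.
Unset Printing Implicit Defensive.

(** * Iterated integrals *)

(** The average is built from iterated one-variable integrals over the ball, so neither a surface
    measure nor rotation invariance is directly available. The geometric input is the dilation law
    of Lebesgue measure: a radial weight is approximated by indicators of concentric balls, which
    separates radius from direction. The radial moments are never evaluated; their ratios follow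
    from inserting 1 = |eta|^2. The kernels are only assumed to converge pointwise, which by itself
    does not allow exchanging sum and average. However, the arguments may be aligned (w = 1), where
    C_k(1) >= 1, and the radius may be multiplied by a constant rho, which multiplies the leading
    term of z^(-lam) J_(k+lam)(z) by rho^k. The value of rho is chosen to beat the growth of C_k and
    C_k' with a factor 2^k to spare. The bivector factor is distributed over the scalar functions
    <u,eta> C_k', so that only scalar functions are averaged and the Clifford product acts on
    constants. *)

(** The pushforward of Lebesgue measure under t -> r t, multiplied by r, has the right value on
    half-open intervals, hence is Lebesgue measure by uniqueness. *)
Lemma lebesgue_scale (R : realType) (r : R) (F : R -> \bar R) :
  0 < r -> measurable_fun setT F -> (forall t, (0 <= F t)%E) ->
  (\int[@lebesgue_measure R]_t F (r * t)%R =
   (r^-1)%:E * \int[@lebesgue_measure R]_t F t)%E.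
Proof.
move=> r0 mF F0.
pose sc : measurableTypeR R -> measurableTypeR R := fun t => r * t.
have msc : measurable_fun setT sc by exact: measurable_funM.
have rV : 0 <= r by exact: ltW.
have nuE A : measurable A ->
    lebesgue_measure A = mscale (NngNum rV) (pushforward (@lebesgue_measure R) sc) A.
  apply: lebesgue_measure_unique => _ [[a b] _ <-].
  have pre : sc @^-1` `]a, b] = `]r^-1 * a, r^-1 * b]%classic.
    apply/seteqP; split => t /=; rewrite !in_itv/=.
      by rewrite !(ltr_pdivrMl _ _ r0) !(ler_pdivlMl _ _ r0).
    by rewrite !(ltr_pdivrMl _ _ r0) !(ler_pdivlMl _ _ r0).
  change (lebesgue_measure (`]a, b]%classic : set R) = 
    (r%:E * lebesgue_measure (sc @^-1` `]a, b]))%E).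
  rewrite pre !lebesgue_measure_itv/= !lte_fin ltr_pM2l ?invr_gt0//.
  case: ifP => _; last by rewrite mule0.
  by rewrite -!EFinD -EFinM -mulrBr mulrA divff ?mul1r// gt_eqF.
rewrite [RHS](_ : _ = (r^-1)%:E * 
   \int[mscale (NngNum rV) (pushforward (@lebesgue_measure R) sc)]_x (F x))%E; last first.
  congr (_ * _)%E; apply: eq_measure_integral => A mA _. exact: nuE.
rewrite ge0_integral_mscale//= ge0_integral_pushforward//=.
by rewrite preimage_setT muleA -EFinM mulVf ?gt_eqF// mul1e.
Qed.

Lemma sigma_finite_prod (R : realType) d1 d2 (T1 : measurableType d1)
    (T2 : measurableType d2) (m1 : {sigma_finite_measure set T1 -> \bar R})
    (m2 : {sigma_finite_measure set T2 -> \bar R}) :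
  sigma_finite setT (m1 \x m2)%E.
Proof.
have /sigma_finiteP[F [TF ndF Foo]] := sigma_finiteT m1.
have /sigma_finiteP[G [TG ndG Goo]] := sigma_finiteT m2.
exists (fun n => F n `*` G n) => [|k].
  apply/seteqP; split => [[x y] _|//].
  have [i _ Fx] : (\bigcup_n F n) x by rewrite -TF.
  have [j _ Gy] : (\bigcup_n G n) y by rewrite -TG.
  exists (maxn i j) => //; split.
    by move/subsetPset: (ndF _ _ (leq_maxl i j)); exact.
  by move/subsetPset: (ndG _ _ (leq_maxr i j)); exact.
have [[mF Fk] [mG Gk]] := (Foo k, Goo k).
split; first exact: measurableX.
by rewrite product_measure1E// lte_mul_pinfty// ge0_fin_numE.
Qed.

(** Packed as a sigma-finite measure so that products can be iterated in an induction on the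
    dimension. *)
Definition sfprod (R : realType) d1 d2 (T1 : measurableType d1)
    (T2 : measurableType d2) (m1 : {sigma_finite_measure set T1 -> \bar R})
    (m2 : {sigma_finite_measure set T2 -> \bar R}) :
  {sigma_finite_measure set (T1 * T2)%type -> \bar R} :=
  HB.pack (product_measure1 m1 m2)
    (Measure_isSigmaFinite.Build _ _ _ _ (sigma_finite_prod m1 m2)).

Lemma integrable_mull (R : realType) d (T : measurableType d)
  (mu : {measure set T -> \bar R}) (D : set T) (c : R) (f : T -> R) :
  measurable D -> mu.-integrable D (EFin \o f) -> mu.-integrable D (EFin \o (fun x => c * f x)).
Proof.
move=> mD fi; rewrite (_ : _ \o _ = (fun x => c%:E * (EFin \o f) x)%E).
  exact: integrableZl.
by apply/funext => x /=; rewrite EFinM.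
Qed.

Definition scons {R : Type} (t : R) (v : nat -> R) : nat -> R :=
  fun i => if i is i'.+1 then v i' else t.

(** A product majorant survives freezing the first coordinate, as the induction on the dimension
    requires. *)
Definition dominated {R : realType} (h : R -> R) (n : nat) (f : (nat -> R) -> R) :=
  exists M : R, forall v, `|f v| <= M * \prod_(i < n) h (v i).

Lemma dominated_scons (R : realType) (h : R -> R) n f t :
  dominated h n.+1 f -> dominated h n (fun v => f (scons t v)).
Proof.
move=> [M HM]; exists (M * h t) => v; apply: le_trans (HM _) _.
by rewrite big_ord_recl /= mulrA.
Qed.

Lemma dominated_integrable (R : realType) (h : R -> R) n d (T : measurableType d)
  (mu : {measure set T -> \bar R}) (c : T -> nat -> R) f :
  mu.-integrable setT (EFin \o (fun w => \prod_(i < n) h (c w i))) ->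
  measurable_fun setT (fun w => f (c w)) -> dominated h n f ->
  mu.-integrable setT (EFin \o (fun w => f (c w))).
Proof.
move=> ih mf [M HM].
apply: (@le_integrable _ _ _ mu setT _ _ (EFin \o (fun w => M * \prod_(i < n) h (c w i)))) => //.
- exact/measurable_EFinP.
- move=> w _ /=; rewrite lee_fin; apply: le_trans (HM _) _; exact: ler_norm.
- exact: integrable_mull.
Qed.

(* A single integral in place of [iter_int] makes dominated convergence available; [S r] is the dilation by [r]. *)
Lemma euclid_model (R : realType) (h : R -> R) (n : nat) :
  (forall t, 0 <= h t) ->
  (@lebesgue_measure R).-integrable setT (EFin \o h) ->
  exists (d : measure_display) (T : measurableType d)
    (mu : {sigma_finite_measure set T -> \bar R})
    (c : T -> nat -> R) (S : R -> T -> T),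
  [/\ (forall i, measurable_fun setT (fun w => c w i)),
      mu.-integrable setT (EFin \o (fun w => \prod_(i < n) h (c w i))),
      (forall f : (nat -> R) -> R, measurable_fun setT (fun w => f (c w)) -> dominated h n f ->
         iter_int n f = Rintegral mu setT (fun w => f (c w))) &
      (forall r, 0 < r ->
        [/\ (forall w i, c (S r w) i = r * c w i),
            measurable_fun setT (S r) &
            forall F : T -> \bar R, measurable_fun setT F -> (forall w, (0 <= F w)%E) ->
             (\int[mu]_w F (S r w) = ((r^-1) ^+ n)%R%:E * \int[mu]_w F w)%E])].
Proof.
move=> h0 ih; elim: n => [|n [d [T [mu [c [S [mc iH HR HS]]]]]]].
  exists _, unit, (dirac tt : {sigma_finite_measure set unit -> \bar R}).
  exists (fun _ _ => 0), (fun _ => id); split.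
  - by move=> i; exact: measurable_cst.
  - rewrite (_ : _ \o _ = cst 1%:E); last by apply/funext => w /=; rewrite big_ord0.
    apply/integrableP; split; first exact: measurable_cst.
    by rewrite integral_dirac//=; rewrite ?diracE ?mem_set ?mul1e //= normr1 ltry.
  - move=> f mf _ /=; by rewrite /Rintegral integral_dirac//= indicE mem_set// mul1r.
  - move=> r r0; split; first by move=> *; rewrite mulr0.
      exact: measurable_id.
    by move=> F _ _; rewrite expr0 mul1e.
have ih' := ih; have /integrableP[mh hoo] := ih.
have /integrableP[mH Hoo] := iH.
have H0 w : 0 <= \prod_(i < n) h (c w i) by apply: prodr_ge0.
pose leb : {sigma_finite_measure set (measurableTypeR R) -> \bar R} := @lebesgue_measure R.
pose leb2 := sfprod leb mu.
exists _, (measurableTypeR R * T)%type, leb2.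
exists (fun w => scons w.1 (c w.2)), (fun r w => (r * w.1, S r w.2)).
have mc' i : measurable_fun [set: measurableTypeR R * T] (fun w => scons w.1 (c w.2) i).
  case: i => [|i] /=; first exact: measurable_fst.
  exact: (measurableT_comp (mc i) measurable_snd).
have iH' : (leb \x mu)%E.-integrable setT
    (EFin \o (fun w => \prod_(i < n.+1) h (scons w.1 (c w.2) i))).
  apply/integrable12ltyP.
    apply/measurable_EFinP.
    under eq_fun do rewrite big_ord_recl /=.
    apply: measurable_funM.
      by apply/measurable_EFinP; exact: (measurableT_comp mh measurable_fst).
    by apply/measurable_EFinP; exact: (measurableT_comp mH measurable_snd).
  (* The envelope is nonnegative and factors, so its integrability reduces to that of each
     factor. *)
  rewrite (_ : (\int[leb]_x _)%E = \int[leb]_x ((\int[mu]_w (\prod_(i < n) h (c w i))%R%:E) * (h x)%:E))%E.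
    rewrite ge0_integralZl//.
    - apply: lte_mul_pinfty; first by apply: integral_ge0 => w _; rewrite lee_fin H0.
        apply: integrable_fin_num => //.
      by apply: le_lt_trans hoo; rewrite le_eqVlt; apply/orP; left; apply/eqP/eq_integral => x _; rewrite /= ger0_norm.
    - by move=> x _; rewrite lee_fin.
    - by apply: integral_ge0 => w _; rewrite lee_fin H0.
  apply: eq_integral => x _.
  rewrite muleC -ge0_integralZl//; [|by move=> w _; rewrite lee_fin H0|by rewrite lee_fin].
    apply: eq_integral => w _; rewrite /= big_ord_recl /= ger0_norm//.
  by rewrite mulr_ge0.
split => //.
- move=> f mf df /=.
  have intf := dominated_integrable iH' mf df.
  have sl t : measurable_fun setT (fun w => f (scons t (c w))).
    exact: (measurable_fun_pair2 (f := fun w => f (scons w.1 (c w.2))) t mf).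
  rewrite /Rintegral; congr fine.
  rewrite -(integral12_prod_meas1 intf) /fubini_F.
  apply: eq_integral => t _ /=.
  rewrite (HR (fun v => f (scons t v)) (sl t) (dominated_scons _ df)).
  rewrite /Rintegral fineK//.
  apply: integrable_fin_num => //.
  apply: (@dominated_integrable _ _ _ _ _ _ _ (fun v => f (scons t v)) iH (sl t)).
  exact: dominated_scons df.
- move=> r r0; have [cS mS IS] := HS r r0; split.
  + by move=> w [|i] /=.
  + apply: measurable_fun_pair; first exact: measurable_funM.
    exact: (measurableT_comp mS measurable_snd).
  + move=> F mF F0.
    have mFS : measurable_fun [set: measurableTypeR R * T] (fun w => F (r * w.1, S r w.2)).
      apply: (measurableT_comp mF).
      apply: measurable_fun_pair; first exact: measurable_funM.
      exact: (measurableT_comp mS measurable_snd).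
    pose G (t : measurableTypeR R) := (\int[mu]_y F (t, y))%E.
    have mG : measurable_fun setT G by exact: measurable_fun_fubini_tonelli_F.
    have G0 t : (0 <= G t)%E by exact: integral_ge0.
    have rn0 : 0 <= r^-1 ^+ n by rewrite exprn_ge0// invr_ge0 ltW.
    (* Tonelli: the inner integral scales by r^-n, the outer one by r^-1. *)
    transitivity (\int[leb]_t (((r^-1) ^+ n)%R%:E * G (r * t)%R))%E.
      rewrite fubini_tonelli1// /fubini_F/=; apply: eq_integral => t _.
      by rewrite (IS (fun w => F ((r * t)%R, w)))//; exact: measurable_fun_pair2.
    rewrite ge0_integralZl//; first last.
      by apply: (measurableT_comp mG); exact: measurable_funM.
    have -> : (\int[leb2]_w F w = \int[leb]_t G t)%E by exact: fubini_tonelli1.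
    have -> : (\int[leb]_t G (r * t)%R = (r^-1)%:E * \int[leb]_t G t)%E.
      exact: lebesgue_scale.
    by rewrite muleA -EFinM -exprSr.
Qed.

(** * Gaussian moments *)

(** The restrictions of f to [a_n, b_n] are dominated by |f| and converge pointwise to f on D; each
    of their integrals is given by the fundamental theorem. *)
Lemma ftc_exhaust (R : realType) (D : set R) (f F : R -> R) (a_ b_ : nat -> R) (l : R) :
  measurable D -> (forall n, a_ n < b_ n) ->
  (forall n, `[a_ n, b_ n]%classic `<=` D) ->
  (forall x, D x -> \forall n \near \oo, `[a_ n, b_ n]%classic x) ->
  (forall x, D x -> is_derive x 1 F (f x)) ->
  (forall x, D x -> {for x, continuous f}) ->
  (@lebesgue_measure R).-integrable D (EFin \o f) ->
  F (b_ n) - F (a_ n) @[n --> \oo] --> l ->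
  Rintegral (@lebesgue_measure R) D f = l.
Proof.
move=> mD ab abD Dab dF cf If Fl.
pose f_ n := (EFin \o f) \_ (`[a_ n, b_ n]%classic).
have mf : measurable_fun D (EFin \o f) by exact: measurable_int If.
have [] := @dominated_convergence _ _ _ (@lebesgue_measure R) D mD f_ (EFin \o f) (abse \o (EFin \o f)).
- move=> n; apply: measurable_funTS. 
  apply/(measurable_restrictT _ _).1 => //.
  exact: measurable_funS mf.
- exact: mf.
- apply: aeW => x Dx; apply: cvg_near_cst.
  by near=> n; rewrite /f_ patchE mem_set//; near: n; exact: Dab.
- exact: integrable_abse.
- apply: aeW => x n Dx; rewrite /f_ patchE; case: ifP => //= _.
  by rewrite normr0 lee_fin.
move=> _ _ cv.
have E n : (\int[@lebesgue_measure R]_(x in D) f_ n x = (F (b_ n) - F (a_ n))%:E)%E.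
  rewrite /f_ -integral_mkcondr setIidr; last exact: abD.
  apply: continuous_FTC2 => //.
  - apply: continuous_in_subspaceT => x; rewrite inE => /abD Dx; exact: cf.
  - have d x : D x -> derivable F x 1 /\ {for x, continuous F}.
      move=> /dF dx; split; first exact: ex_derive.
      by apply/differentiable_continuous/derivable1_diffP; exact: ex_derive.
    have Da : D (a_ n) by apply: (abD n); rewrite /= in_itv/= lexx ltW.
    have Db : D (b_ n) by apply: (abD n); rewrite /= in_itv/= lexx ltW ?ab.
    split.
    + move=> x xab; apply: (d x _).1; apply: (abD n); exact: subset_itv_oo_cc.
    + by apply: cvg_at_right_filter; exact: (d _ Da).2.
    + by apply: cvg_at_left_filter; exact: (d _ Db).2.
  - move=> x xab; rewrite derive1E; have Dx : D x by apply: (abD n); exact: subset_itv_oo_cc.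
    by have dx := dF _ Dx; exact: derive_val.
have cv2 : (\int[@lebesgue_measure R]_(x in D) f_ n x)%E @[n --> \oo] --> l%:E.
  by under eq_cvg do rewrite E; apply/cvg_EFin => //; apply: nearW.
have := cvg_unique _ cv cv2.
by rewrite /Rintegral => ->.
Unshelve. all: end_near. Qed.

Section Gauss.
Variable R : realType.
Implicit Types (t : R) (n : nat).
Let leb := @lebesgue_measure R.

Lemma exprn_le_expR n t : 0 <= t -> t ^+ n <= n`!%:R * expR t.
Proof.
move=> t0; rewrite -ler_pdivrMl ?ltr0n ?fact_gt0// mulrC.
case: n => [|n]; first by rewrite expr0 fact0 divr1 -{1}(expR0 R) ler_expR.
by apply: le_trans (expR_ge1Dxn n t0); rewrite lerDr.
Qed.

Lemma exprn_expRN_le n (y : R) : 0 <= y -> (1 + (2 * y) ^+ n) * expR (- y) <= 1 + 2 ^+ n * n`!%:R.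
Proof.
move=> y0; rewrite mulrDl mul1r lerD//.
  by rewrite -[leRHS]expR0 ler_expR oppr_le0.
rewrite exprMn -mulrA ler_wpM2l ?exprn_ge0//.
by rewrite expRN ler_pdivrMr ?expR_gt0// exprn_le_expR.
Qed.

(* The envelope e^(-t^2/4) dominates both the Gaussian moments and indicators of balls. *)
Definition gw t : R := expR (- (t / 2) ^+ 2).

Lemma gw_ge0 t : 0 <= gw t. Proof. exact: expR_ge0. Qed.

Lemma gw_integrable : leb.-integrable setT (EFin \o gw).
Proof.
have mg : measurable_fun setT (EFin \o @gauss_fun R).
  apply/measurable_EFinP; exact: measurable_gauss_fun.
apply/integrableP; split.
  apply/measurable_EFinP; apply: measurableT_comp => //.
  by apply: measurableT_comp => //; apply: measurable_funX; exact: measurable_funM.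
have -> : (\int[leb]_t `|(EFin \o gw) t| =
   \int[leb]_t (EFin \o gauss_fun) (2^-1 * t)%R)%E.
  apply: eq_integral => t _ /=.
  by rewrite ger0_norm ?gw_ge0// /gw /gauss_fun mulrC.
rewrite lebesgue_scale ?invr_gt0//; last by move=> t; rewrite lee_fin gauss_fun_ge0.
by rewrite integralT_gauss -EFinM ltry.
Qed.

Lemma gw_le1 t : gw t <= 1.
Proof. by rewrite -[leRHS]expR0 /gw ler_expR oppr_le0 sqr_ge0. Qed.

(** Half of the exponent absorbs the power, and the other half e^(-t^2/2) is the square of the
    envelope. The spare factor pays later for evaluating a weight at a point up to distance 1 below
    t. *)
Lemma gauss_dom2 n : exists C : R, 0 <= C /\
  forall t, `|t ^+ n * expR (- t ^+ 2)| <= C * gw t ^+ 2.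
Proof.
exists (1 + 2 ^+ n * n`!%:R); split.
  by rewrite addr_ge0// mulr_ge0// exprn_ge0.
move=> t.
pose y := t ^+ 2 / 2.
have y0 : 0 <= y by rewrite /y mulr_ge0// sqr_ge0.
have g2 : 0 <= gw t ^+ 2 by rewrite sqr_ge0.
have -> : expR (- t ^+ 2) = expR (- y) * gw t ^+ 2.
  by rewrite [gw t ^+ 2]expr2 /gw -!expRD; congr expR; rewrite /y; field.
rewrite normrM [X in _ * X]ger0_norm ?mulr_ge0 ?expR_ge0// mulrA ler_wpM2r//.
have H : `|t| ^+ n <= 1 + (t ^+ 2) ^+ n.
  rewrite -real_normK ?num_real// -exprM mulnC exprM.
  have : 0 <= `|t| ^+ n by rewrite exprn_ge0.
  move: (`|t| ^+ n) => u u0; nra.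
rewrite normrX; apply: (@le_trans _ _ ((1 + (t ^+ 2) ^+ n) * expR (- y))).
  by rewrite ler_wpM2r ?expR_ge0.
by have -> : t ^+ 2 = 2 * y; [rewrite /y; field|exact: exprn_expRN_le].
Qed.

Lemma gauss_dom n : exists C : R, 0 <= C /\
  forall t, `|t ^+ n * expR (- t ^+ 2)| <= C * gw t.
Proof.
have [C [C0 HC]] := gauss_dom2 n; exists C; split => // t.
apply: le_trans (HC t) _; rewrite ler_wpM2l// expr2.
by rewrite ler_piMr ?gw_ge0 ?gw_le1.
Qed.

Lemma gauss_integrable n : leb.-integrable setT (EFin \o (fun t => t ^+ n * expR (- t ^+ 2))).
Proof.
have [C [C0 HC]] := gauss_dom n.
apply: (@le_integrable _ _ _ leb setT _ _ (EFin \o (fun t => C * gw t))) => //.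
- apply/measurable_EFinP; apply: measurable_funM; first exact: exprn_measurable.
  by apply: (measurable_gauss_fun).
- by move=> t _ /=; rewrite lee_fin; apply: le_trans (HC t) _; exact: ler_norm.
- by apply: integrable_mull => //; exact: gw_integrable.
Qed.

Definition gmom n : R := Rintegral leb setT (fun t => t ^+ n * expR (- t ^+ 2)).

Lemma gmom0_gt0 : 0 < gmom 0.
Proof.
rewrite /gmom /Rintegral.
have -> : (\int[leb]_t (t ^+ 0 * expR (- t ^+ 2))%R%:E = \int[leb]_t (gauss_fun t)%:E)%E.
  by apply: eq_integral => t _; rewrite expr0 mul1r.
by rewrite integralT_gauss /= sqrtr_gt0 pi_gt0.
Qed.

Lemma cvg_gw_nat : gw n.+1%:R @[n --> \oo] --> (0 : R).
Proof.
apply: (@squeeze_cvgr _ _ _ _ (fun=> 0) (fun n => 4 * harmonic n)).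
- near=> n; rewrite gw_ge0/= /gw expRN.
  have h : 0 < n.+1%:R :> R by [].
  have h1 : 1 <= n.+1%:R :> R by rewrite ler1n.
  rewrite -[4]invrK /harmonic -invfM lef_pV2 ?posrE ?expR_gt0 ?mulr_gt0//.
  apply: le_trans (expR_ge1Dx _).
  by move: (n.+1%:R : R) h h1 => x h h1; nra.
- exact: cvg_cst.
- by rewrite -[X in _ --> X](mulr0 4); apply: cvgMr; exact: cvg_harmonic.
Unshelve. all: end_near. Qed.

Lemma is_derive_gauss n (x : R) : is_derive x 1 (fun t : R => t ^+ n * expR (- t ^+ 2))
  (n%:R * (x ^+ n.-1 * expR (- x ^+ 2)) - 2 * (x ^+ n.+1 * expR (- x ^+ 2))).
Proof.
have d1 k : is_derive x 1 (fun t : R => t ^+ k) (k%:R * x ^+ k.-1).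
  have := is_deriveX k (is_derive_id x (1 : R)).
  by rewrite fctE /GRing.scale/= mulr1.
have d2 : is_derive x 1 (fun t : R => expR (- t ^+ 2)) (expR (- x ^+ 2) * (- (2 * x))).
  apply: (@is_derive1_comp _ expR (fun t : R => - t ^+ 2)).
apply: is_derive_eq (is_deriveM (d1 n) d2) _.
set e := expR _; transitivity (x ^+ n * (e * - (2 * x)) + e * (n%:R * x ^+ n.-1)) => //.
rewrite (exprS x n); ring.
Qed.

(** The derivative of t^n e^(-t^2) has integral zero, since this function vanishes at both
    infinities. *)
Lemma gmomS n : 2 * gmom n.+1 = n%:R * gmom n.-1.
Proof.
pose F t := t ^+ n * expR (- t ^+ 2).
pose f t := n%:R * (t ^+ n.-1 * expR (- t ^+ 2)) - 2 * (t ^+ n.+1 * expR (- t ^+ 2)).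
have iM (c : R) k : leb.-integrable setT (EFin \o (fun t => c * (t ^+ k * expR (- t ^+ 2)))).
  by apply: integrable_mull => //; exact: gauss_integrable.
suff : Rintegral leb setT f = 0.
  rewrite /f RintegralB//.
  rewrite !RintegralZl//; try exact: gauss_integrable.
  by rewrite -/(gmom _) -/(gmom _) => /eqP; rewrite subr_eq0 => /eqP.
have [C [C0 HC]] := gauss_dom n.
apply: (@ftc_exhaust R setT f F (fun n => - n.+1%:R) (fun n => n.+1%:R)) => //.
- by move=> k; rewrite -subr_gt0 opprK addr_gt0.
- move=> x _; near=> k; rewrite /= in_itv/= -ler_norml.
  apply: (@le_trans _ _ k%:R); last by rewrite ler_nat.
  near: k; exact: nbhs_infty_ger.
- move=> x _; rewrite /F.
  exact: is_derive_gauss.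
- have ck k (x : R) : {for x, continuous (fun t : R => t ^+ k * expR (- t ^+ 2))}.
    apply/differentiable_continuous/derivable1_diffP.
    by have dk := is_derive_gauss k x; exact: ex_derive.
  by move=> x _; apply: cvgB; apply: cvgM; (exact: cvg_cst || exact: ck).
- exact: (integrableB measurableT (iM n%:R n.-1) (iM 2 n.+1)).
- have FC x : `|F x| <= C * gw x by exact: HC.
  have F0 (u : nat -> R) : (forall k, gw (u k) = gw k.+1%:R) -> F (u k) @[k --> \oo] --> 0.
    move=> gu; apply: norm_cvg0.
    apply: (@squeeze_cvgr _ _ _ _ (fun=> 0) (fun n => C * gw n.+1%:R)).
    + by near=> k; rewrite normr_ge0/= -gu FC.
    + exact: cvg_cst.
    + by rewrite -[X in _ --> X](mulr0 C); apply: cvgMr; exact: cvg_gw_nat.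
  rewrite -(subr0 0); apply: cvgB; apply: F0 => // k.
  by rewrite /gw mulNr sqrrN.
Unshelve. all: end_near. Qed.

Lemma iter_int_prod n (c : R) (f : nat -> R -> R) :
  (forall i, leb.-integrable setT (EFin \o f i)) ->
  iter_int n (fun v => c * \prod_(i < n) f i (v i)) =
  c * \prod_(i < n) Rintegral leb setT (f i).
Proof.
elim: n c f => [|n IH] c f fi /=; first by rewrite !big_ord0.
transitivity (Rintegral leb setT
    (fun t => (\prod_(i < n) Rintegral leb setT (f i.+1) * c) * f 0%N t)).
  apply: eq_Rintegral => t _.
  transitivity (iter_int n (fun v => (c * f 0%N t) * \prod_(i < n) f i.+1 (v i))).
    by congr iter_int; apply/funext => v; rewrite big_ord_recl mulrA.
  by rewrite (IH _ (fun i => f i.+1))//; ring.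
rewrite RintegralZl// big_ord_recl /=; ring.
Qed.

End Gauss.

(** * Averages over the sphere *)

(* ['rV_m] is given no sigma-algebra: measurability is tested along measurable families of coordinates. *)
Definition cmeas (R : realType) (m : nat) (g : 'rV[R]_m -> R) :=
  forall d (T : measurableType d) (Y : T -> 'rV[R]_m),
    (forall j, measurable_fun setT (fun w => Y w 0 j)) ->
    measurable_fun setT (fun w => g (Y w)).

(** Boundedness is asked on the closed ball and not just on the sphere, because x/|x| takes the
    value 0 at the origin. *)
Definition nice (R : realType) (m : nat) (g : 'rV[R]_m -> R) :=
  cmeas g /\ exists M : R, forall x, nrmE x <= 1 -> `|g x| <= M.

Section Norm.
Variables (R : realType) (m : nat).
Implicit Types (x y : 'rV[R]_m).

Lemma dotE_ge0 x : 0 <= dotE x x.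
Proof. by apply: sumr_ge0 => j _; rewrite -expr2 sqr_ge0. Qed.

Lemma nrmE_ge0 x : 0 <= nrmE x.
Proof. exact: sqrtr_ge0. Qed.

Lemma sqr_nrmE x : nrmE x ^+ 2 = dotE x x.
Proof. by rewrite /nrmE sqr_sqrtr// dotE_ge0. Qed.

Lemma dotEZl (a : R) x y : dotE (a *: x) y = a * dotE x y.
Proof. by rewrite /dotE mulr_sumr; apply: eq_bigr => j _; rewrite mxE mulrA. Qed.

Lemma dotEC x y : dotE x y = dotE y x.
Proof. by apply: eq_bigr => j _; rewrite mulrC. Qed.

Lemma dotEZr (a : R) x y : dotE x (a *: y) = a * dotE x y.
Proof. by rewrite dotEC dotEZl dotEC. Qed.

Lemma dotEDl x y z : dotE (x + y) z = dotE x z + dotE y z.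
Proof. by rewrite /dotE -big_split; apply: eq_bigr => j _; rewrite mxE mulrDl. Qed.

Lemma nrmEZ (a : R) x : nrmE (a *: x) = `|a| * nrmE x.
Proof.
rewrite /nrmE dotEZl dotEZr mulrA -expr2 sqrtrM ?sqr_ge0//.
by rewrite sqrtr_sqr.
Qed.

Lemma nrmE_eq0 x : (nrmE x == 0) = (x == 0).
Proof.
apply/idP/idP => [/eqP n0|/eqP ->]; last first.
  by rewrite /nrmE /dotE big1 ?sqrtr0// => j _; rewrite mxE mul0r.
have : dotE x x = 0 by rewrite -sqr_nrmE n0 expr0n.
move/eqP; rewrite /dotE psumr_eq0 => [/allP h|j _]; last by rewrite -expr2 sqr_ge0.
apply/eqP/rowP => j; rewrite mxE.
by have := h j (mem_index_enum _); rewrite -expr2 sqrf_eq0 => /eqP.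
Qed.

Lemma nrmE_unit x : x != 0 -> nrmE ((nrmE x)^-1 *: x) = 1.
Proof.
rewrite -nrmE_eq0 => x0; rewrite nrmEZ ger0_norm ?invr_ge0 ?nrmE_ge0//.
by rewrite mulVf.
Qed.

(** An inequality, since the inverse of 0 is 0 and the normalised vector is 0 at the origin. *)
Lemma nrmE_unit_le1 x : nrmE ((nrmE x)^-1 *: x) <= 1.
Proof.
have [->|x0] := eqVneq x 0; last by rewrite nrmE_unit.
by rewrite scaler0 (eqP (_ : nrmE 0 == 0)) ?nrmE_eq0.
Qed.

End Norm.

Section Cmeas.
Variables (R : realType) (m : nat).
Implicit Types (f g : 'rV[R]_m -> R).

Lemma cmeas_ext f g : f =1 g -> cmeas g -> cmeas f.
Proof. by move=> /funext ->. Qed.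

Lemma cmeas_cst (a : R) : cmeas (fun _ : 'rV[R]_m => a).
Proof. by move=> d T Y mY; exact: measurable_cst. Qed.

Lemma cmeas_coord j : cmeas (fun x : 'rV[R]_m => x 0 j).
Proof. by move=> d T Y mY; exact: mY. Qed.

Lemma cmeasD f g : cmeas f -> cmeas g -> cmeas (fun x => f x + g x).
Proof. by move=> mf mg d T Y mY; apply: measurable_funD; [exact: mf|exact: mg]. Qed.

Lemma cmeasM f g : cmeas f -> cmeas g -> cmeas (fun x => f x * g x).
Proof. by move=> mf mg d T Y mY; apply: measurable_funM; [exact: mf|exact: mg]. Qed.

Lemma cmeas_sum (I : Type) (s : seq I) (P : pred I) (f : I -> 'rV[R]_m -> R) :
  (forall i, cmeas (f i)) -> cmeas (fun x : 'rV[R]_m => \sum_(i <- s | P i) f i x).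
Proof.
move=> mf; elim: s => [|i s IH].
  by apply: (cmeas_ext (g := fun _ => 0)) => [x|]; [rewrite big_nil|exact: cmeas_cst].
apply: (cmeas_ext (g := fun x => if P i then f i x + \sum_(i <- s | P i) f i x
  else \sum_(i <- s | P i) f i x)) => [x|]; first by rewrite big_cons.
by case: (P i) => //; exact: cmeasD.
Qed.

Lemma cmeas_comp (h : R -> R) f : measurable_fun setT h -> cmeas f -> cmeas (fun x => h (f x)).
Proof. by move=> mh mf d T Y mY; apply: (measurableT_comp mh); exact: mf. Qed.

Lemma cmeas_dot (u : 'rV[R]_m) : cmeas (dotE u).
Proof.
by apply: cmeas_sum => j; apply: cmeasM; [exact: cmeas_cst|exact: cmeas_coord].
Qed.

Lemma cmeas_nrm : cmeas (@nrmE R m).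
Proof.
apply: (cmeas_ext (g := fun x => dotE x x `^ 2^-1)) => [x|].
  by rewrite powR12_sqrt// dotE_ge0.
apply: (cmeas_comp (h := fun a => a `^ 2^-1) (f := fun x => dotE x x)).
  exact: measurable_powR.
by apply: cmeas_sum => j; apply: cmeasM; exact: cmeas_coord.
Qed.

Lemma cmeas_unit g : cmeas g -> cmeas (fun x => g ((nrmE x)^-1 *: x)).
Proof.
move=> mg d T Y mY; apply: mg => j.
rewrite (_ : (fun w => _) = fun w => (nrmE (Y w) `^ (-1)) * Y w 0 j).
  apply: measurable_funM => //.
  apply: (@measurableT_comp _ _ _ _ _ _ (fun a => a `^ (-1)) _ (fun w => nrmE (Y w))).
    exact: measurable_powR.
  exact: cmeas_nrm.
by apply/funext => w; rewrite mxE powR_inv1// nrmE_ge0.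
Qed.

Lemma cmeas_ifle (b : R) (h f g : 'rV[R]_m -> R) :
  cmeas h -> cmeas f -> cmeas g -> cmeas (fun x => if h x <= b then f x else g x).
Proof.
move=> mh mf mg d T Y mY; apply: measurable_fun_ifT; [|exact: mf|exact: mg].
apply: measurable_fun_ler; [exact: mh|exact: measurable_cst].
Qed.

Lemma cmeas_cvg (f_ : nat -> 'rV[R]_m -> R) f :
  (forall n, cmeas (f_ n)) -> (forall x, f_ n x @[n --> \oo] --> f x) -> cmeas f.
Proof.
move=> mf cf d T Y mY.
apply: (@measurable_fun_cvg _ _ _ setT (fun n w => f_ n (Y w))) => //.
  by move=> n; exact: mf.
Qed.

End Cmeas.

Section Nice.
Variables (R : realType) (m : nat).
Implicit Types (f g : 'rV[R]_m -> R).

Lemma coord_le_nrmE (x : 'rV[R]_m) j : `|x 0 j| <= nrmE x.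
Proof.
rewrite /nrmE -(sqrtr_sqr (x 0 j)) ler_wsqrtr//.
rewrite /dotE (bigD1 j)//= expr2 lerDl.
by apply: sumr_ge0 => i _; rewrite -expr2 sqr_ge0.
Qed.

Lemma nice_ext f g : f =1 g -> nice g -> nice f.
Proof. by move=> /funext ->. Qed.

Lemma nice_cst (a : R) : nice (fun _ : 'rV[R]_m => a).
Proof. by split; [exact: cmeas_cst|exists `|a|]. Qed.

Lemma nice_coord j : nice (fun x : 'rV[R]_m => x 0 j).
Proof.
split; first exact: cmeas_coord.
by exists 1 => x x1; apply: le_trans (coord_le_nrmE _ _) x1.
Qed.

Lemma niceD f g : nice f -> nice g -> nice (fun x => f x + g x).
Proof.
move=> [mf [M HM]] [mg [M' HM']]; split; first exact: cmeasD.
exists (M + M') => x x1; apply: le_trans (ler_normD _ _) _.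
by rewrite lerD ?HM ?HM'.
Qed.

Lemma niceM f g : nice f -> nice g -> nice (fun x => f x * g x).
Proof.
move=> [mf [M HM]] [mg [M' HM']]; split; first exact: cmeasM.
by exists (M * M') => x x1; rewrite normrM ler_pM ?HM ?HM'.
Qed.

Lemma nice_sum (I : Type) (s : seq I) (P : pred I) (f : I -> 'rV[R]_m -> R) :
  (forall i, nice (f i)) -> nice (fun x : 'rV[R]_m => \sum_(i <- s | P i) f i x).
Proof.
move=> mf; elim: s => [|i s IH].
  by apply: (nice_ext (g := fun _ => 0)) => [x|]; [rewrite big_nil|exact: nice_cst].
apply: (nice_ext (g := fun x => if P i then f i x + \sum_(i <- s | P i) f i x
  else \sum_(i <- s | P i) f i x)) => [x|]; first by rewrite big_cons.
by case: (P i) => //; exact: niceD.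
Qed.

Lemma nice_prod (I : Type) (s : seq I) (P : pred I) (f : I -> 'rV[R]_m -> R) :
  (forall i, nice (f i)) -> nice (fun x : 'rV[R]_m => \prod_(i <- s | P i) f i x).
Proof.
move=> mf; elim: s => [|i s IH].
  by apply: (nice_ext (g := fun _ => 1)) => [x|]; [rewrite big_nil|exact: nice_cst].
apply: (nice_ext (g := fun x => if P i then f i x * \prod_(i <- s | P i) f i x
  else \prod_(i <- s | P i) f i x)) => [x|]; first by rewrite big_cons.
by case: (P i) => //; exact: niceM.
Qed.

Lemma nice_dot (u : 'rV[R]_m) : nice (dotE u).
Proof.
by apply: nice_sum => j; apply: niceM; [exact: nice_cst|exact: nice_coord].
Qed.

End Nice.

(** * Polar coordinates in the model space *)

Section SphereModel.
Variables (R : realType) (m : nat) (d : measure_display) (T : measurableType d).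
Variables (mu : {sigma_finite_measure set T -> \bar R}) (c : T -> nat -> R) (S : R -> T -> T).
Hypothesis m_gt0 : (0 < m)%N.
Hypothesis mc : forall i, measurable_fun setT (fun w => c w i).
Hypothesis iE : mu.-integrable setT (EFin \o (fun w => \prod_(i < m) gw (c w i))).
Hypothesis HR : forall f : (nat -> R) -> R, measurable_fun setT (fun w => f (c w)) ->
  dominated (@gw R) m f -> iter_int m f = Rintegral mu setT (fun w => f (c w)).
Hypothesis HS : forall r, 0 < r ->
  [/\ (forall w i, c (S r w) i = r * c w i),
      measurable_fun setT (S r) &
      forall F : T -> \bar R, measurable_fun setT F -> (forall w, (0 <= F w)%E) ->
       (\int[mu]_w F (S r w) = ((r^-1) ^+ m)%R%:E * \int[mu]_w F w)%E].

Let X (w : T) : 'rV[R]_m := \row_i c w i.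
Let U (w : T) : 'rV[R]_m := (nrmE (X w))^-1 *: X w.
Let N (w : T) : R := nrmE (X w).
Let I (f : T -> R) : R := Rintegral mu setT f.

Lemma meas_X (g : 'rV[R]_m -> R) : cmeas g -> measurable_fun setT (fun w => g (X w)).
Proof. by move=> mg; apply: mg => j; under eq_fun do rewrite mxE; exact: mc. Qed.

Lemma prod_gw (v : nat -> R) :
  \prod_(i < m) gw (v i) = gw (nrmE (\row_(i < m) v i)).
Proof.
rewrite /gw; have -> : - (nrmE (\row_(i < m) v i) / 2) ^+ 2 = \sum_(i < m) - (v i / 2) ^+ 2.
  rewrite exprMn sqr_nrmE /dotE mulr_suml -sumrN; apply: eq_bigr => i _.
  by rewrite mxE exprMn expr2.
by rewrite expR_sum.
Qed.

Definition rdom (f : T -> R) :=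
  measurable_fun setT f /\ exists C : R, forall w, `|f w| <= C * gw (N w).

Lemma rdom_integrable f : rdom f -> mu.-integrable setT (EFin \o f).
Proof.
move=> [mf [C HC]].
apply: (@le_integrable _ _ _ mu setT _ _ (EFin \o (fun w => C * \prod_(i < m) gw (c w i)))) => //.
- exact/measurable_EFinP.
- move=> w _ /=; rewrite lee_fin; apply: (le_trans (HC _)).
  by rewrite prod_gw; exact: ler_norm.
- exact: integrable_mull.
Qed.

Lemma rdomD f g : rdom f -> rdom g -> rdom (fun w => f w + g w).
Proof.
move=> [mf [C HC]] [mg [D HD]]; split; first exact: measurable_funD.
exists (C + D) => w; rewrite mulrDl; apply: le_trans (ler_normD _ _) _.
exact: lerD.
Qed.

Lemma rdomZ (a : R) f : rdom f -> rdom (fun w => a * f w).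
Proof.
move=> [mf [C HC]]; split; first exact: measurable_funM.
by exists (`|a| * C) => w; rewrite normrM -mulrA ler_wpM2l.
Qed.

Lemma rdom_intD f g : rdom f -> rdom g -> I (fun w => f w + g w) = I f + I g.
Proof. by move=> /rdom_integrable fi /rdom_integrable gi; rewrite /I RintegralD. Qed.

Lemma rdom_intZ a f : rdom f -> I (fun w => a * f w) = a * I f.
Proof. by move=> /rdom_integrable fi; rewrite /I RintegralZl. Qed.

Lemma rdom_sum (J : Type) (s : seq J) (f : J -> T -> R) :
  (forall j, rdom (f j)) -> rdom (fun w => \sum_(j <- s) f j w) /\
   I (fun w => \sum_(j <- s) f j w) = \sum_(j <- s) I (f j).
Proof.
move=> rf; elim: s => [|j s [IH1 IH2]].
  have -> : (fun w => \sum_(j <- [::]) f j w) = fun=> 0.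
    by apply/funext => w; rewrite big_nil.
  split; last by rewrite big_nil /I Rintegral_cst//= mul0r.
  by split; [exact: measurable_cst|exists 0 => w; rewrite normr0 mul0r].
have -> : (fun w => \sum_(j <- j :: s) f j w) = fun w => f j w + \sum_(j <- s) f j w.
  by apply/funext => w; rewrite big_cons.
by split; [exact: rdomD|rewrite rdom_intD// IH2 big_cons].
Qed.

Lemma rdom_int_cvg (f_ : nat -> T -> R) f (C : R) :
  (forall n, measurable_fun setT (f_ n)) ->
  (forall n w, `|f_ n w| <= C * gw (N w)) ->
  (forall w, f_ n w @[n --> \oo] --> f w) ->
  I (f_ n) @[n --> \oo] --> I f.
Proof.
move=> mf bf cf.
have mf' : measurable_fun setT f.
  by apply: (@measurable_fun_cvg _ _ _ setT f_) => //.
have bf' w : `|f w| <= C * gw (N w).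
  have cn : `|f_ n w| @[n --> \oo] --> `|f w| by apply: cvg_norm; exact: cf.
  rewrite -(cvg_lim (@Rhausdorff R) cn); apply: limr_le.
    by apply/cvg_ex; exists `|f w|.
  by apply: nearW => n; exact: bf.
have rf : rdom f by split => //; exists C.
have rf_ n : rdom (f_ n) by split => //; exists C.
have [] := @dominated_convergence _ _ _ mu setT measurableT
  (fun n w => (f_ n w)%:E) (EFin \o f) (EFin \o (fun w => C * gw (N w))).
- by move=> n; exact/measurable_EFinP.
- exact/measurable_EFinP.
- by apply: aeW => w _; apply: cvg_EFin; [exact: nearW|exact: cf].
- apply: rdom_integrable; split.
    apply: measurable_funM => //.
    apply: (@measurableT_comp _ _ _ _ _ _ (@gw R) _ N); last exact: (meas_X (@cmeas_nrm R m)).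
    by have /integrableP[/measurable_EFinP] := gw_integrable R.
  exists `|C| => w; rewrite normrM [`|gw _|]ger0_norm ?gw_ge0//.
- by apply: aeW => w n _ /=; rewrite lee_fin.
move=> _ _ cv; rewrite /I /Rintegral.
apply: fine_cvg.
rewrite fineK; first exact: cv.
exact: (integrable_fin_num measurableT (rdom_integrable rf)).
Qed.

Lemma U_scale r w : 0 < r -> U (S r w) = U w.
Proof.
move=> r0; have [cS _ _] := HS r0.
have XS : X (S r w) = r *: X w by apply/rowP => j; rewrite !mxE cS.
rewrite /U XS nrmEZ gtr0_norm// invfM scalerA.
by rewrite -mulrA mulrCA mulVf ?mulr1// gt_eqF.
Qed.

Lemma N_scale r w : 0 < r -> N (S r w) = r * N w.
Proof.
move=> r0; have [cS _ _] := HS r0.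
have XS : X (S r w) = r *: X w by apply/rowP => j; rewrite !mxE cS.
by rewrite /N XS nrmEZ gtr0_norm.
Qed.

(** The model gives the dilation law for nonnegative functions; it is applied to the positive and
    negative parts. *)
Lemma int_scale r f : 0 < r -> rdom f -> I (fun w => f (S r w)) = (r^-1) ^+ m * I f.
Proof.
move=> r0 rf; have fi := rdom_integrable rf; have [mf _] := rf.
have [_ mS IS] := HS r0.
have mEf : measurable_fun setT (EFin \o f) by exact/measurable_EFinP.
rewrite /I /Rintegral [X in fine X]integralE [X in _ * fine X]integralE.
transitivity (fine (\int[mu]_w ((EFin \o f)^\+%E (S r w)) - \int[mu]_w ((EFin \o f)^\-%E (S r w)))%E).
  by congr (fine (_ - _)%E); apply: eq_integral => w _; rewrite ?funeposE ?funenegE.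
rewrite !IS//; try exact: measurable_funepos; try exact: measurable_funeneg.
have fp : (\int[mu]_x (EFin \o f)^\+ x)%E \is a fin_num by exact: integrable_pos_fin_num.
have fn : (\int[mu]_x (EFin \o f)^\- x)%E \is a fin_num by exact: integrable_neg_fin_num.
rewrite -[(fun x0 => (f x0)%:E)]/(EFin \o f).
move: fp fn; move: (\int[mu]_x _)%E (\int[mu]_x _)%E => [p| |] [q| |] //= _ _.
by rewrite mulrBr.
Qed.

Section Radial.
Variable g : 'rV[R]_m -> R.
Hypothesis ng : nice g.

Lemma gU_meas : measurable_fun setT (fun w => g (U w)).
Proof. exact: (meas_X (cmeas_unit ng.1)). Qed.

Lemma gU_bound : exists M : R, 0 <= M /\ forall w, `|g (U w)| <= M.
Proof.
have [M HM] := ng.2; exists `|M|; split => // w; apply: le_trans (ler_norm M).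
by apply: HM; exact: nrmE_unit_le1.
Qed.

Lemma rdom_radial (psi : R -> R) (C : R) : measurable_fun setT (fun w => psi (N w)) ->
  (forall t, 0 <= t -> `|psi t| <= C * gw t) -> rdom (fun w => g (U w) * psi (N w)).
Proof.
move=> mp bp; split; first by apply: measurable_funM => //; exact: gU_meas.
have [M [M0 HM]] := gU_bound; exists (M * C) => w.
by rewrite normrM -mulrA ler_pM// bp// nrmE_ge0.
Qed.

Definition ball_ind (r t : R) : R := if t <= r then 1 else 0.

Lemma ball_ind_meas r : measurable_fun setT (fun w => ball_ind r (N w)).
Proof.
apply: (@meas_X (fun x => if nrmE x <= r then 1 else 0)).
apply: cmeas_ifle; [exact: cmeas_nrm|exact: cmeas_cst|exact: cmeas_cst].
Qed.

Lemma ball_ind_dom r : exists C : R, forall t, 0 <= t -> `|ball_ind r t| <= C * gw t.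
Proof.
exists (expR ((r / 2) ^+ 2)) => t t0; rewrite /ball_ind; case: ifP => tr; last first.
  by rewrite normr0 mulr_ge0 ?expR_ge0.
rewrite normr1 /gw -expRD -[leLHS]expR0 ler_expR subr_ge0.
rewrite ler_sqr ?nnegrE ?divr_ge0//; last exact: le_trans tr.
by rewrite ler_pM2r.
Qed.

Lemma rdom_ball r : rdom (fun w => g (U w) * ball_ind r (N w)).
Proof.
have [C HC] := ball_ind_dom r; apply: (rdom_radial (C := C)) => //.
exact: ball_ind_meas.
Qed.

(** The ball of radius r is a dilate of the unit ball, and the angular factor is unchanged by
    dilations. *)
Lemma int_ball r : 0 < r -> I (fun w => g (U w) * ball_ind r (N w)) =
  r ^+ m * I (fun w => g (U w) * ball_ind 1 (N w)).
Proof.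
move=> r0; have rV0 : 0 < r^-1 by rewrite invr_gt0.
have := int_scale rV0 (rdom_ball 1); rewrite invrK => <-.
congr I; apply/funext => w; rewrite U_scale// N_scale//; congr (_ * _).
by rewrite /ball_ind ler_pdivrMl// mulr1.
Qed.

End Radial.

Let nice1 : nice (fun _ : 'rV[R]_m => 1) := nice_cst m 1.

Section Step.
Variables (psi : R -> R) (C : R).
Hypothesis C0 : 0 <= C.
Hypothesis cpsi : continuous psi.
Hypothesis bpsi : forall t, 0 <= t -> `|psi t| <= C * gw t ^+ 2.

(** The inner ball of the first shell is taken empty, not equal to the origin, so that the shells
    also cover t = 0. *)
Let ind0 (j : nat) (b t : R) := if j is 0%N then 0 else ball_ind b t.
(* Approximates [psi] by indicators of balls, whose integrals are known to scale like r^m. *)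
Let step (k : nat) (t : R) : R := \sum_(j <- iota 0 (k.+1 ^ 2))
  psi (j%:R / k.+1%:R) * (ball_ind (j.+1%:R / k.+1%:R) t - ind0 j (j%:R / k.+1%:R) t).
(** What [step k] becomes when each ball of radius b is replaced by its relative volume b^m. *)
Let scoef (k : nat) : R := \sum_(j <- iota 0 (k.+1 ^ 2))
  psi (j%:R / k.+1%:R) * ((j.+1%:R / k.+1%:R) ^+ m - (if j is 0%N then 0 else (j%:R / k.+1%:R) ^+ m)).

(** The shells have width 1/(k+1), and (k+1)^2 of them fill the ball of radius k+1; inside it,
    [step k] takes the value of [psi] at the inner radius s of the shell containing t. *)
Lemma step_spec k (t : R) : 0 <= t -> (k.+1%:R < t) \/
  (exists2 s, [/\ 0 <= s, s <= t & t <= s + k.+1%:R^-1] & step k t = psi s).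
Proof.
move=> t0; have [|tk] := ltP k.+1%:R t; first by left.
right; have K0 : 0 < k.+1%:R :> R by [].
have ex : exists i : nat, t <= i.+1%:R / k.+1%:R.
  exists (k.+1 ^ 2).-1; rewrite prednK ?expn_gt0//.
  by rewrite natrX expr2 mulfK ?gt_eqF.
have [i ti imin] := ex_minnP ex.
have iK : (i < k.+1 ^ 2)%N.
  rewrite -(prednK (_ : 0 < k.+1 ^ 2)%N) ?expn_gt0// ltnS; apply: imin.
  by rewrite prednK ?expn_gt0// natrX expr2 mulfK ?gt_eqF.
have le j : (t <= j.+1%:R / k.+1%:R) = (i <= j)%N.
  apply/idP/idP => [/imin//|ij]; apply: le_trans ti _.
  by rewrite ler_pM2r ?invr_gt0// ler_nat.
exists (i%:R / k.+1%:R).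
  split; first by rewrite divr_ge0.
    case: i {ti imin iK} le => [|i] le; first by rewrite mul0r.
    by rewrite leNgt; apply/negP => /ltW; rewrite le ltnn.
  by rewrite -[X in _ + X]mul1r -mulrDl natr1.
rewrite /step (bigD1_seq i) ?mem_iota ?iota_uniq//= big1 ?addr0.
  rewrite /ball_ind ti; case: i {ti imin iK} le => [|i] le; first by rewrite subr0 mulr1.
  by rewrite /ind0 /ball_ind le ltnn subr0 mulr1.
move=> j ji; rewrite /ball_ind le.
case: j ji => [|j] ji; rewrite /ind0 /ball_ind ?le.
  by rewrite leqn0 eq_sym (negbTE ji) subr0 mulr0.
by rewrite leq_eqVlt eq_sym (negbTE ji) /= ltnS subrr mulr0.
Qed.

Lemma step_out k (t : R) : k.+1%:R < t -> step k t = 0.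
Proof.
move=> kt; rewrite /step big_seq big1// => j; rewrite mem_iota add0n => /andP[_ jk].
have K0 : 0 < k.+1%:R :> R by [].
have no (i : nat) : (i <= k.+1 ^ 2)%N -> ball_ind (i%:R / k.+1%:R) t = 0.
  move=> ik; rewrite /ball_ind leNgt (le_lt_trans _ kt)//.
  by rewrite ler_pdivrMr// -expr2 -natrX ler_nat.
by rewrite no// /ind0; case: j jk => [|j] jk; rewrite ?no ?subr0 ?mulr0// ltnW.
Qed.

(** From t <= s + 1 follows t^2 <= 2 s^2 + 2, hence e^(-s^2/2) <= e^(1/2) e^(-t^2/4). Here the
    square in the bound on [psi] is spent. *)
Lemma step_bound k (t : R) : 0 <= t -> `|step k t| <= C * expR (2^-1) * gw t.
Proof.
move=> t0; have [kt|[s [s0 st ts] ->]] := step_spec k t0.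
  by rewrite step_out// normr0 !mulr_ge0 ?expR_ge0.
apply: le_trans (bpsi s0) _; rewrite -mulrA ler_wpM2l// expr2 /gw -!expRD ler_expR.
have : t <= s + 1.
  by apply: le_trans ts _; rewrite lerD2l invf_le1 ?ler1n.
move=> ts1; have h1 : t * t <= (s + 1) * (s + 1) by apply: ler_pM.
have h2 : 0 <= (s - 1) * (s - 1) by rewrite -expr2 sqr_ge0.
rewrite !expr2; move: h1 h2; move: (s : R) (t : R) => a' b'; lra.
Qed.

Lemma step_cvg (t : R) : 0 <= t -> step k t @[k --> \oo] --> psi t.
Proof.
move=> t0; apply/cvgrPdist_le => e e0.
have ct : psi x @[x --> t] --> psi t by exact: cpsi.
have /cvgrPdist_le/(_ e e0) := ct.
move=> /nbhs_ballP[del /= del0 Hd].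
have ch : harmonic n @[n --> \oo] --> (0 : R) by exact: cvg_harmonic.
have /cvgrPdist_lt/(_ del del0) hh := ch.
near=> k.
have tk : t <= k.+1%:R.
  apply: (@le_trans _ _ k%:R); last by rewrite ler_nat.
  by near: k; exact: nbhs_infty_ger.
have [|[s [s0 st ts] ->]] := step_spec k t0; first by rewrite ltNge tk.
apply: Hd; rewrite /ball/= ger0_norm ?subr_ge0//.
have : `|0 - harmonic k| < del by near: k.
rewrite sub0r normrN ger0_norm ?invr_ge0// => h.
by apply: le_lt_trans h; rewrite lerBlDl.
Unshelve. all: end_near. Qed.

Lemma int_step g k : nice g ->
  rdom (fun w => g (U w) * step k (N w)) /\
  I (fun w => g (U w) * step k (N w)) = scoef k * I (fun w => g (U w) * ball_ind 1 (N w)).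
Proof.
move=> ng.
pose F (j : nat) (w : T) := psi (j%:R / k.+1%:R) * (g (U w) * ball_ind (j.+1%:R / k.+1%:R) (N w)
   + (-1) * (g (U w) * ind0 j (j%:R / k.+1%:R) (N w))).
have -> : (fun w => g (U w) * step k (N w)) = (fun w => \sum_(j <- iota 0 (k.+1 ^ 2)) F j w).
  by apply/funext => w; rewrite /step mulr_sumr; apply: eq_bigr => j _; rewrite /F; ring.
have rI j b : rdom (fun w => g (U w) * ind0 j b (N w)).
  case: j => [|j]; last exact: rdom_ball.
  split; first by under eq_fun do rewrite /ind0 mulr0; exact: measurable_cst.
  by exists 0 => w; rewrite mulr0 normr0 mul0r.
have rF j : rdom (F j).
  by apply: rdomZ; apply: rdomD; [exact: rdom_ball|apply: rdomZ; exact: rI].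
have [rS ->] := rdom_sum (iota 0 (k.+1 ^ 2)) rF; split => //.
rewrite /scoef mulr_suml; apply: eq_bigr => j _.
rewrite /F rdom_intZ; last by apply: rdomD; [exact: rdom_ball|apply: rdomZ; exact: rI].
rewrite -mulrA; congr (_ * _).
rewrite rdom_intD; [|exact: rdom_ball|apply: rdomZ; exact: rI].
rewrite rdom_intZ; last exact: rI.
rewrite (int_ball ng (r := j.+1%:R / k.+1%:R)) ?divr_gt0//.
case: j => [|j].
  have -> : (fun w => g (U w) * ind0 0 (0%:R / k.+1%:R) (N w)) = fun=> 0.
    by apply/funext => w; rewrite /ind0 mulr0.
  by rewrite {2}/I Rintegral_cst//= mul0r mulr0 addr0 subr0.
rewrite /ind0 (int_ball ng (r := j.+1%:R / k.+1%:R)) ?divr_gt0//.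
by rewrite mulN1r mulrBl.
Qed.

Lemma int_step_cvg f : nice f ->
  I (fun w => f (U w) * step k (N w)) @[k --> \oo] --> I (fun w => f (U w) * psi (N w)).
Proof.
move=> nf; have [M [M0 HM]] := gU_bound nf.
apply: (rdom_int_cvg (C := M * (C * expR 2^-1))).
- by move=> k; have [[]] := int_step k nf.
- move=> k w; rewrite normrM -mulrA ler_pM//.
  by apply: step_bound; exact: nrmE_ge0.
- by move=> w; apply: cvgMr; apply: step_cvg; exact: nrmE_ge0.
Qed.

(** Separation of radius and direction. For [step k] both integrals are [scoef k] times an integral
    over the unit ball, so the cross-multiplied identity is exact; it passes to the limit by
    dominated convergence. *)
Lemma int_radial g : nice g ->
  I (fun w => g (U w) * psi (N w)) * I (fun w => ball_ind 1 (N w)) =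
  I (fun w => g (U w) * ball_ind 1 (N w)) * I (fun w => psi (N w)).
Proof.
move=> ng.
have n1 := nice1.
have cg := int_step_cvg ng; have c1 := int_step_cvg n1.
have e1 (h : T -> R) : I (fun w => 1 * h w) = I h.
  by congr I; apply/funext => w; rewrite mul1r.
rewrite e1 in c1.
pose V := I (fun w => ball_ind 1 (N w)).
pose B := I (fun w => g (U w) * ball_ind 1 (N w)).
have l1 : I (fun w => g (U w) * step k (N w)) * V @[k --> \oo] --> I (fun w => g (U w) * psi (N w)) * V.
  by apply: cvgM => //; exact: cvg_cst.
have l2 : B * I (fun w => 1 * step k (N w)) @[k --> \oo] --> B * I (fun w => psi (N w)).
  by apply: cvgM => //; exact: cvg_cst.
rewrite -/V -/B -(cvg_lim (@Rhausdorff R) l1) -(cvg_lim (@Rhausdorff R) l2).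
congr (limn _); apply/funext => k.
have [_ ->] := int_step k ng; have [_ ->] := int_step k n1.
rewrite e1 -/V -/B; ring.
Qed.

(** Used in contrapositive form: the Gaussian has a nonzero integral, so the unit ball has positive
    volume. *)
Lemma int_radial0 : I (fun w => ball_ind 1 (N w)) = 0 -> I (fun w => psi (N w)) = 0.
Proof.
move=> V0; have n1 := nice1.
have c1 := int_step_cvg n1.
have e1 (h : T -> R) : I (fun w => 1 * h w) = I h.
  by congr I; apply/funext => w; rewrite mul1r.
rewrite e1 in c1; rewrite -(cvg_lim (@Rhausdorff R) c1).
apply: (@lim_near_cst R) => //; apply: nearW => k.
by have [_ ->] := int_step k n1; rewrite e1 V0 mulr0.
Qed.

End Step.

Lemma ball_intE g : nice g ->
  ball_int (fun x => g ((nrmE x)^-1 *: x)) = I (fun w => g (U w) * ball_ind 1 (N w)).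
Proof.
move=> ng; rewrite /ball_int /Rm_int.
pose f (v : nat -> R) := if nrmE (\row_(i < m) v i) <= 1 then
  g ((nrmE (\row_(i < m) v i))^-1 *: (\row_(i < m) v i)) else 0.
have [C HC] := ball_ind_dom 1.
have [M HM] := ng.2.
rewrite -/f HR.
- congr I; apply/funext => w; rewrite /f /ball_ind /N /U /X.
  by case: ifP => _; rewrite ?mulr1 ?mulr0.
- apply: (@meas_X (fun x => if nrmE x <= 1 then g ((nrmE x)^-1 *: x) else 0)).
  apply: cmeas_ifle; [exact: cmeas_nrm|exact: cmeas_unit ng.1|exact: cmeas_cst].
- exists (`|M| * C) => v; rewrite prod_gw -mulrA.
  have := HC _ (nrmE_ge0 (\row_(i < m) v i)); rewrite /f /ball_ind.
  case: ifP => _ h; last by rewrite normr0 mulr_ge0// (le_trans _ h).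
  apply: (@le_trans _ _ (`|M| * 1)); last by rewrite ler_wpM2l// -[leLHS]normr1.
  by rewrite mulr1; apply: le_trans (ler_norm _); apply: HM; exact: nrmE_unit_le1.
Qed.

(** The power t^n turns a monomial of degree n in x/|x| back into one in x, whose product with
    e^(-|x|^2) factors over the coordinates. *)
Let psin n (t : R) := t ^+ n * expR (- t ^+ 2).

Lemma psin_cont n : continuous (psin n).
Proof.
move=> x; apply/differentiable_continuous/derivable1_diffP.
by have dk := is_derive_gauss n x; exact: ex_derive.
Qed.

Lemma rdom_psin n g : nice g -> rdom (fun w => g (U w) * psin n (N w)).
Proof.
move=> ng; have [C [_ HC]] := gauss_dom R n.
apply: (rdom_radial ng (C := C)) => [|t _]; last exact: HC.
apply: (@measurableT_comp _ _ _ _ _ _ (psin n) _ N); last exact: (meas_X (@cmeas_nrm R m)).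
exact: continuous_measurable_fun (@psin_cont n).
Qed.

Lemma int_psin (is_ : seq 'I_m) :
  I (fun w => (\prod_(i <- is_) U w 0 i) * psin (size is_) (N w)) =
  \prod_(j < m) gmom R (count_mem j is_).
Proof.
pose h (i : nat) (t : R) := t ^+ (count (fun j : 'I_m => val j == i) is_) * expR (- t ^+ 2).
have e0 v : \prod_(i <- is_) (\row_(j < m) v j : 'rV[R]_m) 0 i =
   \prod_(i < m) v i ^+ (count_mem i is_).
  elim: is_ {h} => [|i s IH]; first by rewrite big_nil big1.
  rewrite big_cons IH mxE /= (bigD1 i)//= [in RHS](bigD1 i)//= eqxx add1n exprS mulrA.
  congr (_ * _); apply: eq_bigr => j ji.
  by rewrite eq_sym (negbTE ji).
have eh v : 1 * \prod_(i < m) h i (v i) =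
   (\prod_(i <- is_) (\row_(j < m) v j : 'rV[R]_m) 0 i) * expR (- nrmE (\row_(j < m) v j : 'rV[R]_m) ^+ 2).
  rewrite mul1r /h big_split/= e0; congr (_ * _).
  rewrite sqr_nrmE /dotE -sumrN expR_sum; apply: eq_bigr => i _.
  by rewrite !mxE expr2.
have := @iter_int_prod R m 1 h (fun i => gauss_integrable _ _).
rewrite mul1r => <-.
have eU w : (\prod_(i <- is_) U w 0 i) * psin (size is_) (N w) = 1 * \prod_(i < m) h i (c w i).
  rewrite eh /psin mulrA; congr (_ * _).
  (* At the origin [U w] is 0: both sides vanish unless the monomial is empty, and then they
     agree. *)
  have [N0|N0] := eqVneq (N w) 0.
    have X0 : X w = 0 by apply/eqP; rewrite -nrmE_eq0 -/(N w) N0.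
    rewrite N0 -/(X w) /U -/(N w) N0 X0 scaler0.
    case: is_ {h e0 eh} => [|i s]; first by rewrite !big_nil mulr1.
    by rewrite !big_cons /= expr0n mulr0 mxE mul0r.
  rewrite -/(X w) /U -/(N w); elim: is_ {h e0 eh} => [|i s IH].
    by rewrite !big_nil mul1r.
  rewrite !big_cons -IH /= exprS [in LHS]mxE; move: (\prod_(j <- s) _) => P.
  by move: (N w ^+ size s) => Q; field.
have r1 : rdom (fun w => (\prod_(i <- is_) U w 0 i) * psin (size is_) (N w)).
  apply: (@rdom_psin _ (fun x => \prod_(i <- is_) x 0 i)).
  by apply: nice_prod => i; exact: nice_coord.
rewrite HR.
- by congr I; apply/funext => w; rewrite eU.
- by have [mr _] := r1; move: mr; under eq_fun do rewrite eU.
- have /choice[C HC] := fun i => gauss_dom R (count (fun j : 'I_m => val j == i) is_).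
  exists (\prod_(i < m) C i) => v; rewrite mul1r normr_prod -big_split/=.
  by apply: ler_prod => i _; rewrite normr_ge0/=; exact: (HC i).2.
Qed.

Lemma ball_ind_int_gt0 : 0 < I (fun w => ball_ind 1 (N w)).
Proof.
rewrite lt_def; apply/andP; split; last first.
  by apply: Rintegral_ge0 => w _; rewrite /ball_ind; case: ifP.
apply/eqP => V0; have [C [C0 HC]] := gauss_dom2 R 0.
have := int_radial0 C0 (@psin_cont 0) (fun t _ => HC t) V0.
have := int_psin [::]; rewrite /=.
under [in X in X = _ -> _]eq_fun do rewrite big_nil mul1r.
move=> -> /eqP; apply/negP; rewrite prodf_seq_neq0.
by apply/allP => j _ /=; rewrite gt_eqF// gmom0_gt0.
Qed.

Lemma ball1_gt0 : 0 < ball_int (fun _ : 'rV[R]_m => 1).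
Proof.
have := ball_intE nice1 => /= ->.
under [X in I X]eq_fun do rewrite mul1r.
exact: ball_ind_int_gt0.
Qed.

(** The integrand is at least e^(-4) on the shell 1 < |x| <= 2, whose volume is 2^m - 1 times that
    of the unit ball. *)
Lemma Rn_gt0 n : 0 < I (fun w => psin n (N w)).
Proof.
pose a := expR (- 4) : R.
have e1 (h : T -> R) : (fun w => 1 * h w) = h by apply/funext => w; rewrite mul1r.
have b2 := rdom_ball nice1 2; have b1 := rdom_ball nice1 1; rewrite !e1 in b1 b2.
have rp := rdom_psin n nice1; rewrite e1 in rp.
have rl : rdom (fun w => a * (ball_ind 2 (N w) + (-1) * ball_ind 1 (N w))).
  by apply: rdomZ; apply: rdomD => //; exact: rdomZ.
have le : I (fun w => a * (ball_ind 2 (N w) + (-1) * ball_ind 1 (N w))) <= I (fun w => psin n (N w)).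
  apply: le_Rintegral => //; [exact: rdom_integrable|exact: rdom_integrable|].
  move=> w _; rewrite /ball_ind /psin; have := nrmE_ge0 (X w); rewrite -/(N w) => N0.
  have p0 : 0 <= N w ^+ n * expR (- N w ^+ 2) by rewrite mulr_ge0 ?expR_ge0 ?exprn_ge0.
  case: (leP (N w) 1) => [l1|l1].
    by rewrite (le_trans l1) ?ler1n// mulr1 subrr mulr0.
  case: ifP => l2; last by rewrite mulr0 addr0 mulr0.
  rewrite mulr0 addr0 mulr1 /a -[leLHS]mul1r ler_pM ?expR_ge0//.
    by rewrite exprn_ege1// ltW.
  by rewrite ler_expR lerN2 -[4](_ : 2 ^+ 2 = 4 :> R) ?ler_sqr ?nnegrE//; ring.
apply: lt_le_trans le; rewrite rdom_intZ; last by apply: rdomD => //; exact: rdomZ.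
rewrite rdom_intD//; last exact: rdomZ.
rewrite rdom_intZ//.
have := int_ball nice1 (ltr0n R 2); rewrite !e1 => ->.
rewrite mulr_gt0 ?expR_gt0// mulN1r subr_gt0 ltr_pMl ?ball_ind_int_gt0//.
by rewrite exprn_egt1 ?ltr1n// -lt0n.
Qed.

Lemma sph_avgE g : nice g -> sph_avg g =
  I (fun w => g (U w) * ball_ind 1 (N w)) / I (fun w => ball_ind 1 (N w)).
Proof.
move=> ng; rewrite /sph_avg ball_intE//; congr (_ / _).
have := ball_intE nice1 => /= ->.
by congr I; apply/funext => w; rewrite mul1r.
Qed.

Lemma sph_avg_monom_model (is_ : seq 'I_m) :
  sph_avg (fun x : 'rV[R]_m => \prod_(i <- is_) x 0 i) * I (fun w => psin (size is_) (N w)) =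
  \prod_(j < m) gmom R (count_mem j is_).
Proof.
have nq : nice (fun x : 'rV[R]_m => \prod_(i <- is_) x 0 i).
  by apply: nice_prod => i; exact: nice_coord.
rewrite sph_avgE// -int_psin.
have [C [C0 HC]] := gauss_dom2 R (size is_).
have := int_radial C0 (@psin_cont (size is_)) (fun t _ => HC t) nq.
have := ball_ind_int_gt0; move: (I _) (I _) (I _) (I _) => a b e f f0 h.
by rewrite -mulrA [_^-1 * a]mulrC mulrA -h mulfK// gt_eqF.
Qed.

Lemma sph_avg_lin_model (a b : R) (f g : 'rV[R]_m -> R) : nice f -> nice g ->
  sph_avg (fun x => a * f x + b * g x) = a * sph_avg f + b * sph_avg g.
Proof.
move=> nf ng.
have nfg : nice (fun x => a * f x + b * g x).
  by apply: niceD; apply: niceM => //; exact: nice_cst.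
rewrite !sph_avgE//.
have -> : (fun w => (a * f (U w) + b * g (U w)) * ball_ind 1 (N w)) =
  fun w => a * (f (U w) * ball_ind 1 (N w)) + b * (g (U w) * ball_ind 1 (N w)).
  by apply/funext => w; ring.
rewrite rdom_intD; [|by apply: rdomZ; exact: rdom_ball|by apply: rdomZ; exact: rdom_ball].
rewrite !rdom_intZ; [|exact: rdom_ball|exact: rdom_ball].
by rewrite mulrDl !mulrA.
Qed.

Lemma sph_avg_cvg_model (f_ : nat -> 'rV[R]_m -> R) f (M : R) :
  (forall n, cmeas (f_ n)) -> (forall n x, nrmE x <= 1 -> `|f_ n x| <= M) ->
  nice f -> (forall x, nrmE x <= 1 -> f_ n x @[n --> \oo] --> f x) ->
  sph_avg (f_ n) @[n --> \oo] --> sph_avg f.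
Proof.
move=> mf bf nf cf.
have nf_ n : nice (f_ n) by split => //; exists M; exact: bf.
rewrite sph_avgE//.
have -> : (fun n => sph_avg (f_ n)) = fun n =>
    I (fun w => f_ n (U w) * ball_ind 1 (N w)) / I (fun w => ball_ind 1 (N w)).
  by apply/funext => n; rewrite sph_avgE.
apply: cvgM; last exact: cvg_cst.
have [C HC] := ball_ind_dom 1.
apply: (rdom_int_cvg (C := M * C)).
- by move=> n; have [] := rdom_ball (nf_ n) 1.
- move=> n w; rewrite normrM -mulrA ler_pM//; [|exact/HC/nrmE_ge0].
  exact/bf/nrmE_unit_le1.
- move=> w; apply: cvgM; last exact: cvg_cst.
  exact/cf/nrmE_unit_le1.
Qed.

(** The condition U = 0 singles out the origin, which lies in the balls of radius 1 and 2 alike; by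
    dilation its measure equals 2^m times itself. *)
Lemma sph_avg_pt_model : sph_avg (fun x : 'rV[R]_m => if nrmE x <= 0 then 1 else 0) = 0.
Proof.
have ng : nice (fun x : 'rV[R]_m => if nrmE x <= 0 then 1 else 0).
  split; first by apply: cmeas_ifle; [exact: cmeas_nrm|exact: cmeas_cst|exact: cmeas_cst].
  by exists 1 => x _; case: ifP; rewrite ?normr1 ?normr0.
rewrite sph_avgE//; set B := I _.
suff -> : B = 0 by rewrite mul0r.
have h := int_ball ng (ltr0n R 2); rewrite -/B in h.
have h2 : I (fun w => (if nrmE (U w) <= 0 then 1 else 0) * ball_ind 2 (N w)) = B.
  congr I; apply/funext => w; rewrite /ball_ind.
  have [X0|X0] := eqVneq (X w) 0.
    have -> : N w = 0 by apply/eqP; rewrite nrmE_eq0 X0.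
    by rewrite ler01 ler0n.
  by rewrite /U nrmE_unit// (_ : (1 <= 0 :> R) = false) ?mul0r// ler10.
move/eqP: h; rewrite h2 -subr_eq0 -{1}[B]mul1r -mulrBl mulf_eq0 subr_eq0 => /orP[|/eqP//].
by rewrite eq_sym gt_eqF// exprn_egt1 ?ltr1n// -lt0n.
Qed.

End SphereModel.

(** * Averages over the sphere, independently of the model *)

Section Sphere.
Variables (R : realType) (m : nat).
Hypothesis m_gt0 : (0 < m)%N.
Implicit Types (f g : 'rV[R]_m -> R).

Lemma sph_avg_lin (a b : R) f g : nice f -> nice g ->
  sph_avg (fun x => a * f x + b * g x) = a * sph_avg f + b * sph_avg g.
Proof.
have [d [T [mu [c [S [mc iE HR HS]]]]]] := euclid_model m (@gw_ge0 R) (gw_integrable R).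
by move=> nf ng; eapply sph_avg_lin_model; eassumption.
Qed.

Lemma sph_avg_cvg (f_ : nat -> 'rV[R]_m -> R) f (M : R) :
  (forall n, cmeas (f_ n)) -> (forall n x, nrmE x <= 1 -> `|f_ n x| <= M) ->
  nice f -> (forall x, nrmE x <= 1 -> f_ n x @[n --> \oo] --> f x) ->
  sph_avg (f_ n) @[n --> \oo] --> sph_avg f.
Proof.
have [d [T [mu [c [S [mc iE HR HS]]]]]] := euclid_model m (@gw_ge0 R) (gw_integrable R).
by move=> *; eapply sph_avg_cvg_model; eassumption.
Qed.

Lemma sph_avg_pt : sph_avg (fun x : 'rV[R]_m => if nrmE x <= 0 then 1 else 0) = 0.
Proof.
have [d [T [mu [c [S [mc iE HR HS]]]]]] := euclid_model m (@gw_ge0 R) (gw_integrable R).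
eapply sph_avg_pt_model; eassumption.
Qed.

Lemma sph_avg_monom : exists Rn : nat -> R, (forall n, 0 < Rn n) /\
  forall is_ : seq 'I_m, sph_avg (fun x : 'rV[R]_m => \prod_(i <- is_) x 0 i) * Rn (size is_) =
  \prod_(j < m) gmom R (count_mem j is_).
Proof.
have [d [T [mu [c [S [mc iE HR HS]]]]]] := euclid_model m (@gw_ge0 R) (gw_integrable R).
exists (fun n => Rintegral mu setT (fun w => nrmE (\row_(i < m) c w i) ^+ n *
  expR (- nrmE (\row_(i < m) c w i) ^+ 2))); split; last by move=> is_; eapply sph_avg_monom_model; eassumption.
by move=> n; eapply Rn_gt0; eassumption.
Qed.

Lemma sph_avg1 : sph_avg (fun _ : 'rV[R]_m => 1) = 1.
Proof.
have [d [T [mu [c [S [mc iE HR HS]]]]]] := euclid_model m (@gw_ge0 R) (gw_integrable R).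
rewrite /sph_avg divff// gt_eqF//; eapply ball1_gt0; eassumption.
Qed.

Lemma sph_avgD f g : nice f -> nice g ->
  sph_avg (fun x => f x + g x) = sph_avg f + sph_avg g.
Proof.
move=> nf ng; rewrite -[sph_avg f]mul1r -[sph_avg g]mul1r -sph_avg_lin//.
by congr sph_avg; apply/funext => x; rewrite !mul1r.
Qed.

Lemma sph_avgZ (a : R) f : nice f -> sph_avg (fun x => a * f x) = a * sph_avg f.
Proof.
move=> nf; rewrite -[RHS]addr0 -[X in _ + X](mul0r (sph_avg f)) -sph_avg_lin//.
by congr sph_avg; apply/funext => x; rewrite mul0r addr0.
Qed.

Lemma sph_avg_cst (a : R) : sph_avg (fun _ : 'rV[R]_m => a) = a.
Proof.
rewrite -[RHS]mulr1 -[X in _ * X]sph_avg1 -sph_avgZ; last exact: nice_cst.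
by congr sph_avg; apply/funext => x; rewrite mulr1.
Qed.

Lemma sph_avg_sum (I : Type) (s : seq I) (f : I -> 'rV[R]_m -> R) :
  (forall i, nice (f i)) ->
  sph_avg (fun x => \sum_(i <- s) f i x) = \sum_(i <- s) sph_avg (f i).
Proof.
move=> nf; elim: s => [|i s IH].
  rewrite big_nil -[RHS](sph_avg_cst 0).
  by congr sph_avg; apply/funext => x; rewrite big_nil.
rewrite big_cons -IH -sph_avgD//; last exact: nice_sum.
by congr sph_avg; apply/funext => x; rewrite big_cons.
Qed.

(** The average sees values on the sphere and the value at 0, taken by x/|x| at the origin; the
    latter has weight zero by [sph_avg_pt]. A function described only on the sphere can thus be
    replaced by a nice one. *)
Lemma sph_avg_ext f g : nice f -> (forall x, nrmE x = 1 -> f x = g x) ->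
  sph_avg g = sph_avg f.
Proof.
move=> nf fg.
pose D x : R := if @nrmE R m x <= 0 then 1 else 0.
have nD : nice D.
  split; first by apply: cmeas_ifle; [exact: cmeas_nrm|exact: cmeas_cst|exact: cmeas_cst].
  by exists 1 => x _; rewrite /D; case: ifP; rewrite ?normr1 ?normr0.
have -> : sph_avg g = sph_avg (fun x => 1 * f x + (g 0 - f 0) * D x).
  rewrite /sph_avg; congr (_ / _); congr ball_int; apply/funext => x.
  have [->|x0] := eqVneq x 0.
    rewrite scaler0 /D (eqP (_ : nrmE 0 == 0)) ?nrmE_eq0// lexx.
    by rewrite mulr1 mul1r addrC subrK.
  have u1 := nrmE_unit x0; rewrite -fg// /D u1.
  by rewrite (_ : (1 <= 0 :> R) = false) ?ler10// mulr0 addr0 mul1r.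
by rewrite sph_avg_lin// sph_avg_pt mulr0 addr0 mul1r.
Qed.

End Sphere.

(** * Integration by parts on the sphere *)

Section NicePoly.
Variables (R : realType) (m : nat).
Implicit Types (f : 'rV[R]_m -> R).

Lemma nice_poly (F : {poly R}) f : nice f -> nice (fun x => F.[f x]).
Proof.
move=> nf; elim/poly_ind: F => [|F c IH].
  by apply: (nice_ext (g := fun _ => 0)) => [x|]; [rewrite horner0|exact: nice_cst].
apply: (nice_ext (g := fun x => F.[f x] * f x + c)) => [x|]; first by rewrite hornerMXaddC.
by apply: niceD; [exact: niceM|exact: nice_cst].
Qed.

Lemma nice_dotr (u : 'rV[R]_m) : nice (fun x => dotE x u).
Proof. by apply: (nice_ext (g := dotE u)) => [x|]; [rewrite dotEC|exact: nice_dot]. Qed.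

Lemma nice_dotxx : nice (fun x : 'rV[R]_m => dotE x x).
Proof. by apply: nice_sum => j; apply: niceM; exact: nice_coord. Qed.

Lemma nice_exp n f : nice f -> nice (fun x => f x ^+ n).
Proof.
move=> nf; apply: (nice_ext (g := fun x => ('X^n).[f x])) => [x|]; first by rewrite hornerXn.
exact: nice_poly.
Qed.

End NicePoly.

Ltac nice := repeat (first [exact: nice_cst | exact: nice_coord | exact: nice_dot | exact: nice_dotr
  | exact: nice_dotxx | assumption | (apply: niceD) | (apply: niceM) | (apply: nice_sum => ?)
  | (apply: nice_prod => ?) | (apply: nice_poly) | (apply: nice_exp)]).

Section Wick.
Variables (R : realType) (m : nat).
Hypothesis m_gt0 : (0 < m)%N.
Let L : ('rV[R]_m -> R) -> R := @sph_avg R m.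
Let mono (is_ : seq 'I_m) (x : 'rV[R]_m) : R := \prod_(i <- is_) x 0 i.
Let P (is_ : seq 'I_m) : R := \prod_(j < m) gmom R (count_mem j is_).

Let gprodS k is_ : 2 * P (k :: is_) = (count_mem k is_)%:R * P (rem k is_).
Proof.
rewrite /P (bigD1 k)//= eqxx add1n mulrA gmomS [in RHS](bigD1 k)//= -mulrA.
have [kin|kin] := boolP (k \in is_); last by rewrite (count_memPn kin) !mul0r.
congr (_ * (_ * _)).
  by rewrite count_rem kin /= eqxx subn1.
apply: eq_bigr => j jk; rewrite eq_sym (negbTE jk) add0n.
by rewrite count_rem kin /= eq_sym (negbTE jk) subn0.
Qed.

Lemma nice_mono is_ : nice (mono is_).
Proof. by apply: nice_prod => i; exact: nice_coord. Qed.

(** The Gaussian recursion [gmomS] in the coordinate k, divided by radial moments. Their ratio in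
    degrees n+2 and n, with n = size - 1, is (n + m)/2, whence the constant. *)
Lemma wick_coord k is_ : ((size is_)%:R + m%:R - 1) * L (fun x => x 0 k * mono is_ x) =
  (count_mem k is_)%:R * L (mono (rem k is_)).
Proof.
have [Rn [Rn0 HL]] := sph_avg_monom R m_gt0.
have LP js : L (mono js) = P js / Rn (size js).
  by rewrite /P -HL mulfK// gt_eqF.
have Lc j js : L (fun x => x 0 j * mono js x) = P (j :: js) / Rn (size js).+1.
  by rewrite -(LP (j :: js)); congr L; apply/funext => x; rewrite /mono big_cons.
have Pc j js : P (j :: js) = 2^-1 * ((count_mem j js)%:R * P (rem j js)).
  by rewrite -gprodS mulrA mulVf ?mul1r.
(* The average of [mono js] is unchanged by the factor sum x_i^2 = 1, which relates the two radial
   moments; a nonzero Gaussian moment allows the division. *)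
have RnS js : P js != 0 -> Rn (size js).+2 = ((size js)%:R + m%:R) / 2 * Rn (size js).
  move=> P0.
  have e1 : L (mono js) = \sum_(i < m) L (mono (i :: i :: js)).
    rewrite -sph_avg_sum//; last by move=> i; exact: nice_mono.
    apply: sph_avg_ext => //; first by apply: nice_sum => i; exact: nice_mono.
    move=> x x1; rewrite /mono.
    transitivity (\sum_(i < m) x 0 i * x 0 i * mono js x).
      by apply: eq_bigr => i _; rewrite !big_cons mulrA.
    by rewrite -mulr_suml -[X in X * _]/(dotE x x) -sqr_nrmE x1 expr1n mul1r.
  have e2 : \sum_(i < m) L (mono (i :: i :: js)) =
     ((size js)%:R + m%:R) / 2 * P js / Rn (size js).+2.
    rewrite (eq_bigr (fun i => ((count_mem i js)%:R + 1) / 2 * P js / Rn (size js).+2)).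
      rewrite -!mulr_suml; congr (_ / _ * _ / _).
      rewrite big_split/= sumr_const card_ord -natr_sum; congr (_ + _); congr _%:R.
      elim: js {P0 e1} => [|i js IH] /=; first by rewrite big1.
      rewrite big_split /= IH (bigD1 i)//= eqxx big1 ?addn0 ?add1n// => j ji.
      by rewrite eq_sym (negbTE ji).
    move=> i _; rewrite LP Pc /= eqxx add1n -natr1; by field; rewrite gt_eqF.
  move: e1; rewrite e2 LP => e.
  have : P js / Rn (size js) * (Rn (size js).+2 * Rn (size js) / P js) =
    ((size js)%:R + m%:R) / 2 * P js / Rn (size js).+2 * (Rn (size js).+2 * Rn (size js) / P js).
    by rewrite e.
  move: (Rn0 (size js)) (Rn0 (size js).+2); move: (Rn _) (Rn _) => r2 r1 r10 r20 h.
  have -> : r2 = P js / r1 * (r2 * r1 / P js) by field; rewrite P0 gt_eqF.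
  by rewrite h; field; rewrite P0 gt_eqF.
rewrite Lc LP Pc.
have [kin|kin] := boolP (k \in is_); last by rewrite (count_memPn kin); ring.
have sz : size is_ = (size (rem k is_)).+1.
  by rewrite size_rem// prednK//; case: (is_) kin.
rewrite sz; have [->|q0] := eqVneq (P (rem k is_)) 0; first by ring.
rewrite RnS// -natr1; have a0 := Rn0 (size (rem k is_)).
have b0 : (size (rem k is_))%:R + m%:R != 0 :> R.
  by rewrite -natrD pnatr_eq0 addn_eq0 negb_and -(lt0n m) m_gt0 orbT.
by field; rewrite b0 gt_eqF.
Qed.

(* [D u] is the derivative of [p] along [u], so that [D x x] is the Euler derivative. *)
Definition sph_ibp (p : 'rV[R]_m -> R) (D : 'rV[R]_m -> 'rV[R]_m -> R) :=
  [/\ nice p, (forall u, nice (D u)), nice (fun x => D x x) &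
   forall u, L (D u) = L (fun x => dotE u x * (D x x + (m%:R - 1) * p x))].

Lemma ibp_ext p q D D' : p =1 q -> (forall u x, D u x = D' u x) -> sph_ibp p D -> sph_ibp q D'.
Proof.
move=> /funext <- DD; suff -> : D = D' by [].
by apply/funext => u; apply/funext => x.
Qed.

Lemma ibp_lin a b p q D D' : sph_ibp p D -> sph_ibp q D' ->
  sph_ibp (fun x => a * p x + b * q x) (fun u x => a * D u x + b * D' u x).
Proof.
move=> [np nD nDx E] [nq nD' nDx' E']; split => [|u||u]; try by nice.
rewrite /L sph_avg_lin//; rewrite -/L E E' /L -sph_avg_lin//; try by nice.
by congr sph_avg; apply/funext => x; ring.
Qed.

Lemma ibp0 : sph_ibp (fun _ => 0) (fun _ _ => 0).
Proof.
split => [|u||u]; try by nice.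
by congr sph_avg; apply/funext => x; ring.
Qed.

Lemma ibp_sum (n : nat) (a : 'I_n -> R) (p : 'I_n -> 'rV[R]_m -> R) D :
  (forall i, sph_ibp (p i) (D i)) ->
  sph_ibp (fun x => \sum_(i < n) a i * p i x) (fun u x => \sum_(i < n) a i * D i u x).
Proof.
elim: n a p D => [|n IH] a p D H.
  by apply: ibp_ext ibp0 => [x|u x]; rewrite big_ord0.
have := ibp_lin (a ord0) 1 (H ord0) (IH (fun i => a (lift ord0 i)) _ _ (fun i => H (lift ord0 i))).
by apply: ibp_ext => [x|u x]; rewrite big_ord_recl mul1r.
Qed.

Let e (i : 'I_m) : 'rV[R]_m := delta_mx 0 i.
Let lin (us : seq 'rV[R]_m) (x : 'rV[R]_m) : R := \prod_(v <- us) dotE v x.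
Fixpoint dlin (us : seq 'rV[R]_m) (u x : 'rV[R]_m) : R :=
  if us is v :: us' then dotE v u * \prod_(v <- us') dotE v x + dotE v x * dlin us' u x else 0.

Lemma lin_cons v us x : lin (v :: us) x = dotE v x * lin us x.
Proof. by rewrite /lin big_cons. Qed.

Lemma dlin_cons v us u x : dlin (v :: us) u x = dotE v u * lin us x + dotE v x * dlin us u x.
Proof. by []. Qed.

Let dotE_e i x : dotE (e i) x = x 0 i.
Proof.
rewrite /dotE (bigD1 i)//= big1 ?addr0 => [|j ji]; rewrite /e mxE !eqxx /= ?mul1r//.
by rewrite (negbTE ji) mul0r.
Qed.

Lemma dotE_expand v x : dotE v x = \sum_(i < m) v 0 i * dotE (e i) x.
Proof. by apply: eq_bigr => i _; rewrite dotE_e. Qed.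

Lemma nice_lin us : nice (lin us). Proof. by rewrite /lin; nice. Qed.

Lemma nice_dlin us : (forall u, nice (dlin us u)) /\ nice (fun x => dlin us x x).
Proof.
elim: us => [|v us [IH1 IH2]] /=; split => [u|]; nice; exact: IH1.
Qed.

(** The sum of [wick_coord] over k with weights u_k; the Euler derivative of a monomial is its
    degree times itself. *)
Lemma ibp_coord is_ : sph_ibp (lin (map e is_)) (dlin (map e is_)).
Proof.
have lE js : lin (map e js) = mono js.
  by apply/funext => x; rewrite /lin /mono big_map; apply: eq_bigr => i _; rewrite dotE_e.
have dE u x : dlin (map e is_) u x = \sum_(k < m) u 0 k * ((count_mem k is_)%:R * mono (rem k is_) x).
  elim: is_ => [|i js IH] /=; first by rewrite big1// => k _; rewrite mul0r mulr0.
  rewrite IH -/(lin (map e js) x) lE !dotE_e.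
  rewrite (bigD1 i)//= [in RHS](bigD1 i)//= eqxx add1n mulrDr addrA; congr (_ + _).
    rewrite -natr1.
    have [iin|iin] := boolP (i \in js); last by rewrite (count_memPn iin); ring.
    rewrite [mono js x](_ : _ = x 0 i * mono (rem i js) x); first by ring.
    by rewrite /mono (perm_big _ (perm_to_rem iin)) big_cons.
  rewrite mulr_sumr; apply: eq_bigr => k ki; rewrite eq_sym (negbTE ki) add0n.
  by rewrite [mono (i :: _) x](_ : _ = x 0 i * mono (rem k js) x); [ring|rewrite /mono big_cons].
have dxE x : dlin (map e is_) x x = (size is_)%:R * mono is_ x.
  elim: is_ {dE} => [|i js IH] /=; first by rewrite mul0r.
  rewrite IH -/(lin (map e js) x) lE !dotE_e /mono big_cons -natr1; ring.
have [n1 n2] := nice_dlin (map e is_).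
split => // [|u]; first exact: nice_lin.
have -> : dlin (map e is_) u = fun x => \sum_(k < m) u 0 k * ((count_mem k is_)%:R * mono (rem k is_) x).
  exact/funext.
rewrite /L sph_avg_sum//; last by move=> k; nice; exact: nice_mono.
transitivity (\sum_(k < m) u 0 k * (((size is_)%:R + m%:R - 1) * L (fun x => x 0 k * mono is_ x))).
  apply: eq_bigr => k _; rewrite wick_coord /L !sph_avgZ//; try exact: nice_mono.
  by nice; exact: nice_mono.
have nk k : nice (fun x : 'rV[R]_m => u 0 k * (((size is_)%:R + m%:R - 1) * (x 0 k * mono is_ x))).
  by nice; exact: nice_mono.
transitivity (\sum_(k < m) L (fun x => u 0 k * (((size is_)%:R + m%:R - 1) * (x 0 k * mono is_ x)))).
  apply: eq_bigr => k _; rewrite /L !sph_avgZ//; nice; exact: nice_mono.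
rewrite /L -sph_avg_sum//; congr sph_avg; apply/funext => x.
rewrite dxE lE /dotE mulr_suml; apply: eq_bigr => k _; ring.
Qed.

(** Multilinearity: each v of the second list is expanded in the basis and its coordinate forms are
    moved to the first list, until only [ibp_coord] remains. *)
Lemma ibp_lin_prod is_ us : sph_ibp (fun x => lin (map e is_) x * lin us x)
  (fun u x => dlin (map e is_) u x * lin us x + lin (map e is_) x * dlin us u x).
Proof.
elim: us is_ => [|v us IH] is_.
  by apply: ibp_ext (ibp_coord is_) => [x|u x]; rewrite /lin /= !big_nil; ring.
have := ibp_sum (fun i => v 0 i) (fun i => IH (i :: is_)).
apply: ibp_ext => [x|u x].
  rewrite [in RHS]lin_cons (dotE_expand v) mulr_suml mulr_sumr; apply: eq_bigr => i _.
  by rewrite /= lin_cons; ring.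
rewrite lin_cons dlin_cons (dotE_expand v x) (dotE_expand v u).
rewrite mulrDr !mulr_suml !mulr_sumr -!big_split /=; apply: eq_bigr => i _.
by rewrite -/(lin (map e is_) x) lin_cons; ring.
Qed.

Lemma ibp_list us : sph_ibp (lin us) (dlin us).
Proof.
by apply: ibp_ext (ibp_lin_prod [::] us) => [x|u x]; rewrite /lin /= big_nil; ring.
Qed.

(** Horner induction on G: each factor X is absorbed as the linear form <z,.> into the list, which
    therefore has to be arbitrary. *)
Lemma ibp_poly1 us z (G : {poly R}) : sph_ibp (fun x => lin us x * G.[dotE z x])
  (fun u x => dlin us u x * G.[dotE z x] + lin us x * (G^`().[dotE z x] * dotE z u)).
Proof.
elim/poly_ind: G us => [|G c IH] us.
  by apply: ibp_ext ibp0 => [x|u x]; rewrite ?deriv0 !horner0; ring.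
have := ibp_lin 1 c (IH (z :: us)) (ibp_list us).
apply: ibp_ext => [x|u x]; rewrite ?derivD ?derivM ?derivX ?derivC !hornerE /=.
  by rewrite lin_cons; ring.
by rewrite lin_cons -/(lin us x); ring.
Qed.

Lemma ibp_poly us y z (F G : {poly R}) :
  sph_ibp (fun x => lin us x * F.[dotE y x] * G.[dotE z x])
  (fun u x => dlin us u x * F.[dotE y x] * G.[dotE z x] +
     lin us x * (F^`().[dotE y x] * dotE y u * G.[dotE z x] + F.[dotE y x] * (G^`().[dotE z x] * dotE z u))).
Proof.
elim/poly_ind: F us => [|F c IH] us.
  by apply: ibp_ext ibp0 => [x|u x]; rewrite ?deriv0 !horner0; ring.
have := ibp_lin 1 c (IH (y :: us)) (ibp_poly1 us z G).
apply: ibp_ext => [x|u x]; rewrite ?derivD ?derivM ?derivX ?derivC !hornerE /=.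
  by rewrite lin_cons; ring.
by rewrite lin_cons -/(lin us x); ring.
Qed.

End Wick.

(** * Gegenbauer polynomials *)

Section GegenbauerPoly.
Variable R : realType.
Implicit Types (lam : R) (k : nat).

(** The recurrence of [gegen2] run on polynomials, so that C_k can be differentiated formally. *)
Fixpoint gegP2 lam k : {poly R} * {poly R} :=
  match k with
  | 0 => (1, (2 * lam)%:P * 'X)
  | k'.+1 => let: (p, q) := gegP2 lam k' in
     (q, ((k'%:R + 2)^-1)%:P * ((2 * (k'%:R + 1 + lam))%:P * 'X * q - (k'%:R + 2 * lam)%:P * p))
  end.
Definition gegP lam k := (gegP2 lam k).1.

Lemma gegPE lam k w : (gegP lam k).[w] = gegen lam k w.
Proof.
suff H : (gegP2 lam k).1.[w] = (gegen2 lam w k).1 /\ (gegP2 lam k).2.[w] = (gegen2 lam w k).2.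
  exact: H.1.
elim: k => [|k [IH1 IH2]] /=; first by rewrite !hornerE.
case: (gegP2 lam k) (gegen2 lam w k) IH1 IH2 => [p q] [p' q'] /= h1 h2; split => //.
rewrite !hornerE h1 h2; ring.
Qed.

Lemma gegP_S lam k : gegP lam k.+1 = (gegP2 lam k).2.
Proof. by rewrite /gegP /=; case: (gegP2 lam k). Qed.

Lemma gegP0 lam : gegP lam 0 = 1. Proof. by []. Qed.
Lemma gegP1 lam : gegP lam 1 = (2 * lam)%:P * 'X. Proof. by []. Qed.

Lemma gegP_rec lam k : (k%:R + 2)%:P * gegP lam k.+2 =
  (2 * (k%:R + 1 + lam))%:P * 'X * gegP lam k.+1 - (k%:R + 2 * lam)%:P * gegP lam k.
Proof.
rewrite [gegP lam k.+2]gegP_S [gegP lam k.+1]gegP_S /gegP /=.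
case: (gegP2 lam k) => [p q] /=; rewrite mulrA -polyCM divff ?mul1r//.
Qed.

Lemma polyCI (c : R) (p q : {poly R}) : c != 0 -> c%:P * p = c%:P * q -> p = q.
Proof. by move=> c0; apply: mulfI; rewrite polyC_eq0. Qed.

Local Notation "D[ lam ] k" := ((gegP lam k)^`()) (at level 10).

Let polyCE := (polyCD, polyCM, polyCB, polyCN, polyC1, polyC0).

(** The two differential recurrences depend on each other. The second at k+1 comes from
    differentiating the three-term recurrence and eliminating C_k' by the first at k; the first at
    k+1 then uses all the others. *)
Lemma gegP_AB lam k :
  (k%:R + 1)%:P * gegP lam k.+1 = 'X * D[lam] k.+1 - D[lam] k /\
  D[lam] k.+1 = 'X * D[lam] k + (k%:R + 2 * lam)%:P * gegP lam k.
Proof.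
elim: k => [|k [A B]].
  rewrite gegP1 gegP0 !(derivM, derivC, derivX) !polyCE; split; ring.
have k2 : k%:R + 2 != 0 :> R by rewrite -natrD pnatr_eq0 addn2.
have rec := gegP_rec lam k.
have drec := congr1 deriv rec.
rewrite derivB !derivM !derivC derivX in drec.
have B' : D[lam] k.+2 = 'X * D[lam] k.+1 + (k.+1%:R + 2 * lam)%:P * gegP lam k.+1.
  apply: (polyCI k2).
  transitivity (0 * gegP lam k.+2 + (k%:R + 2)%:P * D[lam] k.+2); first by ring.
  rewrite drec.
  have -> : D[lam] k = 'X * D[lam] k.+1 - (k%:R + 1)%:P * gegP lam k.+1 by rewrite A; ring.
  rewrite -natr1 !polyCE; ring.
split => //.
have -> : (k.+1%:R + 1)%:P = (k%:R + 2)%:P :> {poly R} by rewrite -natr1 -addrA.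
rewrite rec B'.
have E : (k%:R + 2 * lam)%:P * gegP lam k = D[lam] k.+1 - 'X * D[lam] k by rewrite B; ring.
rewrite E.
have -> : D[lam] k = 'X * D[lam] k.+1 - (k%:R + 1)%:P * gegP lam k.+1 by rewrite A; ring.
rewrite -natr1 !polyCE; ring.
Qed.

Lemma gegP_XD lam k : 'X * D[lam] k.+1 = (k%:R + 1)%:P * gegP lam k.+1 + D[lam] k.
Proof. by have [-> _] := gegP_AB lam k; ring. Qed.

Lemma gegP_DD lam k : D[lam] k.+2 = (2 * (k%:R + 1 + lam))%:P * gegP lam k.+1 + D[lam] k.
Proof.
have [_ ->] := gegP_AB lam k.+1; rewrite gegP_XD -natr1 !polyCE; ring.
Qed.

(** Differentiate (1 - X^2) C_(k+1)' = (k + 2 lam) C_k - (k+1) X C_(k+1) and eliminate C_k'. *)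
Lemma gegP_ode lam k : (1 - 'X * 'X) * (D[lam] k)^`() =
  (2 * lam + 1)%:P * 'X * D[lam] k - (k%:R * (k%:R + 2 * lam))%:P * gegP lam k.
Proof.
case: k => [|k]; first by rewrite gegP0 !derivC !polyCE; ring.
have [A B] := gegP_AB lam k.
have G : (1 - 'X * 'X) * D[lam] k.+1 =
    (k%:R + 2 * lam)%:P * gegP lam k - (k%:R + 1)%:P * 'X * gegP lam k.+1.
  transitivity (D[lam] k.+1 - 'X * ('X * D[lam] k.+1)); first by ring.
  by rewrite gegP_XD {1}B; ring.
have dG := congr1 deriv G.
rewrite !(derivM, derivB, derivC, derivX) in dG.
have E : D[lam] k = 'X * D[lam] k.+1 - (k%:R + 1)%:P * gegP lam k.+1 by rewrite A; ring.
rewrite E in dG.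
transitivity ((0 - (1 * 'X + 'X * 1)) * D[lam] k.+1 + (1 - 'X * 'X) * (D[lam] k.+1)^`() +
   (1 + 1) * 'X * D[lam] k.+1); first by ring.
rewrite dG -natr1 !polyCE; ring.
Qed.

(** The derivatives C_(k+1)' satisfy the three-term recurrence of parameter lam + 1, with matching
    initial values. *)
Lemma gegP_deriv lam k : D[lam] k.+1 = (2 * lam)%:P * gegP (lam + 1) k.
Proof.
suff H : D[lam] k.+1 = (2 * lam)%:P * gegP (lam + 1) k /\
  D[lam] k.+2 = (2 * lam)%:P * gegP (lam + 1) k.+1 by exact: H.1.
elim: k => [|k [IH1 IH2]].
  have E1 : D[lam] 1 = (2 * lam)%:P * gegP (lam + 1) 0.
    by rewrite gegP1 gegP0 derivM derivC derivX; ring.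
  split => //; have [_ ->] := gegP_AB lam 1; rewrite E1 gegP0 !gegP1 !polyCE; ring.
split => //.
have k2 : k%:R + 2 != 0 :> R by rewrite -natrD pnatr_eq0 addn2.
apply: (polyCI k2); rewrite mulrCA gegP_rec.
have [A B] := gegP_AB lam k.+1; have [_ B2] := gegP_AB lam k.+2.
transitivity ((2 * (k%:R + 1 + (lam + 1)))%:P * 'X * D[lam] k.+2 -
  (k%:R + 2 * (lam + 1))%:P * D[lam] k.+1); last by rewrite IH1 IH2; ring.
rewrite B2 mulrDr [X in _ + X]mulrCA.
have -> : (k%:R + 2)%:P * gegP lam k.+2 = 'X * D[lam] k.+2 - D[lam] k.+1.
  by rewrite -A; congr (_%:P * _); rewrite -natr1; ring.
rewrite -!natr1 !polyCE; ring.
Qed.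

End GegenbauerPoly.

Section SphereForm.
Variables (R : realType) (m : nat).
Hypothesis m_gt0 : (0 < m)%N.
Implicit Types (x y u v d : 'rV[R]_m) (F G : {poly R}) (us : seq 'rV[R]_m).

(** A bilinear form in (F, G); the list holds the extra linear weights that integration by parts
    creates or removes. *)
Definition sform us x y F G : R :=
  sph_avg (fun eta => (\prod_(v <- us) dotE v eta) * F.[dotE x eta] * G.[dotE y eta]).

Lemma nice_sform us x y F G :
  nice (fun eta : 'rV[R]_m => (\prod_(v <- us) dotE v eta) * F.[dotE x eta] * G.[dotE y eta]).
Proof. nice. Qed.

Lemma sformDl us x y F F' G : sform us x y (F + F') G = sform us x y F G + sform us x y F' G.
Proof.
rewrite /sform -sph_avgD; [|exact: nice_sform|exact: nice_sform].
by congr sph_avg; apply/funext => eta; rewrite hornerD; ring.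
Qed.

Lemma sformZl us x y a F G : sform us x y (a%:P * F) G = a * sform us x y F G.
Proof.
rewrite /sform -sph_avgZ; [|exact: nice_sform].
by congr sph_avg; apply/funext => eta; rewrite hornerM hornerC; ring.
Qed.

Lemma sformC us x y F G : sform us x y F G = sform us y x G F.
Proof. by rewrite /sform; congr sph_avg; apply/funext => eta; ring. Qed.

Lemma sformDr us x y F G G' : sform us x y F (G + G') = sform us x y F G + sform us x y F G'.
Proof. by rewrite !(sformC us x y) sformDl. Qed.

Lemma sformZr us x y a F G : sform us x y F (a%:P * G) = a * sform us x y F G.
Proof. by rewrite !(sformC us x y) sformZl. Qed.

Lemma sformXl us x y F G : sform (x :: us) x y F G = sform us x y ('X * F) G.
Proof.
by rewrite /sform; congr sph_avg; apply/funext => eta; rewrite big_cons hornerM hornerX; ring.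
Qed.

Lemma sformXr us x y F G : sform (y :: us) x y F G = sform us x y F ('X * G).
Proof. by rewrite sformC sformXl sformC. Qed.

Lemma sform_swap u v x y F G : sform [:: u; v] x y F G = sform [:: v; u] x y F G.
Proof.
by rewrite /sform; congr sph_avg; apply/funext => eta; rewrite !big_cons; ring.
Qed.

Lemma sform0l us x y G : sform us x y 0 G = 0.
Proof. by have := sformZl us x y 0 0 G; rewrite mulr0 mul0r. Qed.

Lemma sform0r us x y F : sform us x y F 0 = 0.
Proof. by rewrite sformC sform0l. Qed.

Lemma sform11 x y : sform [::] x y 1 1 = 1.
Proof.
rewrite /sform -[RHS](sph_avg_cst m 1); congr sph_avg; apply/funext => eta.
by rewrite big_nil !hornerE.
Qed.

Ltac avg_merge := rewrite /sform -?sph_avgZ; try (by []); try (by nice);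
  rewrite -?sph_avgD; try (by []); try (by nice); congr sph_avg; apply/funext => eta;
  rewrite /= ?big_cons ?big_nil ?hornerM ?hornerX; ring.

Lemma sform_ibp0 d x y F G :
  dotE x d * sform [::] x y F^`() G + dotE y d * sform [::] x y F G^`() =
  sform [:: d] x y ('X * F^`()) G + sform [:: d] x y F ('X * G^`()) + (m%:R - 1) * sform [:: d] x y F G.
Proof.
have [_ _ _ /(_ d) E] := ibp_poly m_gt0 [::] x y F G.
apply: etrans (etrans _ E) _; avg_merge.
Qed.

(** Each linear weight is homogeneous of degree one, so it raises the constant m - 1 of [sform_ibp0]
    by one. *)
Lemma sform_ibp1 d u x y F G :
  dotE u d * sform [::] x y F G +
  dotE x d * sform [:: u] x y F^`() G + dotE y d * sform [:: u] x y F G^`() =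
  sform [:: d; u] x y ('X * F^`()) G + sform [:: d; u] x y F ('X * G^`()) + m%:R * sform [:: d; u] x y F G.
Proof.
have [_ _ _ /(_ d) E] := ibp_poly m_gt0 [:: u] x y F G.
apply: etrans (etrans _ E) _; avg_merge.
Qed.

Lemma sform_ibp2 d u v x y F G :
  dotE u d * sform [:: v] x y F G + dotE v d * sform [:: u] x y F G +
  dotE x d * sform [:: u; v] x y F^`() G + dotE y d * sform [:: u; v] x y F G^`() =
  sform [:: d; u; v] x y ('X * F^`()) G + sform [:: d; u; v] x y F ('X * G^`()) +
  (m%:R + 1) * sform [:: d; u; v] x y F G.
Proof.
have [_ _ _ /(_ d) E] := ibp_poly m_gt0 [:: u; v] x y F G.
apply: etrans (etrans _ E) _; avg_merge.
Qed.

End SphereForm.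

(** * Reproducing property *)

Lemma lamm_gt0 (R : realType) m : (2 < m)%N -> 0 < lamm R m.
Proof. by move=> m2; rewrite /lamm divr_gt0// subr_gt0 ltr_nat. Qed.

Lemma lamm2_ge1 (R : realType) m : (2 < m)%N -> 1 <= 2 * lamm R m.
Proof.
move=> m2; rewrite /lamm mulrCA mulfV// mulr1 lerBrDr.
by have : 3%:R <= m%:R :> R; [rewrite ler_nat|lra].
Qed.

Lemma natr_lamm (R : realType) m : m%:R = 2 * lamm R m + 2.
Proof. by rewrite /lamm; field. Qed.

Section Reproducing.
Variables (R : realType) (m : nat).
Hypothesis m_gt2 : (2 < m)%N.
Implicit Types (x y u v : 'rV[R]_m) (F G : {poly R}).
Let m_gt0 : (0 < m)%N. Proof. by case: m m_gt2. Qed.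
Let lam : R := lamm R m.
Let C (k : nat) : {poly R} := gegP lam k.
Local Notation D k := ((C k)^`()).
Local Notation D2 k := ((C k)^`()^`()).

Let lam_gt0 : 0 < lam := lamm_gt0 R m_gt2.

Let mE : m%:R = 2 * lam + 2 :> R := natr_lamm R m.

Let kl_gt0 (k : nat) : 0 < k%:R + lam.
Proof. by rewrite ltr_wpDl. Qed.

Let ev_neq (j k : nat) : j != k -> j%:R * (j%:R + 2 * lam) != k%:R * (k%:R + 2 * lam).
Proof.
move=> jk; rewrite -subr_eq0.
have -> : j%:R * (j%:R + 2 * lam) - k%:R * (k%:R + 2 * lam) = (j%:R - k%:R) * (j%:R + k%:R + 2 * lam) by ring.
rewrite mulf_neq0 ?subr_eq0 ?eqr_nat// gt_eqF//.
by have := ler0n R j; have := ler0n R k; move: lam_gt0; lra.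
Qed.

Let polyCE := (@polyCD R, @polyCM R, @polyCB R, @polyCN R, @polyC1 R, @polyC0 R).

(** The Gegenbauer operator (1 - X^2) F'' - (2 lam + 1) X F', written as a sum of constant multiples
    so that the linearity lemmas of [sform] apply. *)
Definition gegen_op (F : {poly R}) : {poly R} :=
  F^`()^`() + (-1)%:P * ('X * ('X * F^`()^`())) + (- (2 * lam + 1))%:P * ('X * F^`()).
(** The operator satisfied by derivatives: the derivative of [gegen_op F] is [gegen_op1] applied to
    F'. *)
Definition gegen_op1 (F : {poly R}) : {poly R} :=
  F^`()^`() + (-1)%:P * ('X * ('X * F^`()^`())) + (- (2 * lam + 3))%:P * ('X * F^`()) +
  (- (2 * lam + 1))%:P * F.

Lemma gegen_opE k : gegen_op (C k) = (- (k%:R * (k%:R + 2 * lam)))%:P * C k.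
Proof.
rewrite /gegen_op.
transitivity ((1 - 'X * 'X) * D2 k - (2 * lam + 1)%:P * 'X * D k); first by rewrite !polyCE; ring.
by rewrite /C gegP_ode !polyCE; ring.
Qed.

Lemma gegen_op1E k : gegen_op1 (D k) = (- (k%:R * (k%:R + 2 * lam)))%:P * D k.
Proof.
have := congr1 deriv (gegen_opE k).
rewrite /gegen_op /gegen_op1 !(derivD, derivM, derivX, derivC) => e.
apply: etrans (etrans _ e) _; rewrite !polyCE; ring.
Qed.

(** Integration by parts along x with F' in place of F. The right-hand side is symmetric in (F, x)
    and (G, y), so the operator can be moved from F to G. *)
Lemma sform_op0l x y F G : dotE x x = 1 ->
  sform [::] x y (gegen_op F) G = sform [::] x y ('X * F^`()) ('X * G^`()) -
    dotE x y * sform [::] x y F^`() G^`().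
Proof.
move=> hx; have := sform_ibp0 m_gt0 x x y F^`() G.
rewrite hx (dotEC y x) !sformXl mE /gegen_op !sformDl !sformZl; lra.
Qed.

Lemma sform_op0r x y F G : dotE y y = 1 ->
  sform [::] x y F (gegen_op G) = sform [::] x y ('X * F^`()) ('X * G^`()) -
    dotE x y * sform [::] x y F^`() G^`().
Proof.
by move=> hy; rewrite sformC sform_op0l// (dotEC y x) !(sformC [::] y x).
Qed.

(** The right-hand side is that of [sform_op1r]: under the weight <u,.> with u orthogonal to x,
    [gegen_op1] acting on F is adjoint to [gegen_op] acting on G. *)
Lemma sform_op1l x y u F G : dotE x x = 1 -> dotE u x = 0 ->
  sform [:: u] x y (gegen_op1 F) G = sform [:: u] x y ('X * F^`()) ('X * G^`()) +
    sform [:: u] x y F ('X * G^`()) - dotE x y * sform [:: u] x y F^`() G^`()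
    - dotE u y * sform [::] x y F G^`().
Proof.
move=> hx hu; have := sform_ibp1 m_gt0 x u x y F^`() G.
have := sform_ibp0 m_gt0 u x y F G.
rewrite hx hu (dotEC x u) hu (dotEC y x) (dotEC y u) !sformXl mE /gegen_op1 !sformDl !sformZl.
lra.
Qed.

Lemma sform_op1r x y u F G : dotE y y = 1 ->
  sform [:: u] x y F (gegen_op G) = sform [:: u] x y ('X * F^`()) ('X * G^`()) +
    sform [:: u] x y F ('X * G^`()) - dotE x y * sform [:: u] x y F^`() G^`()
    - dotE u y * sform [::] x y F G^`().
Proof.
move=> hy; have := sform_ibp1 m_gt0 y u x y F G^`().
rewrite hy !sformXr mE /gegen_op !sformDr !sformZr; lra.
Qed.

(** With two weights, u orthogonal to x and v orthogonal to y, [gegen_op1] is adjoint to itself;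
    [sform_op2r] has the same right-hand side. *)
Lemma sform_op2l x y u v F G : dotE x x = 1 -> dotE u x = 0 ->
  sform [:: u; v] x y (gegen_op1 F) G = sform [:: u; v] x y ('X * F^`()) ('X * G^`()) +
    sform [:: u; v] x y F ('X * G^`()) + sform [:: u; v] x y ('X * F^`()) G +
    sform [:: u; v] x y F G - dotE x y * sform [:: u; v] x y F^`() G^`()
    - dotE v x * sform [:: u] x y F^`() G - dotE u y * sform [:: v] x y F G^`()
    - dotE u v * sform [::] x y F G.
Proof.
move=> hx hu; have := sform_ibp2 m_gt0 x u v x y F^`() G.
have := sform_ibp1 m_gt0 u v x y F G.
rewrite hx hu (dotEC x u) hu (dotEC y x) (dotEC y u) (dotEC v u).
rewrite !sformXl mE /gegen_op1 !sformDl !sformZl; lra.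
Qed.

Lemma sform_op2r x y u v F G : dotE y y = 1 -> dotE v y = 0 ->
  sform [:: u; v] x y F (gegen_op1 G) = sform [:: u; v] x y ('X * F^`()) ('X * G^`()) +
    sform [:: u; v] x y F ('X * G^`()) + sform [:: u; v] x y ('X * F^`()) G +
    sform [:: u; v] x y F G - dotE x y * sform [:: u; v] x y F^`() G^`()
    - dotE v x * sform [:: u] x y F^`() G - dotE u y * sform [:: v] x y F G^`()
    - dotE u v * sform [::] x y F G.
Proof.
move=> hy hv; rewrite sformC sform_swap sform_op2l// (dotEC y x) (dotEC v u).
rewrite !(sformC _ y x) !(sform_swap v u); ring.
Qed.

Let CXD k : 'X * D k.+1 = (k%:R + 1)%:P * C k.+1 + D k.
Proof. exact: gegP_XD. Qed.

Let CDD k : D k.+2 = (2 * (k%:R + 1 + lam))%:P * C k.+1 + D k.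
Proof. exact: gegP_DD. Qed.

Let CDD2 k : D2 k.+2 = (2 * (k%:R + 1 + lam))%:P * D k.+1 + D2 k.
Proof.
by have := congr1 deriv (CDD k); rewrite !(derivD, derivM, derivC) => ->; ring.
Qed.

Let CXD2 k : 'X * D2 k.+1 = k%:R%:P * D k.+1 + D2 k.
Proof.
have := congr1 deriv (CXD k); rewrite !(derivD, derivM, derivC, derivX) => e.
transitivity (1 * D k.+1 + 'X * D2 k.+1 - D k.+1); first by ring.
rewrite e !polyCE; ring.
Qed.

Let C0 : C 0 = 1. Proof. by []. Qed.
Let D0 : D 0 = 0. Proof. by rewrite C0 derivC. Qed.
Let D1 : D 1 = (2 * lam)%:P * 1.
Proof. by rewrite /C gegP1 derivM derivC derivX; ring. Qed.

(** C_j and C_k are eigenfunctions of a symmetric operator with the distinct eigenvalues -j(j + 2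
    lam) and -k(k + 2 lam). *)
Lemma sform_orth0 x y (hx : dotE x x = 1) (hy : dotE y y = 1) j k : j != k ->
  sform [::] x y (C j) (C k) = 0.
Proof.
move=> /ev_neq jk; have := sform_op0l y (C j) (C k) hx.
rewrite -(sform_op0r x _ _ hy) !gegen_opE sformZl sformZr.
move/eqP; rewrite -subr_eq0 -mulrBl mulf_eq0 => /orP[|/eqP//].
by rewrite subr_eq0 eqr_opp (negbTE jk).
Qed.

(** Unrolling C_(j+2)' = 2(j + 1 + lam) C_(j+1) + C_j' shows that C_j' is a combination of C_i with
    i < j. The variants with weights below rest on the same remark. *)
Let low0 x y (hx : dotE x x = 1) (hy : dotE y y = 1) j k : (j <= k)%N ->
  sform [::] x y (C k) (D j) = 0.
Proof.
suff H : ((j <= k)%N -> sform [::] x y (C k) (D j) = 0) /\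
         ((j.+1 <= k)%N -> sform [::] x y (C k) (D j.+1) = 0) by exact: H.1.
elim: j => [|j [IH1 IH2]]; split => //.
- by rewrite D0 sform0r.
- by move=> k0; rewrite D1 sformZr -C0 (sform_orth0 hx hy) ?mulr0// -lt0n.
- move=> jk; rewrite CDD sformDr sformZr IH1 ?(sform_orth0 hx hy) ?mulr0 ?addr0//.
    by rewrite gtn_eqF.
  by rewrite ltnW// ltnW.
Qed.

Let low0l x y (hx : dotE x x = 1) (hy : dotE y y = 1) j k : (j <= k)%N ->
  sform [::] x y (D j) (C k) = 0.
Proof. by move=> jk; rewrite sformC low0. Qed.

Section Pair.
Variables x y : 'rV[R]_m.
Hypothesis hx : dotE x x = 1.
Hypothesis hy : dotE y y = 1.
Let w := dotE x y.

(** The two values are computed together: [sform_op0l] at C_(k+1) yields a linear equation for the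
    first in terms of the second at k and k+1, and the recurrence for C_(k+2)' advances the second
    by two. Hence the induction over two consecutive derivatives. *)
Lemma sform_diag0 k : sform [::] x y (C k) (C k) = lam / (k%:R + lam) * (C k).[w] /\
  sform [::] x y (D k) (D k) = 2 * lam * (D k).[w].
Proof.
have l0 : lam != 0 by rewrite gt_eqF.
suff H : forall k, [/\ sform [::] x y (C k) (C k) = lam / (k%:R + lam) * (C k).[w],
  sform [::] x y (D k) (D k) = 2 * lam * (D k).[w] &
  sform [::] x y (D k.+1) (D k.+1) = 2 * lam * (D k.+1).[w]] by have [] := H k.
elim => [|{}k [IH1 IH2 IH3]].
  rewrite D0 D1 C0 sform0l sformZl sformZr sform11 !hornerE ?add0r.
  by split; [field; rewrite ?add0r|ring|ring].
have I1 : sform [::] x y (C k.+1) (C k.+1) = lam / (k.+1%:R + lam) * (C k.+1).[w].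
  have e1 : w * (D k.+1).[w] = (k%:R + 1) * (C k.+1).[w] + (D k).[w].
    by have := congr1 (fun p => p.[w]) (CXD k); rewrite !hornerE.
  have e2 := sform_op0l y (C k.+1) (C k.+1) hx.
  rewrite gegen_opE sformZl !CXD !sformDl !sformDr !sformZl !sformZr (low0 hx hy) ?(low0l hx hy)// IH2 IH3 -/w in e2.
  have k0 : (k%:R + 1 : R) != 0 by rewrite natr1.
  have k1 := kl_gt0 k.+1; rewrite -natr1 in e2 k1 *.
  move: (sform _ _ _ _ _) e2 => I e2.
  have e3 : (k%:R + 1) * (2 * (k%:R + 1 + lam)) * I = 2 * lam * ((k%:R + 1) * (C k.+1).[w]).
    have := congr1 (fun t => 2 * lam * t) e1; move: e2.
    move: (D k.+1).[w] (D k).[w] (C k.+1).[w] lam => d1 d0 c l.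
    lra.
  apply: (mulfI (_ : (k%:R + 1) * (2 * (k%:R + 1 + lam)) != 0)).
    by rewrite !mulf_neq0// gt_eqF.
  by rewrite e3; field; rewrite gt_eqF.
split => //.
rewrite CDD sformDl sformZl !sformDr !sformZr I1 IH2 (low0 hx hy) ?(low0l hx hy)//.
rewrite hornerD hornerM hornerC -natr1.
move: (C k.+1).[w] (D k).[w] => c d; field.
by rewrite nat1r gt_eqF.
Qed.


Variable u : 'rV[R]_m.
Hypothesis hu : dotE u x = 0.

Lemma sform_orth1 j k : j != k -> sform [:: u] x y (D j) (C k) = 0.
Proof.
move=> /ev_neq jk; have := sform_op1l y (D j) (C k) hx hu.
rewrite -(sform_op1r x u _ _ hy) gegen_opE gegen_op1E sformZl sformZr.
move/eqP; rewrite -subr_eq0 -mulrBl mulf_eq0 => /orP[|/eqP//].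
by rewrite subr_eq0 eqr_opp (negbTE jk).
Qed.

Let low1 j k : (j <= k)%N -> sform [:: u] x y (D k) (D j) = 0.
Proof.
suff H : ((j <= k)%N -> sform [:: u] x y (D k) (D j) = 0) /\
         ((j.+1 <= k)%N -> sform [:: u] x y (D k) (D j.+1) = 0) by exact: H.1.
elim: j => [|j [IH1 IH2]]; split => //.
- by rewrite D0 sform0r.
- by move=> k0; rewrite D1 sformZr -C0 sform_orth1 ?mulr0// -lt0n.
- move=> jk; rewrite CDD sformDr sformZr IH1 ?sform_orth1 ?mulr0 ?addr0//.
    by rewrite gtn_eqF.
  by rewrite ltnW// ltnW.
Qed.

Let low1l j k : (j <= k)%N -> sform [:: u] x y (D2 j) (C k) = 0.
Proof.
suff H : ((j <= k)%N -> sform [:: u] x y (D2 j) (C k) = 0) /\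
         ((j.+1 <= k)%N -> sform [:: u] x y (D2 j.+1) (C k) = 0) by exact: H.1.
elim: j => [|j [IH1 IH2]]; split => //.
- by rewrite D0 derivC sform0l.
- by rewrite D1 mulr1 derivC sform0l.
- move=> jk; rewrite CDD2 sformDl sformZl IH1 ?sform_orth1 ?mulr0 ?addr0//.
    by rewrite ltn_eqF.
  by rewrite ltnW// ltnW.
Qed.

(** Integration by parts along u of C_k'(<x,.>) C_k(<y,.>): as u is orthogonal to x, only the
    pairing of C_k' with C_k' survives on one side, and orthogonality collapses the other to the
    factor 2(k + lam). *)
Lemma sform_diag1 k : sform [:: u] x y (D k) (C k) = lam / (k%:R + lam) * dotE u y * (D k).[w].
Proof.
case: k => [|k]; first by rewrite D0 sform0l horner0 mulr0.
have := sform_ibp0 m_gt0 u x y (D k.+1) (C k.+1).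
rewrite (dotEC x u) hu mul0r add0r (dotEC y u) (sform_diag0 k.+1).2.
rewrite CXD2 CXD sformDl !sformDr sformZl sformZr low1l// low1// mE !addr0 => e.
apply: (mulfI (_ : 2 * (k.+1%:R + lam) != 0)); first by rewrite mulf_neq0// gt_eqF.
transitivity (dotE u y * (2 * lam * (D k.+1).[w])); last by field; rewrite nat1r gt_eqF.
rewrite e -natr1; ring.
Qed.

Lemma sform_diag1D k : sform [:: u] x y (D2 k) (D k) = 2 * lam * dotE u y * (D2 k).[w].
Proof.
suff H : sform [:: u] x y (D2 k) (D k) = 2 * lam * dotE u y * (D2 k).[w] /\
  sform [:: u] x y (D2 k.+1) (D k.+1) = 2 * lam * dotE u y * (D2 k.+1).[w] by exact: H.1.
elim: k => [|k [IH1 IH2]].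
  by rewrite D0 D1 mulr1 !derivC !sform0l horner0 mulr0.
split => //; rewrite CDD2 CDD sformDl sformZl !sformDr !sformZr IH1 sform_diag1 low1// low1l//.
rewrite hornerD hornerM hornerC -natr1.
by move: (D k.+1).[w] (D2 k).[w] => c d; field; rewrite nat1r gt_eqF.
Qed.

Variable v : 'rV[R]_m.
Hypothesis hv : dotE v y = 0.

Lemma sform_orth2 j k : j != k -> sform [:: u; v] x y (D j) (D k) = 0.
Proof.
move=> /ev_neq jk; have := sform_op2l y v (D j) (D k) hx hu.
rewrite -(sform_op2r x u _ _ hy hv) !gegen_op1E sformZl sformZr.
move/eqP; rewrite -subr_eq0 -mulrBl mulf_eq0 => /orP[|/eqP//].
by rewrite subr_eq0 eqr_opp (negbTE jk).
Qed.

Let low2 j k : (j <= k)%N -> sform [:: u; v] x y (D2 j) (D k) = 0 /\ sform [:: u; v] x y (D k) (D2 j) = 0.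
Proof.
suff H : ((j <= k)%N -> sform [:: u; v] x y (D2 j) (D k) = 0 /\ sform [:: u; v] x y (D k) (D2 j) = 0) /\
  ((j.+1 <= k)%N -> sform [:: u; v] x y (D2 j.+1) (D k) = 0 /\ sform [:: u; v] x y (D k) (D2 j.+1) = 0) by exact: H.1.
elim: j => [|j [IH1 IH2]]; split => //.
- by rewrite D0 derivC sform0l sform0r.
- by rewrite D1 mulr1 derivC sform0l sform0r.
- move=> jk; have [|h1 h2] := IH1; first by rewrite ltnW// ltnW.
  rewrite CDD2 sformDl sformDr sformZl sformZr h1 h2 !sform_orth2 ?mulr0 ?addr0//.
    by rewrite gtn_eqF.
  by rewrite ltn_eqF.
Qed.

(** Integration by parts along v, orthogonal to y, reduces two weights to the pairings with at most
    one weight found above. *)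
Lemma sform_diag2 k : sform [:: u; v] x y (D k) (D k) =
  lam / (k%:R + lam) * (dotE u v * (D k).[w] + dotE v x * dotE u y * (D2 k).[w]).
Proof.
case: k => [|k]; first by rewrite D0 derivC sform0l !horner0 !mulr0 addr0 mulr0.
have := sform_ibp1 m_gt0 v u x y (D k.+1) (D k.+1).
rewrite (dotEC y v) hv mul0r addr0 (dotEC x v) (sform_diag0 k.+1).2 sform_diag1D sform_swap.
rewrite !CXD2 !sformDl !sformDr !sformZl !sformZr !(sform_swap v u).
have [-> ->] := low2 (leqnSn k); rewrite mE !addr0 => e.
apply: (mulfI (_ : 2 * (k.+1%:R + lam) != 0)); first by rewrite mulf_neq0// gt_eqF.
transitivity (dotE u v * (2 * lam * (D k.+1).[w]) + dotE v x * (2 * lam * dotE u y * (D2 k.+1).[w]));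
  last by field; rewrite nat1r gt_eqF.
rewrite e -natr1; ring.
Qed.

End Pair.
End Reproducing.

(** * Clifford algebra *)

Section Clifford.
Variables (R : realType) (m : nat).
Local Notation set := {set 'I_m}.
Implicit Types (A B : set) (f g h : Cl R m) (x y : 'rV[R]_m) (i j : 'I_m).

Let in_symdiff A B p : (p \in symdiff A B) = (p \in A) (+) (p \in B).
Proof. by rewrite /symdiff !inE; case: (p \in A); case: (p \in B). Qed.

Let symdiffA A B (D : set) : symdiff A (symdiff B D) = symdiff (symdiff A B) D.
Proof. by apply/setP => p; rewrite !in_symdiff addbA. Qed.

Let symdiffC A B : symdiff A B = symdiff B A.
Proof. by apply/setP => p; rewrite !in_symdiff addbC. Qed.

Let symdiff0 A : symdiff finset.set0 A = A.
Proof. by apply/setP => p; rewrite !in_symdiff inE. Qed.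

Let symdiffK A : involutive (symdiff A).
Proof. by move=> B; apply/setP => p; rewrite !in_symdiff addbA addbb. Qed.

Let symdiff_eq A B (D : set) : (symdiff A B == D) = (B == symdiff A D).
Proof. by rewrite (can2_eq (symdiffK A) (symdiffK A)). Qed.

(** Strict pairs record the transpositions and equal pairs the squares e_i^2 = -1; merged in one
    product over pairs, the sign becomes multiplicative in each argument for the symmetric
    difference. *)
Lemma clsignE A B : clsign R A B =
  \prod_(p : 'I_m * 'I_m) (-1) ^+ ([&& p.1 \in A, p.2 \in B & (p.2 <= p.1)%N] : nat).
Proof.
rewrite /clsign exprD -!prodr_const.
rewrite [in X in X * _]big_mkcond/= [X in _ * X]big_mkcond/=.
have -> : \prod_(i : 'I_m) (if i \in A :&: B then -1 else 1) =
  \prod_(p : 'I_m * 'I_m) (if [&& p.1 \in A, p.2 \in B & p.1 == p.2] then -1 else 1 : R[i]).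
  rewrite -(pair_bigA _ (fun i j : 'I_m => if [&& i \in A, j \in B & i == j] then -1 else 1 : R[i]))/=.
  apply: eq_bigr => i _; rewrite (bigD1 i)//= big1 ?mulr1 => [|j ji].
    by rewrite inE eqxx andbT.
  by rewrite (eq_sym i) (negbTE ji) !andbF.
rewrite -big_split; apply: eq_bigr => -[i j] _ /=; rewrite inE/= -val_eqE/= (leq_eqVlt j) eq_sym.
case: (i \in A); case: (j \in B) => /=; rewrite ?mul1r//.
by have [_|_|_] := ltngtP i j; rewrite /= ?mul1r ?mulr1.
Qed.

Let sign_addb (a b c : bool) :
  (-1) ^+ ((a (+) b) && c : nat) = (-1) ^+ ((a && c) + (b && c)) :> R[i].
Proof. by case: a; case: b; case: c => //; rewrite -[RHS]signr_odd. Qed.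

Lemma clsignDl A B (D : set) : clsign R (symdiff A B) D = clsign R A D * clsign R B D.
Proof.
rewrite !clsignE -big_split; apply: eq_bigr => p _ /=; rewrite in_symdiff -exprD.
exact: sign_addb.
Qed.

Lemma clsignDr A B (D : set) : clsign R D (symdiff A B) = clsign R D A * clsign R D B.
Proof.
rewrite !clsignE -big_split; apply: eq_bigr => p _ /=; rewrite in_symdiff -exprD.
by rewrite !(andbCA (p.1 \in D)); exact: sign_addb.
Qed.

Lemma clsign_sqr A B : clsign R A B * clsign R A B = 1.
Proof. by rewrite /clsign -exprD -signr_odd oddD addbb. Qed.

Lemma clsign0l A : clsign R finset.set0 A = 1.
Proof. by rewrite clsignE big1// => p _; rewrite inE. Qed.

Lemma clsign0r A : clsign R A finset.set0 = 1.
Proof. by rewrite clsignE big1// => p _; rewrite !inE andbF. Qed.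

Lemma clmulE f g (D : set) :
  clmul f g D = \sum_(A : set) clsign R A (symdiff A D) * f A * g (symdiff A D).
Proof.
rewrite ffunE; apply: eq_bigr => A _.
rewrite (bigD1 (symdiff A D))//= symdiffK eqxx big1 ?addr0// => B.
by rewrite symdiff_eq => /negbTE ->.
Qed.

(** By bimultiplicativity of the sign, the two sides carry the same sign factors up to a square. *)
Lemma clmulA : associative (@clmul R m).
Proof.
move=> f g h; apply/ffunP => D; rewrite !clmulE.
under eq_bigr do rewrite clmulE mulr_sumr.
under [RHS]eq_bigr do rewrite clmulE mulr_sumr mulr_suml.
rewrite [RHS]exchange_big; apply: eq_bigr => A _ /=.
rewrite (reindex_inj (can_inj (symdiffK A))); apply: eq_bigr => B _ /=.
have -> : symdiff (symdiff A B) (symdiff A D) = symdiff B D.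
  by rewrite (symdiffC A B) -symdiffA symdiffK.
rewrite !(clsignDl, clsignDr).
set s1 := clsign R A A; set s2 := clsign R A D; set s3 := clsign R A B.
set s4 := clsign R B B; set s5 := clsign R B D.
transitivity (s2 * s2 * (s1 * s3 * s4 * s5 * f A * g (symdiff A B) * h (symdiff B D))); first by ring.
by rewrite clsign_sqr; ring.
Qed.

Lemma cladd_ffun f g : cladd f g = (f : {ffun _}) + g.
Proof. by apply/ffunP => A; rewrite !ffunE. Qed.

Lemma clsc_mull c f : clmul (clsc m c) f = clscale c f.
Proof.
apply/ffunP => D; rewrite clmulE ffunE (bigD1 finset.set0)//= big1 => [|A A0].
  by rewrite symdiff0 clsign0l ffunE eqxx mul1r addr0.
by rewrite ffunE (negbTE A0) mulr0 mul0r.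
Qed.

Lemma clsc_mulr c f : clmul f (clsc m c) = clscale c f.
Proof.
apply/ffunP => D; rewrite clmulE ffunE (bigD1 D)//= big1 => [|A A0].
  have -> : symdiff D D = finset.set0 by apply/setP => p; rewrite in_symdiff addbb inE.
  by rewrite clsign0r ffunE eqxx mul1r addr0 mulrC.
rewrite (_ : clsc _ _ _ = 0) ?mulr0// ffunE symdiff_eq.
by rewrite (symdiffC A) symdiff0 eq_sym (negbTE A0).
Qed.

(* A copy of [Cl R m] to carry the ring structure. *)
Definition clif := Cl R m.
HB.instance Definition _ := GRing.Zmodule.copy clif {ffun set -> R[i]}.

Let cl1l : left_id (clsc m 1 : clif) (@clmul R m).
Proof. by move=> f; rewrite clsc_mull; apply/ffunP => A; rewrite ffunE mul1r. Qed.
Let cl1r : right_id (clsc m 1 : clif) (@clmul R m).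
Proof. by move=> f; rewrite clsc_mulr; apply/ffunP => A; rewrite ffunE mul1r. Qed.
Let clDl : left_distributive (@clmul R m) (+%R : clif -> clif -> clif).
Proof.
move=> f g h; apply/ffunP => D; rewrite [RHS]ffunE !clmulE -big_split.
by apply: eq_bigr => A _; rewrite /= ffunE; ring.
Qed.
Let clDr : right_distributive (@clmul R m) (+%R : clif -> clif -> clif).
Proof.
move=> f g h; apply/ffunP => D; rewrite [RHS]ffunE !clmulE -big_split.
by apply: eq_bigr => A _; rewrite /= ffunE; ring.
Qed.
HB.instance Definition _ :=
  GRing.Zmodule_isPzRing.Build clif clmulA cl1l cl1r clDl clDr.

Definition csc (c : R[i]) : clif := clsc m c.
Definition cgen (j : 'I_m) : clif := clgen R j.
Definition cvec (x : 'rV[R]_m) : clif := \sum_j csc (x 0 j)%:C * cgen j.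

Let csc_zmod : zmod_morphism csc.
Proof.
by move=> c d; apply/ffunP => A; rewrite !ffunE; case: ifP => _; rewrite ?subrr.
Qed.
Let csc_monoid : monoid_morphism csc.
Proof.
split => // c d; apply/ffunP => A; rewrite [csc c * csc d]clsc_mull !ffunE.
by case: ifP; rewrite ?mulr0.
Qed.
HB.instance Definition _ := GRing.isZmodMorphism.Build _ _ csc csc_zmod.
HB.instance Definition _ := GRing.isMonoidMorphism.Build _ _ csc csc_monoid.

Lemma cscC c (f : clif) : f * csc c = csc c * f.
Proof. by rewrite [LHS]clsc_mulr [RHS]clsc_mull. Qed.

Lemma cscE c (f : clif) A : (csc c * f) A = c * f A.
Proof. by rewrite [csc c * f]clsc_mull ffunE. Qed.

Let cgenM i j A : (cgen i * cgen j) A =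
  (if symdiff [set i]%SET [set j]%SET == A then clsign R [set i]%SET [set j]%SET else 0).
Proof.
rewrite [_ A]clmulE (bigD1 [set i]%SET)//= big1 => [|B Bi].
  rewrite addr0 !ffunE eqxx mulr1 (can2_eq (symdiffK _) (symdiffK _)) [LHS]mulrC eq_sym.
  by case: eqP => [->|_]; rewrite ?mul0r ?mul1r.
by rewrite ffunE (negbTE Bi) mulr0 mul0r.
Qed.

Lemma cgen_sqr i : cgen i * cgen i = -1.
Proof.
apply/ffunP => A; rewrite cgenM !ffunE.
have -> : symdiff [set i]%SET [set i]%SET = finset.set0 by apply/setP => p; rewrite in_symdiff addbb inE.
rewrite (eq_sym finset.set0); case: ifP => _; last by rewrite oppr0.
rewrite clsignE (bigD1 (i, i))//= big1 ?mulr1 => [|[p q] /= pq].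
  by rewrite !inE eqxx leqnn.
rewrite !inE; case: eqP => //= pi; case: eqP => //= qi.
by rewrite pi qi eqxx in pq.
Qed.

Lemma cgen_anti i j : i != j -> cgen i * cgen j = - (cgen j * cgen i).
Proof.
move=> ij; apply/ffunP => A; rewrite [RHS]ffunE !cgenM symdiffC; case: ifP => _; last by rewrite oppr0.
have H (k l : 'I_m) : clsign R [set k]%SET [set l]%SET = (-1) ^+ ((l <= k)%N : nat).
  rewrite clsignE (bigD1 (k, l))//= big1 ?mulr1 => [|[p q] /= pq].
    by rewrite !inE !eqxx.
  rewrite !inE; case: eqP => //= pi; case: eqP => //= qi.
  by rewrite pi qi eqxx in pq.
rewrite !H; move: ij; rewrite -val_eqE/=.
by case: ltngtP => //= _ _; rewrite ?expr0 ?expr1 ?opprK.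
Qed.

Let cl_addE : @cladd R m = (+%R : clif -> clif -> clif).
Proof. by apply/funext => f; apply/funext => g; exact: cladd_ffun. Qed.
Let cl_zeroE : clzero R m = 0 :> clif. Proof. by []. Qed.

Let wedge_sum x y : wedge x y = (\sum_(j < m) \sum_(k < m | (j < k)%N)
  csc ((x 0 j * y 0 k - x 0 k * y 0 j)%:C) * (cgen j * cgen k) : clif).
Proof.
rewrite /wedge cl_addE cl_zeroE; apply: eq_bigr => j _; apply: eq_bigr => k _.
by rewrite -clsc_mull.
Qed.

Definition cwedge x y : clif := wedge x y.

Lemma cwedgeC x y : cwedge x y = - cwedge y x.
Proof.
rewrite /cwedge !wedge_sum -sumrN; apply: eq_bigr => j _; rewrite -sumrN; apply: eq_bigr => k _.
have -> : y 0 j * x 0 k - y 0 k * x 0 j = - (x 0 j * y 0 k - x 0 k * y 0 j) by ring.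
by rewrite rmorphN/= rmorphN/= mulNr opprK.
Qed.

Lemma cvecM x y : cvec x * cvec y = \sum_j \sum_k csc (x 0 j * y 0 k)%:C * (cgen j * cgen k).
Proof.
rewrite /cvec mulr_suml; apply: eq_bigr => j _; rewrite mulr_sumr; apply: eq_bigr => k _.
by rewrite !rmorphM/= mulrA -(mulrA _ (cgen j)) cscC !mulrA.
Qed.

(** In xy, the diagonal terms contribute -<x,y> since e_j^2 = -1, and anticommutation folds the
    others onto j < k. All bivector computations thereby reduce to products of vectors. *)
Lemma cwedgeE x y : cwedge x y = cvec x * cvec y + csc (dotE x y)%:C.
Proof.
rewrite /cwedge wedge_sum cvecM /dotE !rmorph_sum/= -big_split/=.
pose T (j k : 'I_m) : clif := csc (x 0 j * y 0 k)%:C * (cgen j * cgen k).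
pose S := \sum_(j < m) \sum_(k < m | (j < k)%N) T j k.
pose S' := \sum_(j < m) \sum_(k < m | (k < j)%N) T j k.
transitivity (S + S').
  rewrite /S /S' [X in _ + X](exchange_big_dep predT)//= -big_split; apply: eq_bigr => j _ /=.
  rewrite -big_split; apply: eq_bigr => k jk; rewrite /T /= (cgen_anti (i := k) (j := j)).
    by rewrite rmorphB rmorphB mulrN mulrBl.
  by rewrite gt_eqF.
rewrite /S /S' -big_split; apply: eq_bigr => j _ /=.
rewrite [in RHS](bigD1 j)//= cgen_sqr mulrN1 addrAC addNr add0r.
rewrite [RHS](bigID (fun k : 'I_m => (j < k)%N))/=; congr (_ + _); apply: eq_bigl => k.
  by rewrite andb_idl// => jk; rewrite gt_eqF.
by rewrite -leqNgt ltn_neqAle.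
Qed.

Lemma cvec_anti x y : cvec y * cvec x = - (cvec x * cvec y) - csc (dotE x y)%:C *+ 2.
Proof.
have /eqP := cwedgeC y x; rewrite !cwedgeE (dotEC y x) -subr_eq0 opprK => /eqP e.
apply/eqP; rewrite -subr_eq0 -e; apply/eqP.
by rewrite mulr2n !opprD !opprK -!addrA; congr (_ + _); rewrite addrCA.
Qed.

Lemma cvec_sqr x : cvec x * cvec x = - csc (dotE x x)%:C.
Proof.
apply/eqP; rewrite -subr_eq0 opprK -cwedgeE; apply/eqP.
rewrite /cwedge wedge_sum big1// => j _; rewrite big1// => k _.
by rewrite (mulrC (x 0 k)) subrr !rmorph0 mul0r.
Qed.

Lemma cwedge_xx x : cwedge x x = 0.
Proof. by rewrite cwedgeE cvec_sqr addNr. Qed.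

Lemma cwedge_sqr x y :
  cwedge x y * cwedge x y = csc (dotE x y ^+ 2 - dotE x x * dotE y y)%:C.
Proof.
rewrite cwedgeE !rmorphB !rmorphXn !rmorphM/=.
set X := cvec x; set Y := cvec y; set S := csc (dotE x y)%:C.
have e : X * Y * (X * Y) = - (csc (dotE x x)%:C * csc (dotE y y)%:C) - (S * (X * Y)) *+ 2.
  rewrite -mulrA (mulrA Y) cvec_anti -/S mulrBl mulrBr mulNr mulrN -/X -/Y.
  rewrite -!mulrA (mulrA X X) cvec_sqr cvec_sqr mulrNN; congr (- _ - _).
  by rewrite mulrnAl mulrnAr !mulrA (cscC _ X).
rewrite mulrDl !mulrDr e (cscC _ (X * Y)) expr2 mulr2n.
move: (S * (X * Y)) (S * S) (_ * csc _) => P Q T.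
by apply/ffunP => A; rewrite !ffunE; ring.
Qed.

Lemma cvec_delta i : cvec (delta_mx 0 i) = cgen i.
Proof.
rewrite /cvec (bigD1 i)//= big1 => [|j ji]; rewrite !mxE !eqxx/= ?(negbTE ji) ?rmorph0 ?mul0r//.
by rewrite !rmorph1 mul1r addr0.
Qed.

Lemma dotE_delta i x : dotE (delta_mx 0 i) x = x 0 i.
Proof.
rewrite /dotE (bigD1 i)//= big1 => [|j ji]; rewrite !mxE !eqxx/= ?(negbTE ji) ?mul0r//.
by rewrite mul1r addr0.
Qed.

Lemma cwedge_suml x y : cwedge x y = \sum_i csc (x 0 i)%:C * cwedge (delta_mx 0 i) y.
Proof.
rewrite cwedgeE /cvec mulr_suml /dotE !rmorph_sum/= -big_split; apply: eq_bigr => i _ /=.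
by rewrite cwedgeE cvec_delta dotE_delta mulrDr mulrA !rmorphM.
Qed.

(** A contraction over the basis: e_i is moved through x and y by anticommutation, the sums of z_i
    e_i give back z, and the terms free of i are counted m times. *)
Lemma cwedge_sum_delta x y :
  \sum_i cwedge (delta_mx 0 i) x * cwedge y (delta_mx 0 i) =
  csc ((m%:R - 1) * dotE x y)%:C - csc (m%:R - 2)%:C * cwedge x y.
Proof.
set X := cvec x; set Y := cvec y; set S := csc (dotE x y)%:C.
have an z i : cgen i * cvec z = - (cvec z * cgen i) - csc (z 0 i)%:C *+ 2.
  by rewrite -(cvec_delta i) cvec_anti dotEC dotE_delta.
have t i : cwedge (delta_mx 0 i) x * cwedge y (delta_mx 0 i) =
  - (X * Y) + (X * (csc (y 0 i)%:C * cgen i)) *+ 2 - Y * (csc (x 0 i)%:C * cgen i) +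
  csc (y 0 i)%:C * cgen i * X + csc (x 0 i * y 0 i)%:C.
  have e : cgen i * X * (Y * cgen i) = - (X * Y) + (X * (csc (y 0 i)%:C * cgen i)) *+ 2 -
      (Y * (csc (x 0 i)%:C * cgen i)) *+ 2.
    rewrite an -/X mulrBl mulNr -mulrA (mulrA _ Y) an -/Y.
    rewrite mulrBl mulrBr mulNr mulrN -(mulrA Y) cgen_sqr mulrN1 mulrN opprK opprD opprK.
    rewrite !(mulrnAl, mulrnAr); congr (_ + _ - _ *+ 2).
    by rewrite !mulrA (cscC _ Y).
  rewrite !cwedgeE !cvec_delta (dotEC y) !dotE_delta -/X -/Y mulrDl !mulrDr e.
  rewrite !rmorphM/= (cscC _ (_ * X)) !mulrA (cscC _ Y) mulr2n opprD -!addrA.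
  congr (_ + _); congr (_ + _); congr (_ + _); congr (_ + _).
  by rewrite [LHS]addrCA; congr (_ + _); rewrite addrA addNr add0r.
rewrite (eq_bigr _ (fun i _ => t i)) !big_split/= !sumrN -!mulr_sumr -mulr_suml.
have -> : \sum_i csc (x 0 i * y 0 i)%:C = S by rewrite /S /dotE !rmorph_sum.
rewrite sumr_const card_ord -/(cvec y) -/(cvec x) -/X -/Y.
rewrite cwedgeE -/X -/Y -/S rmorphM/= rmorphM/= -/S.
rewrite !rmorphB/= !rmorph_nat !rmorph1 !mulrBl !mulr_natl mul1r mulrnAr.
rewrite !mulrnDl; set P := X * Y; set Q := Y * X.
apply/ffunP => A; rewrite !ffunE; ring.
Qed.

End Clifford.

(** * Gamma function and Bessel series *)

Section GammaFunction.
Variable R : realType.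
Let leb := @lebesgue_measure R.
Let D : set R := `]0%R, +oo[%classic.
Let f (s t : R) : R := t `^ (s - 1) * expR (- t).
Implicit Types s t : R.

Let mD : measurable (D : set (measurableTypeR R)).
Proof. exact: measurable_itv. Qed.

Let mf s : measurable_fun setT (f s).
Proof.
apply: measurable_funM; first exact: measurable_powR.
by apply: measurableT_comp => //; exact: measurableT_comp.
Qed.

Let f_ge0 s t : 0 <= f s t.
Proof. by rewrite mulr_ge0 ?powR_ge0 ?expR_ge0. Qed.

Let f_dom s : 1 <= s -> exists C : R, 0 <= C /\ forall t, 0 < t -> f s t <= C * expR (- (t / 2)).
Proof.
move=> s1; pose n := Num.trunc s.
have sn : s - 1 <= n%:R by rewrite lerBlDr natr1 ltW// truncnS_gt.
exists (1 + 2 ^+ n * n`!%:R); split; first by rewrite addr_ge0// mulr_ge0// exprn_ge0.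
move=> t t0; rewrite /f.
have -> : expR (- t) = expR (- (t / 2)) * expR (- (t / 2)) by rewrite -expRD; congr expR; field.
rewrite mulrA ler_wpM2r ?expR_ge0//.
have t20 : 0 <= t / 2 by rewrite divr_ge0// ltW.
have H : t `^ (s - 1) <= 1 + t ^+ n.
  have [t1|t1] := leP t 1.
    rewrite -[leLHS]addr0 lerD ?exprn_ge0 ?(ltW t0)//.
    apply: (@le_trans _ _ (1 `^ (s - 1))); last by rewrite powR1.
    rewrite ge0_ler_powR ?nnegrE ?subr_ge0//; exact: ltW.
  rewrite -[leLHS]add0r lerD// -powR_mulrn ?(ltW t0)//.
  by rewrite ler_powR// ltW.
apply: (@le_trans _ _ ((1 + t ^+ n) * expR (- (t / 2)))); first by rewrite ler_wpM2r ?expR_ge0.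
by have {1}-> : t = 2 * (t / 2); [field|exact: exprn_expRN_le].
Qed.

Lemma Gamma_integrable s : 1 <= s -> leb.-integrable D (EFin \o f s).
Proof.
move=> s1; have [C [C0 HC]] := f_dom s1.
have h0 : 0 < 2^-1 :> R by rewrite invr_gt0.
apply: (@le_integrable _ _ _ leb D _ _ (EFin \o (fun t => (C * 2) * exponential_pdf 2^-1 t))) => //.
- by apply/measurable_EFinP; exact: measurable_funTS (mf s).
- move=> t; rewrite /D/= in_itv/= andbT => t0.
  rewrite lee_fin ger0_norm// ger0_norm; last first.
    by rewrite mulr_ge0 ?exponential_pdf_ge0 ?(ltW h0)// mulr_ge0.
  apply: le_trans (HC _ t0) _; rewrite -mulrA ler_wpM2l// /exponential_pdf patchE mem_set/=; last first.
    by rewrite in_itv/= andbT ltW.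
  by rewrite mulrA mulfV// mul1r mulNr mulrC.
- apply: (integrableS measurableT) => //.
  by apply: integrable_mull => //; exact: integrable_exponential_pdf.
Qed.

(** On [1, 2] the integrand is at least e^(-2). *)
Lemma Gamma_gt0 s : 1 <= s -> 0 < Gamma s.
Proof.
move=> s1; rewrite /Gamma -/leb.
have If := Gamma_integrable s1.
have : ((expR (- 2))%:E <= \int[leb]_(x in D) (f s x)%:E)%E.
  apply: (@le_trans _ _ (\int[leb]_(x in `[1%R, 2%R]) (f s x)%:E)%E); last first.
    apply: ge0_subset_integral => //.
    - by apply/measurable_EFinP; exact: measurable_funTS (mf s).
    - by move=> x _; rewrite lee_fin f_ge0.
    - move=> x; rewrite /D /= !in_itv/= andbT => /andP[x1 _]; exact: lt_le_trans x1.
  apply: (@le_trans _ _ (\int[leb]_(x in `[1%R, 2%R]) (expR (- 2))%:E)%E).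
    have -> : (\int[leb]_(x in `[1%R, 2%R]) (expR (- 2))%:E = (expR (- 2))%:E * leb `[1%R, 2%R])%E.
      by apply: integral_cst; exact: measurable_itv.
    have -> : leb `[1%R, 2%R]%classic = 1%E.
      rewrite /leb lebesgue_measure_itv/= lte_fin ltr1n -EFinB; congr EFin; ring.
    by rewrite mule1.
  apply: ge0_le_integral => //.
  - by apply/measurable_EFinP; exact: measurable_funTS (mf s).
  - move=> x /=; rewrite in_itv/= => /andP[x1 x2]; rewrite lee_fin /f.
    rewrite -[leLHS]mul1r ler_pM ?expR_ge0 ?ler_expR ?lerN2//.
    apply: (@le_trans _ _ (x `^ 0)); first by rewrite powRr0.
    by rewrite ler_powR// subr_ge0.
have := integrable_fin_num _ If => /(_ _)/fineK <- //.
by rewrite lee_fin; apply: lt_le_trans; exact: expR_gt0.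
Qed.

Lemma GammaS s : 1 <= s -> Gamma (s + 1) = s * Gamma s.
Proof.
move=> s1; have s2 : 1 <= s + 1 by lra.
have s0 : 0 < s by lra.
pose F t := - (t `^ s * expR (- t)).
have dF (x : R) : 0 < x -> is_derive x 1 F (f (s + 1) x - s * f s x).
  move=> x0.
  have d1 : is_derive x 1 (fun t : R => t `^ s) (s * x `^ (s - 1)).
    have x0' : x \in `]0, +oo[ by rewrite in_itv/= x0.
    apply: DeriveDef; first exact: derivable_powR.
    by rewrite -derive1E; exact: powR_derive1.
  have d2 : is_derive x 1 (fun t : R => expR (- t)) (expR (- x) * (- 1)).
    by apply: (@is_derive1_comp _ expR (fun t : R => - t)).
  apply: is_derive_eq (is_deriveN (is_deriveM d1 d2)) _.
  rewrite /f addrK /GRing.scale/=; ring.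
have I2 : leb.-integrable D (EFin \o (fun t => s * f s t)).
  by apply: integrable_mull => //; exact: Gamma_integrable.
suff : Rintegral leb D (fun t => f (s + 1) t - s * f s t) = 0.
  rewrite RintegralB// ?RintegralZl//; try exact: Gamma_integrable.
  by move/eqP; rewrite subr_eq0 => /eqP.
have [C [C0 HC]] := f_dom s2.
(* The half-line is exhausted by [1/(n+2), n+2]; the offset 2 makes the interval nondegenerate
   already at n = 0. *)
apply: (@ftc_exhaust R D _ F (fun n => n.+2%:R^-1) (fun n => n.+2%:R)) => //.
- move=> n; apply: (@lt_trans _ _ 1); last by rewrite ltr1n.
  by rewrite invf_lt1// ltr1n.
- move=> n x; rewrite /D /= !in_itv/= andbT => /andP[nx _]; apply: lt_le_trans nx; by rewrite invr_gt0.
- move=> x; rewrite /D /= in_itv/= andbT => x0.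
  near=> n; rewrite /= in_itv/=; apply/andP; split.
    rewrite -[leRHS]invrK lef_pV2 ?posrE ?invr_gt0//.
    apply: (@le_trans _ _ n%:R); last by rewrite ler_nat -addn2 leq_addr.
    near: n; exact: nbhs_infty_ger.
  apply: (@le_trans _ _ n%:R); last by rewrite ler_nat -addn2 leq_addr.
  near: n; exact: nbhs_infty_ger.
- by move=> x; rewrite /D /= in_itv/= andbT => x0; exact: dF.
- move=> x; rewrite /D /= in_itv/= andbT => x0.
  have cf u : {for x, continuous (f u)}.
    have cp : {for x, continuous (fun t : R => t `^ (u - 1))}.
      apply/differentiable_continuous/derivable1_diffP; apply: derivable_powR.
      by rewrite in_itv/= x0.
    have ce : {for x, continuous (fun t : R => expR (- t))}.
      apply: (@continuous_comp _ _ _ -%R expR); first exact: opp_continuous.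
      exact: continuous_expR.
    exact: cvgM cp ce.
  by apply: cvgB; [exact: cf|apply: cvgM; [exact: cvg_cst|exact: cf]].
- exact: (integrableB mD (Gamma_integrable s2) I2).
- have Fneg t : F t = - f (s + 1) t by rewrite /F /f addrK.
  have F0 (u : nat -> R) (K : R) : (forall n, 0 <= f (s + 1) (u n) <= K * harmonic n) ->
      F (u n) @[n --> \oo] --> 0.
    move=> uK; rewrite -oppr0; under eq_cvg do rewrite Fneg; apply: cvgN.
    apply: (@squeeze_cvgr _ _ _ _ (fun=> 0) (fun n => K * harmonic n)).
    + by apply: nearW => n; exact: uK.
    + exact: cvg_cst.
    + by rewrite -[X in _ --> X](mulr0 K); apply: cvgMr; exact: cvg_harmonic.
  rewrite -(subr0 0); apply: cvgB.
  + apply: (F0 _ (C * 2)) => n; rewrite f_ge0/=; apply: le_trans (HC _ _) _ => //.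
    rewrite -mulrA ler_wpM2l// expRN /harmonic/=.
    have h : n.+1%:R / 2 <= expR (n.+2%:R / 2) :> R.
      apply: le_trans (expR_ge1Dx _); rewrite -(natr1 n.+1).
      by have := ler0n R n.+1; move: (n.+1%:R : R) => v; lra.
    have -> : 2 * n.+1%:R^-1 = (n.+1%:R / 2)^-1 :> R by rewrite invfM invrK mulrC.
    by rewrite lef_pV2 ?posrE ?expR_gt0 ?divr_gt0.
  + apply: (F0 _ 1) => n; rewrite f_ge0/= mul1r /f addrK.
    have n0 : 0 < n.+2%:R^-1 :> R by rewrite invr_gt0.
    apply: (@le_trans _ _ (n.+2%:R^-1 * 1)).
      apply: ler_pM; rewrite ?powR_ge0 ?expR_ge0//.
        rewrite -[leRHS]powRr1 ?(ltW n0)//; apply: ger_powR => //.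
        by rewrite n0/= invf_le1// ler1n.
    by rewrite mulr1 /harmonic/= lef_pV2 ?posrE// ler_nat.
Unshelve. all: end_near. Qed.
End GammaFunction.

Section ExpDominated.
Variable R : realType.

Lemma series_exp_dominated (u : nat -> R) (c q : R) : 0 <= q ->
  (forall j, `|u j| <= c * (q ^+ j / j`!%:R)) ->
  cvgn (series u) /\ `|limn (series u)| <= c * expR q.
Proof.
move=> q0 uc.
have cE : (fun j => c * (q ^+ j / j`!%:R)) = c *: exp_coeff q.
  by apply/funext => j.
have cs : series (fun j => c * (q ^+ j / j`!%:R)) n @[n --> \oo] --> c * expR q.
  rewrite cE seriesZ; apply: cvgZr; exact: is_cvg_series_exp_coeff.
have cn : cvgn [normed series u].
  apply: (@series_le_cvg _ (fun j => `|u j|) (fun j => c * (q ^+ j / j`!%:R))) => // [j|].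
    exact: le_trans (normr_ge0 _) (uc j).
  by apply/cvg_ex; eexists; exact: cs.
have cu := normed_cvg cn; split => //.
apply: le_trans (lim_series_norm cn) _; rewrite -(cvg_lim _ cs)//.
by apply: lim_series_le uc => //; apply/cvg_ex; eexists; exact: cs.
Qed.

Lemma series_exp_partial (u : nat -> R) (c q : R) n : 0 <= q ->
  (forall j, `|u j| <= c * (q ^+ j / j`!%:R)) -> `|series u n| <= c * expR q.
Proof.
move=> q0 uc; have c0 : 0 <= c.
  by have := uc 0%N; rewrite expr0 fact0 divr1 mulr1; exact: le_trans.
have cs : cvgn (series (c *: exp_coeff q)).
  by rewrite seriesZ; apply: is_cvgZr; exact: is_cvg_series_exp_coeff.
have -> : c * expR q = limn (series (c *: exp_coeff q)).
  by rewrite seriesZ limZr//; exact: is_cvg_series_exp_coeff.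
apply: (@le_trans _ _ (series (c *: exp_coeff q) n)).
  rewrite /series/=; apply: le_trans (ler_norm_sum _ _ _) _; apply: ler_sum => j _.
  exact: uc.
apply: nondecreasing_cvgn_le => //; apply: nondecreasing_series => j _ _.
by apply: mulr_ge0 => //; apply: divr_ge0 => //; exact: exprn_ge0.
Qed.

End ExpDominated.

(** * Normalised Bessel series *)

Section BesselSeries.
Variables (R : realType) (lam : R).
Hypothesis lam_gt0 : 0 < lam.
Implicit Types (k j : nat) (z : R).

(** The Pochhammer symbol (lam + 1)_n, which is Gamma(n + lam + 1) / Gamma(lam + 1). *)
Definition rise n : R := \prod_(i < n) (i%:R + lam + 1).

Lemma riseS n : rise n.+1 = rise n * (n%:R + lam + 1).
Proof. by rewrite /rise big_ord_recr. Qed.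

Lemma rise_gt0 n : 0 < rise n.
Proof. by apply: prodr_gt0 => i _; have := ler0n R i; move: lam_gt0; lra. Qed.

Lemma rise_le k j : rise k <= rise (j + k).
Proof.
elim: j => [|j IH]//=; rewrite addSn riseS; apply: le_trans IH _.
by rewrite ler_peMr ?(ltW (rise_gt0 _))//; have := ler0n R (j + k); move: lam_gt0; lra.
Qed.

Lemma rise_leS k j : k.+1%:R * rise k <= rise (j.+1 + k).
Proof.
apply: (@le_trans _ _ (rise k.+1)); last by rewrite addSnnS rise_le.
rewrite riseS mulrC ler_wpM2l ?(ltW (rise_gt0 _))// -natr1; move: lam_gt0; lra.
Qed.

Lemma fact_le_rise n : n`!%:R <= rise n.
Proof.
elim: n => [|n IH]; first by rewrite /rise big_ord0.
rewrite riseS factS natrM mulrC ler_pM//.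
by rewrite -natr1; move: lam_gt0; lra.
Qed.

Lemma Gamma_rise n : Gamma (n%:R + lam + 1) = rise n * Gamma (lam + 1).
Proof.
elim: n => [|n IH]; first by rewrite /rise big_ord0 mul1r add0r.
have -> : n.+1%:R + lam + 1 = n%:R + lam + 1 + 1 by rewrite -natr1; ring.
rewrite riseS [LHS]GammaS ?IH; first by ring.
by have := ler0n R n; move: lam_gt0; lra.
Qed.

(** Terms of 2^lam Gamma(lam + 1) z^(-lam) J_(k+lam)(z), normalised so that degree 0 has value 1 at
    z = 0. The series is entire in z, so the sign of sin alpha needs no case distinction. *)
Definition gterm k z j := (-1) ^+ j * (z / 2) ^+ (2 * j + k) / (j`!%:R * rise (j + k)).
Definition gser k z := limn (series (gterm k z)).
(** The absolute value of the term j = 0. *)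
Definition glead k z := `|z / 2| ^+ k / rise k.

Lemma glead_ge0 k z : 0 <= glead k z.
Proof. by rewrite divr_ge0 ?exprn_ge0// ltW// rise_gt0. Qed.

Let gterm_norm k z j : `|gterm k z j| = glead k z * (rise k / rise (j + k)) * (((z / 2) ^+ 2) ^+ j / j`!%:R).
Proof.
rewrite /gterm !normrM normrX normrN1 expr1n mul1r normrX normfV.
rewrite [`|j`!%:R * _|]ger0_norm; last by rewrite mulr_ge0 ?(ltW (rise_gt0 _)).
rewrite exprD exprM real_normK ?num_real// /glead.
have := rise_gt0 k; have := rise_gt0 (j + k).
have : 0 < j`!%:R :> R by rewrite ltr0n fact_gt0.
move: (j`!%:R) (rise _) (rise _) => f p q f0 p0 q0.
by field; rewrite !gt_eqF.
Qed.

Let exp_coef_ge0 z j : 0 <= ((z / 2) ^+ 2) ^+ j / j`!%:R.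
Proof. by apply: divr_ge0 => //; apply: exprn_ge0; exact: sqr_ge0. Qed.

Lemma gterm_le k z j : `|gterm k z j| <= glead k z * (((z / 2) ^+ 2) ^+ j / j`!%:R).
Proof.
rewrite gterm_norm ler_wpM2r ?exp_coef_ge0//.
by rewrite ler_piMr ?glead_ge0// ler_pdivrMr ?rise_gt0// mul1r rise_le.
Qed.

Lemma is_cvg_gterm k z : cvgn (series (gterm k z)).
Proof. by have [] := series_exp_dominated (sqr_ge0 (z / 2)) (gterm_le k z). Qed.

Lemma gser_le k z : `|gser k z| <= glead k z * expR ((z / 2) ^+ 2).
Proof. by have [] := series_exp_dominated (sqr_ge0 (z / 2)) (gterm_le k z). Qed.

(** All terms after the leading one gain a factor 1/(k+1) by [rise_leS]. For fixed z and large k the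
    leading term therefore dominates, so that bounds on c_k J_(k+lam) can be turned into bounds on
    c_k. *)
Lemma gser_ge k z : glead k z - glead k z / k.+1%:R * expR ((z / 2) ^+ 2) <= `|gser k z|.
Proof.
pose v j := if j is 0 then 0 else gterm k z j.
have vb j : `|v j| <= glead k z / k.+1%:R * (((z / 2) ^+ 2) ^+ j / j`!%:R).
  case: j => [|j]; rewrite /v ?normr0.
    by apply: mulr_ge0 => //; apply: divr_ge0 => //; exact: glead_ge0.
  rewrite gterm_norm ler_wpM2r ?exp_coef_ge0//.
  (* What remains is [rise k / rise (j.+1 + k) <= 1 / k.+1]. *)
  rewrite ler_wpM2l ?glead_ge0// ler_pdivrMr ?rise_gt0// mulrC ler_pdivlMr// mulrC.
  exact: rise_leS.
have [cv vl] := series_exp_dominated (sqr_ge0 (z / 2)) vb.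
have E : limn (series v) = gser k z - gterm k z 0.
  rewrite /gser; apply: cvg_lim => //.
  have H : series (gterm k z) n - gterm k z 0 @[n --> \oo] --> limn (series (gterm k z)) - gterm k z 0.
    by apply: cvgB; [exact: is_cvg_gterm|exact: cvg_cst].
  rewrite -(cvg_shiftS (series v)).
  rewrite -(cvg_shiftS (fun n => series (gterm k z) n - gterm k z 0)) in H.
  apply: cvg_trans H; apply: near_eq_cvg; apply: nearW => n.
  by rewrite /series/= !big_nat_recl//= add0r addrC addKr.
rewrite E in vl.
have : `|gterm k z 0| = glead k z.
  by rewrite gterm_norm add0n divff ?gt_eqF ?rise_gt0// mulr1 expr0 fact0 divr1 mulr1.
have := ler_distD (gser k z) 0 (gterm k z 0).
rewrite !sub0r !normrN => h e; rewrite e in h.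
by rewrite lerBlDr; apply: le_trans h _; rewrite lerD2l.
Qed.

Let kappa : R := 2 `^ lam * Gamma (lam + 1).

Lemma kappa_gt0 : 0 < kappa.
Proof. by rewrite mulr_gt0 ?powR_gt0// Gamma_gt0//; move: lam_gt0; lra. Qed.

Let zJterm s k z j := (-1) ^+ j * z ^+ (2 * j + k - s)%N
      / (2 `^ ((2 * j + k)%:R + lam) * j`!%:R * Gamma (j%:R + k%:R + lam + 1)).

Let zJtermE k z : zJterm 0 k z = kappa^-1 *: gterm k z.
Proof.
apply/funext => j; rewrite /zJterm /gterm fctE /GRing.scale/= subn0.
rewrite -natrD Gamma_rise powRD; last by apply/implyP; rewrite pnatr_eq0.
rewrite powR_mulrn// expr_div_n /kappa.
have := rise_gt0 (j + k); have := kappa_gt0; rewrite /kappa.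
have : 0 < 2 `^ lam by rewrite powR_gt0.
have : 0 < j`!%:R :> R by rewrite ltr0n fact_gt0.
have : 0 < 2 ^+ (2 * j + k) :> R by rewrite exprn_gt0.
have : 0 < Gamma (lam + 1) by rewrite Gamma_gt0//; move: lam_gt0; lra.
move: (Gamma _) (2 `^ _) (2 ^+ _) (j`!%:R) (rise _) => G P T f p G0 T0 f0 P0 _ p0.
by field; rewrite !gt_eqF.
Qed.

Lemma zJ0E k z : kappa * zJ lam 0 k z = gser k z.
Proof.
rewrite /zJ -/(zJterm 0 k z) zJtermE seriesZ limZr; last exact: is_cvg_gterm.
by rewrite /GRing.scale/= mulrA mulfV ?mul1r// gt_eqF// kappa_gt0.
Qed.

(** Reduces the Bessel factor of B to that of A. The degree is positive, so no exponent is truncated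
    and the right-hand side vanishes at z = 0. *)
Lemma zJ1E k z : z * zJ lam 1 k.+1 z = zJ lam 0 k.+1 z.
Proof.
have [->|z0] := eqVneq z 0.
  rewrite mul0r; apply/esym; rewrite /zJ -/(zJterm 0 k.+1 0).
  have -> : zJterm 0 k.+1 0 = fun=> 0.
    by apply/funext => j; rewrite /zJterm subn0 addnS expr0n/= mulr0 mul0r.
  rewrite (_ : series _ = fun=> 0) ?lim_cst//.
  by apply/funext => n; rewrite /series/= big1.
rewrite /zJ -/(zJterm 0 k.+1 z) -/(zJterm 1 k.+1 z).
have -> : zJterm 1 k.+1 z = z^-1 *: zJterm 0 k.+1 z.
  apply/funext => j; rewrite fctE /GRing.scale/= /zJterm addnS subn0 subSS subn0 exprS.
  by rewrite [_ * (z * _)]mulrCA !mulrA mulVf// mul1r.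
rewrite seriesZ limZr; first by rewrite /GRing.scale/= mulrA mulfV ?mul1r.
by rewrite zJtermE seriesZ; apply: is_cvgZr; exact: is_cvg_gterm.
Qed.

Lemma gser0 k : gser k 0 = (k == 0)%:R.
Proof.
rewrite /gser; apply: cvg_lim => //; rewrite -cvg_shiftS/=.
apply: cvg_near_cst; apply: nearW => n; rewrite /series/= big_nat_recl//= big1 => [|j _].
  rewrite addr0 /gterm mul0r expr0 mul1r fact0 mul1r muln0 !add0n expr0n.
  by case: k => [|k]; rewrite ?mul0r// /rise big_ord0 divr1.
by rewrite /gterm mul0r expr0n mulnS !mulr0 mul0r.
Qed.

End BesselSeries.

(** * Growth of coefficients *)

Section GegenbauerBounds.
Variables (R : realType) (lam : R).
Hypothesis lam_gt0 : 0 < lam.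
Implicit Types k : nat.

Lemma gegen0 (w : R) : gegen lam 0 w = 1.
Proof. by rewrite -gegPE gegP0 hornerC. Qed.

Lemma gegen1 (w : R) : gegen lam 1 w = 2 * lam * w.
Proof. by rewrite -gegPE gegP1 !hornerE. Qed.

Lemma gegen_rec k (w : R) : (k%:R + 2) * gegen lam k.+2 w =
  2 * (k%:R + 1 + lam) * w * gegen lam k.+1 w - (k%:R + 2 * lam) * gegen lam k w.
Proof. by have := congr1 (fun p => p.[w]) (gegP_rec lam k); rewrite !hornerE !gegPE. Qed.

(** A crude bound from the three-term recurrence; only its geometric shape matters, the constant
    reappears in [rho]. *)
Lemma gegen_le k (w : R) : `|w| <= 1 -> `|gegen lam k w| <= (4 * (1 + lam)) ^+ k.
Proof.
move=> w1; set X := 4 * _.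
suff H : `|gegen lam k w| <= X ^+ k /\ `|gegen lam k.+1 w| <= X ^+ k.+1 by exact: H.1.
elim: k => [|k [IH1 IH2]].
  rewrite gegen0 gegen1 expr0 expr1 normr1; split => //.
  rewrite normrM ger0_norm; last by rewrite mulr_ge0// ltW.
  apply: (@le_trans _ _ (2 * lam * 1)); first by rewrite ler_wpM2l// mulr_ge0// ltW.
  by rewrite /X; move: lam_gt0; lra.
split => //.
have k0 := ler0n R k; have k2 : 0 < k%:R + 2 :> R by lra.
rewrite -(ler_pM2l k2) -[X in X * _ <= _](ger0_norm (ltW k2)) -normrM gegen_rec.
apply: le_trans (ler_normB _ _) _; rewrite !normrM.
have -> : `|k%:R + 1 + lam| = k%:R + 1 + lam by rewrite ger0_norm//; move: lam_gt0; lra.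
have -> : `|k%:R + 2 * lam| = k%:R + 2 * lam by rewrite ger0_norm//; move: lam_gt0; lra.
rewrite ger0_norm//.
have X0 : 0 <= X ^+ k by rewrite exprn_ge0// /X; move: lam_gt0; lra.
move: IH1 IH2; rewrite !exprS; move: X0; set Y := X ^+ k => Y0.
have : 0 <= `|gegen lam k.+1 w| by [].
move: `|gegen lam k.+1 w| `|gegen lam k w| => c1 c0 c10 IH1 IH2.
apply: (@le_trans _ _ (2 * (k%:R + 1 + lam) * (X * Y) + (k%:R + 2 * lam) * Y)).
  apply: lerD; last by rewrite ler_wpM2l//; move: lam_gt0; lra.
  rewrite -!mulrA ler_wpM2l// ler_wpM2l//; first by move: lam_gt0; lra.
  by apply: (@le_trans _ _ c1); [rewrite ler_piMl|rewrite mulrA].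
rewrite /X.
have -> : (k%:R + 2) * (4 * (1 + lam) * (4 * (1 + lam) * Y)) =
   16 * ((k%:R + 2) * ((1 + lam) * (1 + lam))) * Y by ring.
have -> : 2 * (k%:R + 1 + lam) * (4 * (1 + lam) * Y) + (k%:R + 2 * lam) * Y =
  (8 * (k%:R + 1 + lam) * (1 + lam) + (k%:R + 2 * lam)) * Y by ring.
by rewrite ler_wpM2r//; move: k0 lam_gt0; move: (k%:R : R) lam => a l; nra.
Qed.

(** By the recurrence the values at 1 increase with k. This lets the Gegenbauer factor be dropped
    from bounded terms at w = 1. *)
Lemma gegen_1_ge k : 1 <= 2 * lam -> 1 <= gegen lam k 1.
Proof.
move=> l1; suff H : 1 <= gegen lam k 1 /\ gegen lam k 1 <= gegen lam k.+1 1 by exact: H.1.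
elim: k => [|k [IH1 IH2]]; first by rewrite gegen0 gegen1 mulr1.
split; first exact: le_trans IH2.
have k0 := ler0n R k; have k2 : 0 < k%:R + 2 :> R by lra.
rewrite -(ler_pM2l k2) gegen_rec mulr1.
have := ler_wpM2l (_ : 0 <= k%:R + 2 * lam) IH2; move=> /(_ _)H.
have : (k%:R + 2 * lam) * gegen lam k 1 <= (k%:R + 2 * lam) * gegen lam k.+1 1.
  by apply: H; move: lam_gt0; lra.
lra.
Qed.

End GegenbauerBounds.

Section CoefBound.
Variables (R : realType) (lam : R).
Hypothesis lam_gt0 : 0 < lam.

(* Enlarging the radius by rho turns boundedness of the terms into geometric decay. *)
Lemma coef_bound (c P : nat -> R) (z rho B : R) : 0 < rho -> (forall k, 1 <= P k) ->
  (forall k, `|c k * (gser lam k (rho * z) * P k)| <= B) ->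
  exists M, forall k, `|c k * gser lam k z| * rho ^+ k <= M.
Proof.
move=> r0 P1 cB.
pose E := expR ((rho * z / 2) ^+ 2); pose E' := expR ((z / 2) ^+ 2).
have E0 : 0 < E by exact: expR_gt0.
have E'0 : 0 < E' by exact: expR_gt0.
(* From K on, k + 1 >= 2 E and the correction in [gser_ge] is at most half the leading term; the
   finitely many earlier terms are added to the bound at the end. *)
pose K := (Num.trunc (2 * E)).+1.
have leadE k : glead lam k (rho * z) = rho ^+ k * glead lam k z.
  by rewrite /glead -mulrA normrM (ger0_norm (ltW r0)) exprMn mulrA.
pose v k := `|c k * gser lam k z| * rho ^+ k.
have v0 k : 0 <= v k by rewrite mulr_ge0// exprn_ge0// ltW.
have B0 : 0 <= B := le_trans (normr_ge0 _) (cB 0%N).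
have late k : (K <= k)%N -> v k <= 2 * E' * B.
  move=> Kk; have hk : 2 * E <= k.+1%:R.
    apply: (@le_trans _ _ K%:R); first by rewrite ltW// truncnS_gt.
    by rewrite ler_nat ltnW.
  have h1 : glead lam k (rho * z) <= 2 * `|gser lam k (rho * z)|.
    have := gser_ge lam_gt0 k (rho * z); rewrite -/E.
    have : glead lam k (rho * z) / k.+1%:R * E <= glead lam k (rho * z) / 2.
      rewrite -mulrA ler_wpM2l ?glead_ge0// mulrC ler_pdivrMr//.
      by rewrite [leRHS]mulrC ler_pdivlMr// mulrC.
    set a := glead lam k (rho * z) / k.+1%:R * E => h1 h2.
    by move: h1 h2; move: a (glead lam k (rho * z)) `|gser lam k (rho * z)| => a g n; lra.
  rewrite /v normrM.
  apply: (@le_trans _ _ (`|c k| * (glead lam k (rho * z) * E'))).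
    rewrite -mulrA ler_wpM2l// leadE -mulrA [leRHS]mulrC ler_wpM2r ?exprn_ge0 ?(ltW r0)//.
    exact: gser_le.
  apply: (@le_trans _ _ (2 * E' * (`|c k| * `|gser lam k (rho * z)|))).
    have -> : 2 * E' * (`|c k| * `|gser lam k (rho * z)|) =
      `|c k| * (2 * `|gser lam k (rho * z)| * E') by ring.
    by rewrite ler_wpM2l// ler_wpM2r// ltW.
  rewrite ler_wpM2l ?mulr_ge0 ?(ltW E'0)//; apply: le_trans (cB k).
  rewrite !normrM mulrA ler_peMr ?mulr_ge0//.
  exact: le_trans (P1 k) (ler_norm _).
exists (2 * E' * B + \sum_(k < K) v k) => k; rewrite -/(v k).
have [Kk|kK] := leqP K k.
  by apply: le_trans (late _ Kk) _; rewrite lerDl sumr_ge0.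
rewrite (bigD1 (Ordinal kK))//= addrCA lerDl addr_ge0 ?sumr_ge0//.
by rewrite !mulr_ge0// ltW.
Qed.

End CoefBound.

(** * Termwise averaging of series of functions on the ball *)

Section BallSeries.
Variables (R : realType) (m : nat).
Implicit Types (p q : nat -> 'rV[R]_m -> R).

Definition geo_bounded p := exists M : R, forall k x, nrmE x <= 1 -> `|p k x| <= M * 2^-1 ^+ k.

(** Cut to 0 outside the unit ball, where convergence is not known, so that the sum is a pointwise
    limit of measurable functions on the whole space. *)
Definition ball_sum p x : R := limn (series (fun k => if nrmE x <= 1 then p k x else 0)).

Lemma ball_sumE p x : nrmE x <= 1 -> ball_sum p x = limn (series (p^~ x)).
Proof. by move=> x1; rewrite /ball_sum x1. Qed.

Let geo_series (u : nat -> R) (M : R) : (forall k, `|u k| <= M * 2^-1 ^+ k) ->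
  cvgn (series u) /\ forall n, `|series u n| <= 2 * M.
Proof.
move=> uM; have M0 : 0 <= M.
  by have := uM 0%N; rewrite expr0 mulr1; exact: le_trans.
have h : `|2^-1 : R| < 1 by rewrite ger0_norm// invf_lt1// ltr1n.
have hg := @cvg_geometric_series _ M _ h.
have E : M / (1 - 2^-1) = 2 * M by field.
have bn n : series (geometric M 2^-1) n <= 2 * M.
  rewrite -E -(cvg_lim _ hg)//; apply: nondecreasing_cvgn_le; last by apply/cvg_ex; eexists; exact: hg.
  by apply: nondecreasing_series => k _ _; rewrite mulr_ge0.
split.
  apply: normed_cvg; apply: (@series_le_cvg _ (fun j => `|u j|) (geometric M 2^-1)) => //.
  - by move=> k; rewrite mulr_ge0.
  - by apply/cvg_ex; eexists; exact: hg.
move=> n; apply: le_trans (bn n); rewrite /series/=.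
by apply: le_trans (ler_norm_sum _ _ _) _; apply: ler_sum => k _; exact: uM.
Qed.

Lemma cvg_ball_sum p x : geo_bounded p -> nrmE x <= 1 ->
  series (p^~ x) n @[n --> \oo] --> ball_sum p x.
Proof.
move=> [M pM] x1; rewrite ball_sumE//.
by have [] := @geo_series (p^~ x) M (fun k => pM k x x1).
Qed.

Let seriesE p x : (fun n => series (p^~ x) n) = fun n => \sum_(k < n) p k x.
Proof. by apply/funext => n; rewrite /series/= big_mkord. Qed.

Lemma nice_ball_sum p : (forall k, nice (p k)) -> geo_bounded p -> nice (ball_sum p).
Proof.
move=> np bp; have [M pM] := bp; split.
  apply: (@cmeas_cvg _ _ (fun n x => if nrmE x <= 1 then \sum_(k < n) p k x else 0)).
    move=> n; apply: cmeas_ifle; [exact: cmeas_nrm| |exact: cmeas_cst].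
    by apply: cmeas_sum => k; have [] := np k.
  move=> x; have [x1|x1] := boolP (nrmE x <= 1).
    by have := cvg_ball_sum bp x1; rewrite seriesE.
  rewrite /ball_sum (negbTE x1) (_ : series _ = fun=> 0); last first.
    by apply/funext => n; rewrite /series/= big1.
  by rewrite lim_cst//; exact: cvg_cst.
exists (2 * M) => x x1.
have h := cvg_ball_sum bp x1.
have hn : `|series (p^~ x) n| @[n --> \oo] --> `|ball_sum p x| by exact: cvg_norm.
rewrite -(cvg_lim _ hn)//.
apply: limr_le; first by apply/cvg_ex; eexists; exact: hn.
by apply: nearW => n; have [_] := @geo_series (p^~ x) M (fun k => pM k x x1); exact.
Qed.

(** For partial sums, orthogonality leaves the diagonal. The geometric bounds make the partial sums
    uniformly bounded on the ball, so dominated convergence applies to their product. *)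
Lemma sph_avg_ball_sum p q (h : nat -> R) :
  (forall k, nice (p k)) -> (forall k, nice (q k)) -> geo_bounded p -> geo_bounded q ->
  (forall k, sph_avg (fun x => p k x * q k x) = h k) ->
  (forall j k, j != k -> sph_avg (fun x => p j x * q k x) = 0) ->
  series h n @[n --> \oo] --> sph_avg (fun x => ball_sum p x * ball_sum q x).
Proof.
move=> np nq bp bq hd ho.
have [M pM] := bp; have [M' qM] := bq.
have E n : series h n = sph_avg (fun x => (\sum_(k < n) p k x) * (\sum_(k < n) q k x)).
  transitivity (sph_avg (fun x => \sum_(j < n) \sum_(k < n) p j x * q k x)).
    rewrite sph_avg_sum => [|j]; last by apply: nice_sum => k; exact: niceM.
    rewrite /series/= big_mkord; apply: eq_bigr => j _.
    rewrite sph_avg_sum => [|k]; last exact: niceM.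
    rewrite (bigD1 j)//= hd big1 ?addr0// => k kj; apply: ho.
    by rewrite eq_sym.
  congr sph_avg; apply/funext => x; rewrite mulr_suml; apply: eq_bigr => j _.
  by rewrite mulr_sumr.
suff : sph_avg (fun x => (\sum_(k < n) p k x) * (\sum_(k < n) q k x)) @[n --> \oo] -->
    sph_avg (fun x => ball_sum p x * ball_sum q x).
  by apply: cvg_trans; apply: near_eq_cvg; apply: nearW => n; rewrite E.
apply: (@sph_avg_cvg _ _ (fun n x => (\sum_(k < n) p k x) * (\sum_(k < n) q k x)) _
  (2 * M * (2 * M'))).
- move=> n; apply: cmeasM; apply: cmeas_sum => k; [by have [] := np k|by have [] := nq k].
- move=> n x x1; rewrite normrM.
  have [_ /(_ n)] := @geo_series (p^~ x) M (fun k => pM k x x1); rewrite /series/= big_mkord => h1.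
  have [_ /(_ n)] := @geo_series (q^~ x) M' (fun k => qM k x x1); rewrite /series/= big_mkord => h2.
  exact: ler_pM.
- by apply: niceM; exact: nice_ball_sum.
- by move=> x x1; apply: cvgM; rewrite -?seriesE; exact: cvg_ball_sum.
Qed.

End BallSeries.

(** * Plane waves and the addition theorem *)

Section Monomials.
Variables (R : realType) (lam : R).
Hypothesis lam_gt0 : 0 < lam.
Implicit Types (n k j : nat).
Local Notation rise := (rise lam).

(* The coefficient of C_k in x^n / n!. *)
Definition mcoef n k : R :=
  if odd (n + k) || (n < k)%N then 0 else
  (k%:R + lam) / lam * 2^-1 ^+ n / ((n - k)./2`!%:R * rise ((n - k)./2 + k)).

Lemma mcoefE k j : mcoef (2 * j + k) k =
  (k%:R + lam) / lam * 2^-1 ^+ (2 * j + k) / (j`!%:R * rise (j + k)).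
Proof.
rewrite /mcoef -addnA addnn oddD odd_double mul2n odd_double/= ltnNge leq_addl/=.
by rewrite addnK doubleK.
Qed.

Lemma mcoef_odd k j : mcoef (2 * j + k).+1 k = 0.
Proof. by rewrite /mcoef addSn -addnA addnn /= oddD odd_double mul2n odd_double. Qed.

Lemma mcoef_small n k : (n < k)%N -> mcoef n k = 0.
Proof. by rewrite /mcoef => ->; rewrite orbT. Qed.

Let rise_neq0 n : rise n != 0.
Proof. by rewrite gt_eqF// rise_gt0. Qed.

Let l_neq0 : lam != 0. Proof. by rewrite gt_eqF. Qed.

Let kl_neq0 k : k%:R + lam != 0.
Proof. by rewrite gt_eqF// ltr_wpDl. Qed.

Let f_neq0 n : n`!%:R != 0 :> R.
Proof. by rewrite pnatr_eq0 -lt0n fact_gt0. Qed.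

Let mcoef_down n k : (k%:R + 2 * lam) / (2 * (k.+1%:R + lam)) * mcoef n k.+1 =
  if odd (n.+1 + k) || (n < k.+1)%N then 0 else
  (k%:R + 2 * lam) * ((n.+1 - k)./2%:R / lam * 2^-1 ^+ n.+1 / ((n.+1 - k)./2`!%:R * rise ((n.+1 - k)./2 + k))).
Proof.
have [nk|kn] := ltnP n k.+1; first by rewrite mcoef_small// orbT mulr0.
rewrite orbF; have [ho|he] := boolP (odd _).
  by rewrite /mcoef addnS -addSn ho/= mulr0.
pose j := (n - k.+1)./2.
have nE : n = (2 * j + k.+1)%N.
  rewrite /j mul2n halfK oddB// (_ : odd n (+) odd k.+1 = false) ?subn0 ?subnK//.
  by rewrite -oddD addnS -addSn (negbTE he).
move: j nE => j nE.
have -> : (n.+1 - k = 2 * j.+1)%N by rewrite nE; lia.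
have -> : (2 * j.+1)./2 = j.+1 by rewrite mul2n doubleK.
rewrite {1}nE mcoefE factS natrM addSn -addnS -nE exprS.
have h1 := f_neq0 j; have h2 := rise_neq0 (j + k.+1); have h3 := kl_neq0 k.+1.
move: h1 h2 h3; rewrite -(natr1 j) -(natr1 k) => h1 h2 h3.
have h4 : 1 + j%:R != 0 :> R by rewrite nat1r pnatr_eq0.
have h5 : 1 + k%:R + lam != 0 by rewrite (addrC 1).
field; repeat (apply/andP; split => //).
Qed.

Let mcoef_up n k : (k%:R + 1) / (2 * (k%:R + lam)) * mcoef n k =
  if odd (n.+1 + k.+1) || (n.+1 < k.+1)%N then 0 else
  (k%:R + 1) * (((n.+1 - k.+1)./2%:R + k%:R + 1 + lam) / lam * 2^-1 ^+ n.+1 /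
    ((n.+1 - k.+1)./2`!%:R * rise ((n.+1 - k.+1)./2 + k.+1))).
Proof.
rewrite addnS addSn/= negbK ltnS subSS; have [ho|he] := boolP (odd _) => /=.
  by rewrite /mcoef ho mulr0.
case: ltnP => kn; first by rewrite mcoef_small// mulr0.
rewrite /mcoef (negbTE he) ltnNge kn/= addnS riseS exprS natrD.
set j := (_ - _)./2; set r := _ ^+ n.
have h1 := f_neq0 j; have h2 := rise_neq0 (j + k); have h3 := kl_neq0 k.
have h4 : j%:R + k%:R + lam + 1 != 0 by rewrite -natrD -addrAC natr1 kl_neq0.
field; repeat (apply/andP; split => //).
Qed.

(** Multiplication by s in the Gegenbauer basis, read on coefficients. With j = (n + 1 - k)/2 and
    over the common denominator of [mcoef n.+1 k], the neighbours contribute k(j + k + lam) and j(k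
    + 2 lam), with sum (2j + k)(k + lam), and 2j + k = n + 1. *)
Lemma mcoefS n k : (n%:R + 1) * mcoef n.+1 k =
  (if k is k'.+1 then (k'%:R + 1) / (2 * (k'%:R + lam)) * mcoef n k' else 0) +
  (k%:R + 2 * lam) / (2 * (k.+1%:R + lam)) * mcoef n k.+1.
Proof.
rewrite mcoef_down.
have -> : (if k is k'.+1 then (k'%:R + 1) / (2 * (k'%:R + lam)) * mcoef n k' else 0) =
  if odd (n.+1 + k) || (n.+1 < k)%N then 0 else
  k%:R * (((n.+1 - k)./2%:R + k%:R + lam) / lam * 2^-1 ^+ n.+1 /
    ((n.+1 - k)./2`!%:R * rise ((n.+1 - k)./2 + k))).
  case: k => [|k]; first by rewrite mul0r if_same.
  by rewrite mcoef_up -(natr1 k) addrA.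
have [ho|he] := boolP (odd _); first by rewrite /mcoef ho mulr0 addr0.
rewrite /mcoef (negbTE he)/=; have [nk|kn] := ltnP n.+1 k.
  by rewrite mulr0 (ltn_trans (ltnSn n) (ltn_trans nk (ltnSn k))) addr0.
pose j := (n.+1 - k)./2.
have nE : n.+1 = (2 * j + k)%N.
  by rewrite /j mul2n halfK oddB// -oddD (negbTE he) subn0 subnK.
have nR : n%:R + 1 = 2 * j%:R + k%:R :> R by rewrite natr1 nE natrD natrM.
rewrite -/j nR; set r := _ ^+ n.+1.
have h1 := f_neq0 j; have h2 := rise_neq0 (j + k).
case: ltnP => nk.
  have -> : j = 0%N by move: nE; lia.
  rewrite addr0 mulr0 !add0r add0n; field; repeat (apply/andP; split => //).
field; repeat (apply/andP; split => //).
Qed.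

Lemma gegen_mulX k (s : R) : s * gegen lam k s =
  (k%:R + 1) / (2 * (k%:R + lam)) * gegen lam k.+1 s +
  (if k is k'.+1 then (k'%:R + 2 * lam) / (2 * (k%:R + lam)) * gegen lam k' s else 0).
Proof.
case: k => [|k]; first by rewrite gegen0 gegen1; field.
have := gegen_rec lam k s; have h3 := kl_neq0 k.+1; rewrite -natr1 in h3 *.
have -> : k%:R + 1 + 1 = k%:R + 2 :> R by ring.
move=> e; rewrite -mulrA mulrCA -(mulrA _ _^-1) (mulrCA _ _^-1) -mulrDr.
by rewrite e; field.
Qed.

Lemma exp_gegen n N (s : R) : (n < N)%N ->
  s ^+ n / n`!%:R = \sum_(k < N) mcoef n k * gegen lam k s.
Proof.
suff H : forall n, s ^+ n / n`!%:R = \sum_(k < n.+1) mcoef n k * gegen lam k s.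
  move=> nN; rewrite H -!(big_mkord xpredT (fun k => mcoef n k * gegen lam k s)).
  rewrite (big_cat_nat (n := n.+1) (p := N))//=.
  rewrite [X in _ + X](_ : _ = 0) ?addr0//.
  rewrite big_nat big1// => k /andP[nk _].
  by rewrite mcoef_small ?mul0r.
elim => [|{}n IH].
  rewrite big_ord_recl big_ord0 gegen0 -[X in mcoef X](_ : 2 * 0 + 0 = 0)%N// mcoefE.
  by rewrite /rise big_ord0 expr0 fact0 add0r; field.
have n1 : n%:R + 1 != 0 :> R by rewrite natr1 pnatr_eq0.
apply: (mulfI n1).
have -> : (n%:R + 1) * (s ^+ n.+1 / n.+1`!%:R) = s * (s ^+ n / n`!%:R).
  rewrite exprS factS natrM -natr1; field; rewrite f_neq0/=.
  by rewrite addrC.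
rewrite IH !mulr_sumr.
under eq_bigr do rewrite mulrCA gegen_mulX mulrDr.
under [RHS]eq_bigr do rewrite mulrA mcoefS mulrDl.
rewrite !big_split/=; congr (_ + _).
  rewrite [RHS]big_ord_recl mul0r add0r; apply: eq_bigr => k _ /=.
  by rewrite mulrA (mulrC (mcoef _ _)).
rewrite [LHS]big_ord_recl mulr0 add0r.
rewrite [RHS]big_ord_recr/= mcoef_small// mulr0 mul0r addr0.
rewrite [RHS]big_ord_recr/= mcoef_small// mulr0 mul0r addr0.
by apply: eq_bigr => k _ /=; rewrite mulrA (mulrC (mcoef _ _)).
Qed.

End Monomials.

(** * Discrete dominated convergence *)

Section Tannery.
Variable R : realType.

Let geo_tail (a : nat -> R) (c : R) (K n : nat) :
  (forall k, a k <= c * 2^-1 ^+ k) -> (K <= n)%N ->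
  \sum_(k < n) a k + 2 * c * 2^-1 ^+ n <= \sum_(k < K) a k + 2 * c * 2^-1 ^+ K.
Proof.
move=> ac; elim: n => [|n IH]; first by rewrite leqn0 => /eqP ->.
rewrite leq_eqVlt => /predU1P[->//|Kn]; apply: le_trans (IH Kn).
rewrite big_ord_recr/= -addrA lerD2l exprS; have := ac n.
by move: (a n) (2^-1 ^+ n) => u v; lra.
Qed.

Let cvg_sum_ord (u : nat -> nat -> R) (v : nat -> R) K : (forall k, u n k @[n --> \oo] --> v k) ->
  \sum_(k < K) u n k @[n --> \oo] --> \sum_(k < K) v k.
Proof.
move=> uv; elim: K => [|K IH].
  by rewrite big_ord0; under eq_cvg do rewrite big_ord0; exact: cvg_cst.
by rewrite big_ord_recr; under eq_cvg do rewrite big_ord_recr; exact: cvgD.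
Qed.

Lemma tannery_geo (f : nat -> nat -> R) (F : nat -> R) (M l : R) :
  (forall k, f n k @[n --> \oo] --> F k) ->
  (forall n k, `|f n k| <= M * 2^-1 ^+ k) ->
  \sum_(k < n) f n k @[n --> \oo] --> l -> series F n @[n --> \oo] --> l.
Proof.
move=> fF fM fl.
have FM k : `|F k| <= M * 2^-1 ^+ k.
  have h : `|f n k| @[n --> \oo] --> `|F k| by apply: cvg_norm; exact: fF.
  rewrite -(cvg_lim _ h)//; apply: limr_le; first by apply/cvg_ex; eexists; exact: h.
  exact: nearW.
suff d0 : series F n - \sum_(k < n) f n k @[n --> \oo] --> 0.
  rewrite -(add0r l); apply: cvg_trans (cvgD d0 fl); apply: near_eq_cvg.
  by apply: nearW => n; rewrite subrK.
apply/cvgrPdist_le => e e0.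
(* The differences |F k - f n k| are at most 2 M 2^-k, so their tail from K on is at most twice its
   first bound. *)
have [K hK] : exists K : nat, 2 * (2 * M) * 2^-1 ^+ K <= e / 2.
  have h : 2 * (2 * M) * 2^-1 ^+ K @[K --> \oo] --> 2 * (2 * M) * 0.
    by apply: cvgMr; apply: cvg_expr; rewrite ger0_norm// invf_lt1// ltr1n.
  rewrite mulr0 in h; move/cvgrPdist_le : h => /(_ (e / 2)) [|K _ HK]; first by rewrite divr_gt0.
  exists K; apply: le_trans (HK K _) => /=; last by rewrite leqnn.
  by rewrite sub0r normrN ler_norm.
have h : \sum_(k < K) `|F k - f n k| @[n --> \oo] --> \sum_(k < K) `|F k - F k|.
  apply: (cvg_sum_ord (u := fun n k => `|F k - f n k|) (v := fun k => `|F k - F k|)) => k; apply: cvg_norm; apply: cvgB; [exact: cvg_cst|exact: fF].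
rewrite big1 in h => [|k _]; last by rewrite subrr normr0.
move/cvgrPdist_le : h => /(_ (e / 2)) h.
near=> n; rewrite sub0r normrN.
have Kn : (K <= n)%N by near: n; exact: nbhs_infty_ge.
rewrite /series/= big_mkord -sumrB; apply: le_trans (ler_norm_sum _ _ _) _.
have aM k : `|F k - f n k| <= 2 * M * 2^-1 ^+ k.
  apply: le_trans (ler_normB _ _) _; have := FM k; have := fM n k.
  by move: `|F k| `|f n k| (2^-1 ^+ k) => u v t; lra.
apply: le_trans (le_trans _ (geo_tail aM Kn)) _.
  rewrite lerDl !mulr_ge0 ?exprn_ge0//.
  by have := FM 0%N; rewrite expr0 mulr1; exact: le_trans.
have -> : e = e / 2 + e / 2 by field.
apply: lerD => //.
have : `|0 - \sum_(k < K) `|F k - f n k| | <= e / 2.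
  by near: n; apply: h; rewrite divr_gt0.
by rewrite sub0r normrN; apply: le_trans; exact: ler_norm.
Unshelve. all: end_near. Qed.

End Tannery.

(** * Gegenbauer expansion of cosine and sine *)

Section Wave.
Variables (R : realType) (lam : R).
Hypothesis lam_gt0 : 0 < lam.
Implicit Types (k n : nat) (z s : R).
Local Notation gterm := (gterm lam).
Local Notation gser := (gser lam).
Local Notation wt k := ((k%:R + lam) / lam).

Let lead_bound z : exists M : R, forall k s, `|s| <= 1 ->
  wt k * (glead lam k z * expR ((z / 2) ^+ 2)) * `|gegen lam k s| <= M * 2^-1 ^+ k.
Proof.
(* The 4 in t is 2 times 2: one factor bounds the weight by a multiple of 2^k, the other leaves
   2^-k. The factorial inside [rise] absorbs all powers. *)
pose G := 4 * (1 + lam); pose t := 4 * (`|z / 2| * G).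
exists ((1 + lam) / lam * expR ((z / 2) ^+ 2) * expR t) => k s s1.
have G0 : 0 <= G by rewrite /G; move: lam_gt0; lra.
have l0 := ltW lam_gt0.
have h1 : wt k <= (1 + lam) / lam * 2 ^+ k.
  rewrite mulrAC ler_pM2r ?invr_gt0// mulrDl mul1r lerD//.
    by rewrite -natrX ler_nat ltnW// ltn_expl.
  by rewrite ler_peMr// exprn_ege1// ler1n.
have h2 : glead lam k z <= `|z / 2| ^+ k / k`!%:R.
  rewrite /glead ler_wpM2l ?exprn_ge0// lef_pV2 ?posrE ?rise_gt0 ?ltr0n ?fact_gt0//.
  exact: fact_le_rise.
have h3 := gegen_le lam_gt0 k s1.
have h4 : t ^+ k / k`!%:R <= expR t.
  rewrite ler_pdivrMr ?ltr0n ?fact_gt0// mulrC; apply: exprn_le_expR.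
  by apply: mulr_ge0 => //; exact: mulr_ge0.
have w0 : 0 <= wt k by rewrite divr_ge0// addr_ge0.
apply: (@le_trans _ _ ((1 + lam) / lam * 2 ^+ k *
    (`|z / 2| ^+ k / k`!%:R * expR ((z / 2) ^+ 2)) * G ^+ k)).
  apply: ler_pM => //.
    by rewrite mulr_ge0// mulr_ge0 ?glead_ge0 ?expR_ge0.
  apply: ler_pM => //; first by rewrite mulr_ge0 ?glead_ge0 ?expR_ge0.
  by rewrite ler_wpM2r ?expR_ge0.
have -> : (1 + lam) / lam * 2 ^+ k * (`|z / 2| ^+ k / k`!%:R * expR ((z / 2) ^+ 2)) * G ^+ k =
  (1 + lam) / lam * expR ((z / 2) ^+ 2) * (t ^+ k / k`!%:R) * 2^-1 ^+ k.
  have E2 : 2 ^+ k = 4 ^+ k * 2^-1 ^+ k :> R by rewrite -exprMn; congr (_ ^+ k); field.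
  by rewrite /t E2 [(4 * _) ^+ k]exprMn [(`|_| * G) ^+ k]exprMn; ring.
rewrite ler_wpM2r ?exprn_ge0// ler_wpM2l// mulr_ge0 ?expR_ge0// divr_ge0//.
by rewrite addr_ge0.
Qed.

Let partial_le k z n : `|series (gterm k z) n| <= glead lam k z * expR ((z / 2) ^+ 2).
Proof.
by apply: series_exp_partial; [exact: sqr_ge0|exact: gterm_le].
Qed.

(** Stands for the signs of the Taylor coefficients of cosine or of sine; both are negated by n -> n
    + 2, so one proof serves the two. *)
Variable delta : nat -> R.
Hypothesis deltaSS : forall n, delta n.+2 = - delta n.
Hypothesis delta_le1 : forall n, `|delta n| <= 1.

Lemma wave_bound z : exists M : R, forall k s, `|s| <= 1 ->
  (forall n, `|delta k * wt k * series (gterm k z) n * gegen lam k s| <= M * 2^-1 ^+ k) /\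
  `|delta k * wt k * gser k z * gegen lam k s| <= M * 2^-1 ^+ k.
Proof.
have [M HM] := lead_bound z; exists M => k s s1.
have w0 : 0 <= wt k by rewrite divr_ge0 ?(ltW lam_gt0)// addr_ge0// ltW.
have H (u : R) : `|u| <= glead lam k z * expR ((z / 2) ^+ 2) ->
    `|delta k * wt k * u * gegen lam k s| <= M * 2^-1 ^+ k.
  move=> hu; apply: le_trans (HM k s s1); move: (wt k) w0 => W w0.
  rewrite !normrM (ger0_norm w0).
  rewrite ler_wpM2r//; apply: ler_pM => //; first by rewrite mulr_ge0.
  by rewrite ler_piMl.
by split=> [n|]; apply: H; [exact: partial_le|exact: gser_le].
Qed.

Let deltaE j k : delta (2 * j + k) = (-1) ^+ j * delta k.
Proof.
elim: j => [|j IH]; first by rewrite mul1r.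
by rewrite (_ : 2 * j.+1 + k = (2 * j + k).+2)%N ?deltaSS ?IH ?exprS; [ring|lia].
Qed.

(** The degree k part of a truncated Taylor series is a truncated Bessel series: the exponents n =
    k, k+2, ... below N number [uphalf (N - k)]. *)
Let coefE z k N : \sum_(n < N) delta n * z ^+ n * mcoef lam n k =
  delta k * wt k * series (gterm k z) (uphalf (N - k)).
Proof.
elim: N => [|N IH]; first by rewrite big_ord0 /series/= big_geq ?mulr0.
rewrite big_ord_recr/= IH.
have [Nk|kN] := ltnP N k.
  rewrite mcoef_small// mulr0 addr0 (_ : N.+1 - k = N - k)%N//.
  by move: Nk; lia.
rewrite subSn//.
have [ho|he] := boolP (odd (N - k)).
  have NE : N = (2 * (N - k)./2 + k).+1.
    by rewrite mul2n -addSn -add1n -{1}(subnK kN); congr addn; rewrite -[LHS]odd_double_half ho.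
  have -> : mcoef lam N k = 0 by rewrite NE mcoef_odd.
  rewrite mulr0 addr0; congr (_ * series _ _).
  by rewrite /= uphalf_half ho.
have NE : N = (2 * (N - k)./2 + k)%N.
  by rewrite mul2n -{1}(subnK kN); congr addn; rewrite -[LHS]odd_double_half (negbTE he).
rewrite /= uphalf_half (negbTE he) add0n.
move: NE; move: (N - k)./2 => j NE; rewrite NE deltaE mcoefE.
rewrite seriesSr/= [RHS]mulrDr; congr (_ + _).
rewrite /gterm [(z / 2) ^+ _]exprMn; ring.
Qed.

(** Each power of s is expanded by [exp_gegen] and the finite sums are exchanged; the truncated
    Bessel series then converge degree by degree under a geometric bound. *)
Lemma plane_wave z s (l : R) : `|s| <= 1 ->
  series (fun n => delta n * (z * s) ^+ n / n`!%:R) n @[n --> \oo] --> l ->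
  series (fun k => delta k * wt k * gser k z * gegen lam k s) n @[n --> \oo] --> l.
Proof.
move=> s1 hl; have [M HM] := wave_bound z.
apply: (@tannery_geo R (fun N k => delta k * wt k * series (gterm k z) (uphalf (N - k)) * gegen lam k s)
  _ M).
- move=> k; apply: cvgMl; apply: cvgMr.
  have c : uphalf (N - k) @[N --> \oo] --> \oo.
    apply/cvgnyPge => A; near=> N.
    have : (A.*2 + k <= N)%N by near: N; exact: nbhs_infty_ge.
    by rewrite uphalf_half; lia.
  exact: (cvg_comp _ _ c (is_cvg_gterm lam_gt0 (k := k) (z := z))).
- by move=> n k; have [] := HM k s s1.
apply: cvg_trans hl; apply: near_eq_cvg; apply: nearW => N.
under [RHS]eq_bigr do rewrite -coefE mulr_suml.
rewrite exchange_big /series/= big_mkord; apply: eq_bigr => n _.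
rewrite exprMn -!mulrA (exp_gegen lam_gt0 s (ltn_ord n)) !mulr_sumr.
by apply: eq_bigr => k _; ring.
Unshelve. all: end_near. Qed.

End Wave.

(** * The addition theorem *)

Section Addition.
Variables (R : realType) (m : nat).
Hypothesis m_gt2 : (2 < m)%N.
Implicit Types (x y v eta : 'rV[R]_m) (k n : nat).
Let m_gt0 : (0 < m)%N. Proof. by case: m m_gt2. Qed.
Let lam : R := lamm R m.
Let lam_gt0 : 0 < lam := lamm_gt0 R m_gt2.
Let mE : m%:R = 2 * lam + 2 :> R := natr_lamm R m.
Local Notation wt k := ((k%:R + lam) / lam).

Lemma dotE_le1 x eta : dotE x x = 1 -> nrmE eta <= 1 -> `|dotE x eta| <= 1.
Proof.
move=> hx he.
have h1 : dotE eta eta <= 1.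
  by rewrite -sqr_nrmE expr_le1// nrmE_ge0.
have := dotE_ge0 (x + eta); have := dotE_ge0 (x + (-1) *: eta).
rewrite !(dotEDl, dotEZl) !(dotEC _ (_ + _)) !(dotEDl, dotEZl) hx (dotEC eta x).
by rewrite ler_norml; move: (dotE _ _) (dotE eta eta) h1 => a b h1 h2 h3; apply/andP; split; lra.
Qed.

Definition pwave (delta : nat -> R) (z : R) x k eta : R :=
  delta k * wt k * gser lam k z * gegen lam k (dotE x eta).

Lemma nice_pwave delta z x k : nice (pwave delta z x k).
Proof.
apply: niceM; first exact: nice_cst.
apply: (nice_ext _ (nice_poly (gegP lam k) (nice_dot x))) => eta.
by rewrite gegPE.
Qed.

Lemma pwave_orth delta z1 z2 x y j k : dotE x x = 1 -> dotE y y = 1 -> j != k ->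
  sph_avg (fun eta => pwave delta z1 x j eta * pwave delta z2 y k eta) = 0.
Proof.
move=> hx hy jk.
pose c := delta j * wt j * gser lam j z1 * (delta k * wt k * gser lam k z2).
transitivity (c * sform [::] x y (gegP lam j) (gegP lam k)); last by rewrite sform_orth0// mulr0.
rewrite /sform -sph_avgZ; last exact: nice_sform.
congr sph_avg; apply/funext => eta; rewrite /pwave /c big_nil !gegPE; ring.
Qed.

Lemma pwave_diag delta z1 z2 x y k : dotE x x = 1 -> dotE y y = 1 ->
  sph_avg (fun eta => pwave delta z1 x k eta * pwave delta z2 y k eta) =
  delta k ^+ 2 * (wt k * (gser lam k z1 * gser lam k z2) * gegen lam k (dotE x y)).
Proof.
move=> hx hy.
pose c := delta k * wt k * gser lam k z1 * (delta k * wt k * gser lam k z2).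
transitivity (c * sform [::] x y (gegP lam k) (gegP lam k)).
  rewrite /sform -sph_avgZ; last exact: nice_sform.
  congr sph_avg; apply/funext => eta; rewrite /pwave /c big_nil !gegPE; ring.
rewrite (sform_diag0 m_gt2 hx hy k).1 gegPE -/lam /c; field.
by rewrite !gt_eqF// ltr_wpDl.
Qed.

Section Phase.
Variables (delta : nat -> R) (f : R -> R).
Hypothesis deltaSS : forall n, delta n.+2 = - delta n.
Hypothesis delta_le1 : forall n, `|delta n| <= 1.
Hypothesis delta_f : forall t, series (fun n => delta n * t ^+ n / n`!%:R) n @[n --> \oo] --> f t.

Lemma geo_pwave z x : dotE x x = 1 -> geo_bounded (pwave delta z x).
Proof.
move=> hx; have [M HM] := wave_bound lam_gt0 delta_le1 z.
by exists M => k eta he; have [_] := HM k _ (dotE_le1 hx he).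
Qed.

Lemma ball_sum_pwave z x eta : dotE x x = 1 -> nrmE eta <= 1 ->
  ball_sum (pwave delta z x) eta = f (z * dotE x eta).
Proof.
move=> hx he; rewrite ball_sumE//; apply: cvg_lim => //.
by apply: (plane_wave lam_gt0 deltaSS delta_le1 (dotE_le1 hx he)); exact: delta_f.
Qed.

Lemma pwave_sum z1 z2 x y : dotE x x = 1 -> dotE y y = 1 ->
  (forall z x, nice (fun eta => f (z * dotE x eta))) ->
  series (fun k => delta k ^+ 2 * (wt k * (gser lam k z1 * gser lam k z2) * gegen lam k (dotE x y))) n
    @[n --> \oo] --> sph_avg (fun eta => f (z1 * dotE x eta) * f (z2 * dotE y eta)).
Proof.
move=> hx hy nf.
have -> : sph_avg (fun eta => f (z1 * dotE x eta) * f (z2 * dotE y eta)) =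
  sph_avg (fun eta => ball_sum (pwave delta z1 x) eta * ball_sum (pwave delta z2 y) eta).
  have nb z v : dotE v v = 1 -> nice (ball_sum (pwave delta z v)).
    by move=> hv; apply: nice_ball_sum; [move=> k; exact: nice_pwave|exact: geo_pwave].
  apply: (sph_avg_ext m_gt0 (niceM (nb z1 _ hx) (nb z2 _ hy))) => eta he.
  by rewrite !ball_sum_pwave// he.
apply: sph_avg_ball_sum; try by [move=> k; exact: nice_pwave|exact: geo_pwave].
- by move=> k; exact: pwave_diag.
- by move=> j k; exact: pwave_orth.
Qed.

End Phase.

(** Integration by parts along v, with all directions equal to v, of the power k+1 gives the
    recursion (k+1) |v|^2 S_k = (k + m) S_(k+2) for the moments S_k. *)
Lemma sph_avg_dot_exp v n : sph_avg (fun eta => dotE v eta ^+ (2 * n)) / (2 * n)`!%:R =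
  (nrmE v / 2) ^+ (2 * n) / (n`!%:R * rise lam n).
Proof.
pose S k := sform [::] v v 'X^k 1.
have SE k : S k = sph_avg (fun eta => dotE v eta ^+ k).
  by rewrite /S /sform; congr sph_avg; apply/funext => eta; rewrite big_nil !hornerE.
have S2 k : dotE v v * ((k%:R + 1) * S k) = (k%:R + 1 + (m%:R - 1)) * S k.+2.
  have := sform_ibp0 m_gt0 v v v 'X^(k.+1) 1.
  have e : ('X^(k.+1))^`() = (k%:R + 1)%:P * 'X^k :> {poly R}.
    by rewrite derivXn/= -mulr_natl -natr1 polyCD polyC_natr.
  rewrite e -polyC1 derivC !mulr0 !sform0r mulr0 !addr0 polyC1.
  rewrite sformXl sformXl !sformZl.
  have -> : 'X * ((k%:R + 1)%:P * 'X^k) = (k%:R + 1)%:P * 'X^(k.+1) :> {poly R}.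
    by rewrite mulrCA -exprS.
  have -> : 'X * ((k%:R + 1)%:P * 'X^(k.+1)) = (k%:R + 1)%:P * 'X^(k.+2) :> {poly R}.
    by rewrite mulrCA -exprS.
  by rewrite -exprS sformZl -/(S k) -/(S k.+2) => ->; ring.
rewrite -SE -sqr_nrmE in S2 *.
elim: n => [|n IH].
  by rewrite muln0 /S !expr0 sform11 /rise big_ord0 fact0 !divr1 mulr1 divr1.
have r0 := rise_gt0 lam_gt0 n; have n0 := ler0n R n.
have f0 : (0 : R) < n`!%:R by rewrite ltr0n fact_gt0.
have F0 : (0 : R) < (2 * n)`!%:R by rewrite ltr0n fact_gt0.
have h : 0 < 2 * n%:R + 2 + 2 * lam by move: lam_gt0; lra.
have SS : S (2 * n.+1)%N = nrmE v ^+ 2 * (2 * n%:R + 1) / (2 * n%:R + 2 + 2 * lam) * S (2 * n)%N.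
  have := S2 (2 * n)%N; rewrite mE (_ : (2 * n).+2 = 2 * n.+1)%N; last by lia.
  rewrite natrM => e; apply: (mulfI (_ : 2 * n%:R + 2 + 2 * lam != 0)); first by rewrite gt_eqF.
  transitivity (nrmE v ^+ 2 * ((2 * n%:R + 1) * S (2 * n)%N)); last by field; rewrite gt_eqF.
  rewrite e; ring.
rewrite SS (_ : (2 * n.+1)`! = (2 * n).+2 * ((2 * n).+1 * (2 * n)`!))%N; last first.
  by rewrite -!factS; congr factorial; lia.
have -> : S (2 * n)%N = (2 * n)`!%:R * ((nrmE v / 2) ^+ (2 * n) / (n`!%:R * rise lam n)).
  by rewrite -IH mulrCA mulfV ?mulr1// gt_eqF.
rewrite factS riseS (_ : 2 * n.+1 = 2 + 2 * n)%N; last by lia.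
rewrite exprD !natrM -!natr1 natrM.
move: ((nrmE v / 2) ^+ (2 * n)) => P; move: r0 f0 F0 n0 h; move: (rise _ _) (n`!%:R) ((2 * n)`!%:R).
move: (n%:R : R) lam lam_gt0 => a l l0 r f F r0 f0 F0 a0 h.
field; rewrite !gt_eqF//; lra.
Qed.

Let nice_cmp (g : R -> R) v : measurable_fun setT g -> (forall t, `|g t| <= 1) ->
  nice (fun eta => g (dotE v eta)).
Proof.
move=> mg g1; split; first by apply: cmeas_comp => //; exact: cmeas_dot.
by exists 1 => x _; exact: g1.
Qed.

Let nice_cos v : nice (fun eta => cos (dotE v eta)).
Proof.
apply: nice_cmp; last exact: cos_max.
by apply: continuous_measurable_fun; exact: continuous_cos.
Qed.

Let nice_sin v : nice (fun eta => sin (dotE v eta)).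
Proof.
apply: nice_cmp; last exact: sin_max.
by apply: continuous_measurable_fun; exact: continuous_sin.
Qed.

(** The cosine series is averaged termwise; its even moments produce exactly the terms of the Bessel
    series of degree 0. *)
Lemma sph_avg_cos v : sph_avg (fun eta => cos (dotE v eta)) = gser lam 0 (nrmE v).
Proof.
have [_ [B HB]] := nice_dot v.
pose f n eta := series (cos_coeff' (dotE v eta)) n.
have fE n : f n = fun eta => \sum_(k < n) ((-1) ^+ k / (2 * k)`!%:R * dotE v eta ^+ (2 * k)).
  apply/funext => eta; rewrite /f /series/= big_mkord; apply: eq_bigr => k _.
  by rewrite /cos_coeff' -exprnP mul2n mulrAC.
have nt k : nice (fun eta => (-1) ^+ k / (2 * k)`!%:R * dotE v eta ^+ (2 * k)).
  by apply: niceM; [exact: nice_cst|apply: nice_exp; exact: nice_dot].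
have E n : sph_avg (f n) = series (gterm lam 0 (nrmE v)) n.
  rewrite fE sph_avg_sum// /series/= big_mkord; apply: eq_bigr => k _.
  rewrite sph_avgZ; last by apply: nice_exp; exact: nice_dot.
  by rewrite -mulrA (mulrC _^-1) sph_avg_dot_exp /gterm !addn0 mulrA.
have c1 : sph_avg (f n) @[n --> \oo] --> sph_avg (fun eta => cos (dotE v eta)).
  apply: (@sph_avg_cvg _ _ f _ (1 * expR (B ^+ 2))) => //.
  - by move=> n; rewrite fE; apply: cmeas_sum => k; have [] := nt k.
  - move=> n eta he; apply: series_exp_partial; first exact: sqr_ge0.
    move=> j; rewrite /cos_coeff' -exprnP mul1r !normrM normrX normrN1 expr1n mul1r normfV normrX (ger0_norm (ler0n R _)).
    rewrite -mul2n exprM; apply: ler_pM => //.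
      rewrite lerXn2r ?nnegrE ?sqr_ge0// lerXn2r ?nnegrE ?HB//.
      exact: le_trans (HB _ he).
    by rewrite lef_pV2 ?posrE ?ltr0n ?fact_gt0// ler_nat leq_fact// mul2n -addnn leq_addr.
  - by move=> eta _; exact: cvg_cos_coeff'.
have c2 : sph_avg (f n) @[n --> \oo] --> gser lam 0 (nrmE v).
  by under eq_cvg do rewrite E; exact: is_cvg_gterm.
exact: cvg_unique c1 c2.
Qed.

Let cosd n : R := (~~ odd n)%:R * (-1) ^+ n./2.
Let sind n : R := (odd n)%:R * (-1) ^+ n.-1./2.

Let cosdSS n : cosd n.+2 = - cosd n.
Proof. by rewrite /cosd /= negbK exprS; ring. Qed.
Let sindSS n : sind n.+2 = - sind n.
Proof.
rewrite /sind /= negbK; case: n => [|n]; first by rewrite !mul0r oppr0.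
by rewrite -[n.+1.-1]/n (_ : uphalf n.+1 = n./2.+1)// exprS; ring.
Qed.
Let cosd_le1 n : `|cosd n| <= 1.
Proof. by rewrite normrM normrX normrN1 expr1n mulr1; case: odd; rewrite ?normr0 ?normr1. Qed.
Let sind_le1 n : `|sind n| <= 1.
Proof. by rewrite normrM normrX normrN1 expr1n mulr1; case: odd; rewrite ?normr0 ?normr1. Qed.

Lemma gegenbauer_addition x y z1 z2 : dotE x x = 1 -> dotE y y = 1 ->
  series (fun k => wt k * (gser lam k z1 * gser lam k z2) * gegen lam k (dotE x y)) n
    @[n --> \oo] --> gser lam 0 (Num.sqrt (z1 ^+ 2 + z2 ^+ 2 - 2 * (z1 * z2) * dotE x y)).
Proof.
move=> hx hy.
pose v := z1 *: x + (- z2) *: y.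
have -> : Num.sqrt (z1 ^+ 2 + z2 ^+ 2 - 2 * (z1 * z2) * dotE x y) = nrmE v.
  rewrite /nrmE /v; congr Num.sqrt.
  rewrite !(dotEDl, dotEZl) !(dotEC _ (_ + _)) !(dotEDl, dotEZl) hx hy (dotEC y x); ring.
have zc (g : R -> R) : (forall v, nice (fun eta => g (dotE v eta))) ->
    forall z u, nice (fun eta => g (z * dotE u eta)).
  by move=> ng z u; apply: nice_ext (ng (z *: u)) => eta; rewrite dotEZl.
have cc := @pwave_sum cosd (@cos R) cosdSS cosd_le1 _ z1 z2 x y hx hy (zc _ nice_cos).
have ss := @pwave_sum sind (@sin R) sindSS sind_le1 _ z1 z2 x y hx hy (zc _ nice_sin).
rewrite -sph_avg_cos.
have -> : sph_avg (fun eta => cos (dotE v eta)) =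
  sph_avg (fun eta => cos (z1 * dotE x eta) * cos (z2 * dotE y eta)) +
  sph_avg (fun eta => sin (z1 * dotE x eta) * sin (z2 * dotE y eta)).
  rewrite -sph_avgD; [|by apply: niceM; exact: zc nice_cos _ _|by apply: niceM; exact: zc nice_sin _ _].
  by congr sph_avg; apply/funext => eta; rewrite -cosB /v dotEDl !dotEZl mulNr.
apply: cvg_trans (cvgD (cc _) (ss _)) => [||].
- apply: near_eq_cvg; apply: nearW => n.
  rewrite fctE /series/= -big_split; apply: eq_bigr => k _; rewrite /= -mulrDl.
  (* Cosines supply the even degrees and sines the odd ones, so each degree occurs once. *)
  rewrite (_ : cosd k ^+ 2 + sind k ^+ 2 = 1) ?mul1r//.
  rewrite /cosd /sind !exprMn !sqrr_sign !mulr1.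
  by case: odd; rewrite /= expr1n expr0n ?addr0 ?add0r.
- by move=> t; rewrite unlock; exact: is_cvg_series_cos_coeff.
- by move=> t; rewrite unlock; exact: is_cvg_series_sin_coeff.
Qed.

End Addition.

(** * Complex averages *)

Local Notation Re := (@complex.Re _).
Local Notation Im := (@complex.Im _).

Section ComplexAverage.
Variables (R : realType) (m : nat).
Hypothesis m_gt0 : (0 < m)%N.
Implicit Types (F G : 'rV[R]_m -> R[i]) (c d u : nat -> R[i]) (p q : nat -> 'rV[R]_m -> R).

Lemma ReM (z w : R[i]) : Re (z * w) = Re z * Re w - Im z * Im w.
Proof. by case: z; case: w. Qed.

Lemma ImM (z w : R[i]) : Im (z * w) = Re z * Im w + Im z * Re w.
Proof. by case: z; case: w. Qed.

Lemma ReD (z w : R[i]) : Re (z + w) = Re z + Re w.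
Proof. by case: z; case: w. Qed.

Lemma ImD (z w : R[i]) : Im (z + w) = Im z + Im w.
Proof. by case: z; case: w. Qed.

Lemma Re_sum (I : Type) (s : seq I) (f : I -> R[i]) :
  Re (\sum_(i <- s) f i) = \sum_(i <- s) Re (f i).
Proof. exact: (big_morph (@complex.Re R) ReD). Qed.

Lemma Im_sum (I : Type) (s : seq I) (f : I -> R[i]) :
  Im (\sum_(i <- s) f i) = \sum_(i <- s) Im (f i).
Proof. exact: (big_morph (@complex.Im R) ImD). Qed.

Lemma complex_eq (z w : R[i]) : Re z = Re w -> Im z = Im w -> z = w.
Proof. by case: z => a b; case: w => a' b' /= -> ->. Qed.

Definition has_csum u (l : R[i]) :=
  series (fun k => Re (u k)) n @[n --> \oo] --> Re l /\
  series (fun k => Im (u k)) n @[n --> \oo] --> Im l.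

Lemma has_csum_uniq u l l' : has_csum u l -> has_csum u l' -> l = l'.
Proof.
by move=> [h1 h2] [h3 h4]; apply: complex_eq; [exact: cvg_unique h1 h3|exact: cvg_unique h2 h4].
Qed.

Lemma has_csum0 : has_csum (fun=> 0) 0.
Proof. by split; apply: cvg_near_cst; apply: nearW => n; rewrite /series/= big1. Qed.

Lemma has_csumD u v l l' : has_csum u l -> has_csum v l' -> has_csum (fun k => u k + v k) (l + l').
Proof.
move=> [h1 h2] [h3 h4]; split.
- rewrite ReD; apply: cvg_trans (cvgD h1 h3); apply: near_eq_cvg; apply: nearW => n.
  by rewrite fctE /series/= -big_split; apply: eq_bigr => k _; rewrite ReD.
- rewrite ImD; apply: cvg_trans (cvgD h2 h4); apply: near_eq_cvg; apply: nearW => n.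
  by rewrite fctE /series/= -big_split; apply: eq_bigr => k _; rewrite ImD.
Qed.

Lemma has_csumZr u l (e : R[i]) : has_csum u l -> has_csum (fun k => u k * e) (l * e).
Proof.
move=> [h1 h2]; split.
- have H : series (fun k => Re (u k)) n * Re e - series (fun k => Im (u k)) n * Im e
    @[n --> \oo] --> Re l * Re e - Im l * Im e.
    by apply: cvgB; apply: cvgM => //; exact: cvg_cst.
  rewrite ReM; apply: cvg_trans H; apply: near_eq_cvg; apply: nearW => n.
  by rewrite /series/= !mulr_suml -sumrB; apply: eq_bigr => k _; rewrite ReM.
- have H : series (fun k => Re (u k)) n * Im e + series (fun k => Im (u k)) n * Re e
    @[n --> \oo] --> Re l * Im e + Im l * Re e.
    by apply: cvgD; apply: cvgM => //; exact: cvg_cst.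
  rewrite ImM; apply: cvg_trans H; apply: near_eq_cvg; apply: nearW => n.
  by rewrite /series/= !mulr_suml -big_split; apply: eq_bigr => k _; rewrite ImM.
Qed.

Lemma has_csum_sum (I : Type) (s : seq I) (v : I -> nat -> R[i]) (l : I -> R[i]) :
  (forall i, has_csum (v i) (l i)) ->
  has_csum (fun k => \sum_(i <- s) v i k) (\sum_(i <- s) l i).
Proof.
move=> vl; elim: s => [|i s IH].
  by rewrite big_nil (_ : (fun k => _) = fun=> 0) ?big_nil; [exact: has_csum0|apply/funext => k; rewrite big_nil].
rewrite big_cons (_ : (fun k => _) = fun k => v i k + \sum_(j <- s) v j k).
  exact: has_csumD.
by apply/funext => k; rewrite big_cons.
Qed.

Lemma has_csum_real (u : nat -> R) (l : R) : series u n @[n --> \oo] --> l ->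
  has_csum (fun k => (u k)%:C) l%:C.
Proof.
by move=> ul; split => //; apply: cvg_near_cst; apply: nearW => n; rewrite /series/= big1.
Qed.

Definition csph_avg F : R[i] :=
  sph_avg (fun eta => Re (F eta)) +i* sph_avg (fun eta => Im (F eta)).

Definition cnice F := nice (fun eta => Re (F eta)) /\ nice (fun eta => Im (F eta)).

Lemma cniceM F G : cnice F -> cnice G -> cnice (fun eta => F eta * G eta).
Proof.
move=> [f1 f2] [g1 g2]; split.
- apply: (nice_ext _ (niceD (niceM f1 g1) (niceM (nice_cst m (-1)) (niceM f2 g2)))) => eta.
  by rewrite ReM mulN1r.
- apply: (nice_ext _ (niceD (niceM f1 g2) (niceM f2 g1))) => eta.
  by rewrite ImM.
Qed.

Lemma cnice_sum (I : Type) (s : seq I) (F : I -> 'rV[R]_m -> R[i]) :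
  (forall i, cnice (F i)) -> cnice (fun eta => \sum_(i <- s) F i eta).
Proof.
move=> nF; split.
- apply: (nice_ext _ (nice_sum s predT (fun i => (nF i).1))) => eta; exact: Re_sum.
- apply: (nice_ext _ (nice_sum s predT (fun i => (nF i).2))) => eta; exact: Im_sum.
Qed.

Lemma csph_avgZr F (e : R[i]) : cnice F -> csph_avg (fun eta => F eta * e) = csph_avg F * e.
Proof.
move=> [f1 f2]; apply: complex_eq; rewrite ?ReM ?ImM/=.
- transitivity (sph_avg (fun eta => Re e * Re (F eta) + (- Im e) * Im (F eta))).
    by congr sph_avg; apply/funext => eta; rewrite ReM; ring.
  by rewrite sph_avg_lin//; ring.
- transitivity (sph_avg (fun eta => Im e * Re (F eta) + Re e * Im (F eta))).
    by congr sph_avg; apply/funext => eta; rewrite ImM; ring.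
  by rewrite sph_avg_lin//; ring.
Qed.

Lemma csph_avg_sum (I : Type) (s : seq I) (F : I -> 'rV[R]_m -> R[i]) :
  (forall i, cnice (F i)) ->
  csph_avg (fun eta => \sum_(i <- s) F i eta) = \sum_(i <- s) csph_avg (F i).
Proof.
move=> nF; apply: complex_eq; rewrite ?Re_sum ?Im_sum/=.
- rewrite -sph_avg_sum => [|i]; last by have [] := nF i.
  by congr sph_avg; apply/funext => eta; rewrite Re_sum.
- rewrite -sph_avg_sum => [|i]; last by have [] := nF i.
  by congr sph_avg; apply/funext => eta; rewrite Im_sum.
Qed.

Definition cball_sum c p eta : R[i] :=
  ball_sum (fun k x => Re (c k) * p k x) eta +i* ball_sum (fun k x => Im (c k) * p k x) eta.

Definition cgeo_bounded c p := geo_bounded (fun k x => Re (c k) * p k x) /\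
  geo_bounded (fun k x => Im (c k) * p k x).

Lemma cnice_cball_sum c p : (forall k, nice (p k)) -> cgeo_bounded c p -> cnice (cball_sum c p).
Proof.
move=> np [b1 b2]; split; apply: nice_ball_sum => // k; apply: niceM => //; exact: nice_cst.
Qed.

Lemma csph_avg_cball_sum c d p q (h : nat -> R) :
  (forall k, nice (p k)) -> (forall k, nice (q k)) -> cgeo_bounded c p -> cgeo_bounded d q ->
  (forall k, sph_avg (fun x => p k x * q k x) = h k) ->
  (forall j k, j != k -> sph_avg (fun x => p j x * q k x) = 0) ->
  has_csum (fun k => c k * d k * (h k)%:C) (csph_avg (fun eta => cball_sum c p eta * cball_sum d q eta)).
Proof.
move=> np nq [c1 c2] [d1 d2] hd ho.
have nc (e : R) f : nice f -> nice (fun x : 'rV[R]_m => e * f x).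
  by move=> nf; apply: niceM => //; exact: nice_cst.
have H (a b : nat -> R) : geo_bounded (fun k x => a k * p k x) -> geo_bounded (fun k x => b k * q k x) ->
  nice (fun eta => ball_sum (fun k x => a k * p k x) eta * ball_sum (fun k x => b k * q k x) eta) /\
  series (fun k => a k * b k * h k) n @[n --> \oo] -->
    sph_avg (fun eta => ball_sum (fun k x => a k * p k x) eta * ball_sum (fun k x => b k * q k x) eta).
  move=> ba bb; split; first by apply: niceM; apply: nice_ball_sum => // k; exact: nc.
  have E j k : sph_avg (fun x => a j * p j x * (b k * q k x)) = a j * b k * sph_avg (fun x => p j x * q k x).
    rewrite -sph_avgZ; last exact: niceM.
    by congr sph_avg; apply/funext => x; ring.
  apply: sph_avg_ball_sum => //; try by move=> k; exact: nc.
  - by move=> k; rewrite E hd.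
  - by move=> j k jk; rewrite E ho// mulr0.
have [n1 h1] := H _ _ c1 d1; have [n2 h2] := H _ _ c2 d2.
have [n3 h3] := H _ _ c1 d2; have [n4 h4] := H _ _ c2 d1.
split.
- rewrite [Re (csph_avg _)](_ : _ = 1 * sph_avg (fun eta =>
    ball_sum (fun k x => Re (c k) * p k x) eta * ball_sum (fun k x => Re (d k) * q k x) eta)
    + (-1) * sph_avg (fun eta =>
    ball_sum (fun k x => Im (c k) * p k x) eta * ball_sum (fun k x => Im (d k) * q k x) eta)).
    rewrite mul1r mulN1r; apply: cvg_trans (cvgB h1 h2); apply: near_eq_cvg; apply: nearW => n.
    rewrite fctE /series/= -sumrB; apply: eq_bigr => k _; rewrite !ReM/=; ring.
  rewrite -sph_avg_lin//= /csph_avg/=; congr sph_avg; apply/funext => eta; ring.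
- rewrite [Im (csph_avg _)](_ : _ = 1 * sph_avg (fun eta =>
    ball_sum (fun k x => Re (c k) * p k x) eta * ball_sum (fun k x => Im (d k) * q k x) eta)
    + 1 * sph_avg (fun eta =>
    ball_sum (fun k x => Im (c k) * p k x) eta * ball_sum (fun k x => Re (d k) * q k x) eta)).
    rewrite !mul1r; apply: cvg_trans (cvgD h3 h4); apply: near_eq_cvg; apply: nearW => n.
    rewrite fctE /series/= -big_split; apply: eq_bigr => k _; rewrite !(ImM, ReM)/=; ring.
  rewrite -sph_avg_lin//= /csph_avg/=; congr sph_avg; apply/funext => eta; ring.
Qed.

Let evalE (A : {set 'I_m}) (I : Type) (s : seq I) (f : I -> clif R m) :
  (\sum_(i <- s) f i) A = \sum_(i <- s) f i A.
Proof. by apply: (big_morph (fun f : clif R m => f A)) => [f1 f2|]; rewrite ffunE. Qed.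

(** Scalars are central, so the functions can be gathered in front of the constant Clifford
    elements; the integrand has to be known on the sphere only. *)
Lemma sph_int_bilinear (I : finType) (phi psi : I -> 'rV[R]_m -> R[i]) (V W : I -> clif R m)
    (F : 'rV[R]_m -> Cl R m) :
  (forall i, cnice (phi i)) -> (forall i, cnice (psi i)) ->
  (forall eta, nrmE eta = 1 ->
    F eta = (\sum_i csc m (phi i eta) * V i) * (\sum_j csc m (psi j eta) * W j)) ->
  sph_int F = \sum_i \sum_j csc m (csph_avg (fun eta => phi i eta * psi j eta)) * (V i * W j) :> clif R m.
Proof.
move=> nphi npsi FE.
have FE' eta A : nrmE eta = 1 ->
    F eta A = \sum_(ij : I * I) (phi ij.1 eta * psi ij.2 eta) * (V ij.1 * W ij.2) A.
  move=> /FE ->; rewrite -(pair_bigA _ (fun i j => (phi i eta * psi j eta) * (V i * W j) A))/=.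
  rewrite mulr_suml evalE; apply: eq_bigr => i _.
  rewrite mulr_sumr evalE; apply: eq_bigr => j _.
  by rewrite -cscE rmorphM/= -!mulrA (mulrA (V i)) cscC -!mulrA.
have nij ij : cnice (fun eta => phi ij.1 eta * psi ij.2 eta) by exact: cniceM.
have nijA ij (e : R[i]) : cnice (fun eta => phi ij.1 eta * psi ij.2 eta * e).
  by apply: cniceM => //; split; exact: nice_cst.
apply/ffunP => A; rewrite ffunE evalE.
under [RHS]eq_bigr do rewrite evalE.
under [RHS]eq_bigr do under eq_bigr do rewrite cscE.
rewrite [RHS](pair_bigA _ (fun i j => csph_avg (fun eta => phi i eta * psi j eta) * (V i * W j) A))/=.
transitivity (csph_avg (fun eta => \sum_(ij : I * I) (phi ij.1 eta * psi ij.2 eta) * (V ij.1 * W ij.2) A)).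
  have [n1 n2] := cnice_sum (index_enum _) (fun ij => nijA ij ((V ij.1 * W ij.2) A)).
  by rewrite /csph_avg; congr (_ +i* _); [apply: (sph_avg_ext m_gt0 n1)|apply: (sph_avg_ext m_gt0 n2)] => eta he;
    rewrite FE'.
rewrite csph_avg_sum => [|ij]; last exact: nijA.
by apply: eq_bigr => ij _; rewrite csph_avgZr.
Qed.

End ComplexAverage.

(** * The two kernels *)

Section Kernel.
Variables (R : realType) (m : nat).
Hypothesis m_gt2 : (2 < m)%N.
Implicit Types (x y xi zeta eta : 'rV[R]_m) (k : nat) (o : option 'I_m).
Let m_gt0 : (0 < m)%N. Proof. by case: m m_gt2. Qed.
Let lam : R := lamm R m.
Let lam_gt0 : 0 < lam := lamm_gt0 R m_gt2.
Let mE : m%:R = 2 * lam + 2 :> R := natr_lamm R m.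
Let kappa : R := 2 `^ lam * Gamma (lam + 1).
Local Notation C k := (gegP lam k).
Local Notation D k := ((gegP lam k)^`()).
Local Notation D2 k := ((gegP lam k)^`()^`()).
Local Notation J k z := (zJ lam 0 k z).

Definition proj_delta xi i : 'rV[R]_m := delta_mx 0 i + (- xi 0 i) *: xi.

Lemma proj_delta_dot xi i y : dotE (proj_delta xi i) y = y 0 i - xi 0 i * dotE xi y.
Proof. by rewrite /proj_delta dotEDl dotEZl dotE_delta mulNr. Qed.

Lemma proj_delta_orth xi i : dotE xi xi = 1 -> dotE (proj_delta xi i) xi = 0.
Proof. by move=> h; rewrite proj_delta_dot h mulr1 subrr. Qed.

(** The component removed by the projection contributes a multiple of xi /\ xi = 0. *)
Lemma cwedge_proj xi y :
  \sum_i csc m (dotE (proj_delta xi i) y)%:C * cwedge (delta_mx 0 i) xi = cwedge y xi.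
Proof.
transitivity (\sum_i (csc m (y 0 i)%:C * cwedge (delta_mx 0 i) xi -
    csc m (dotE xi y)%:C * (csc m (xi 0 i)%:C * cwedge (delta_mx 0 i) xi))).
  apply: eq_bigr => i _; rewrite proj_delta_dot rmorphB rmorphB/= mulrBl mulrA -!rmorphM/=.
  by rewrite (mulrC (xi 0 i)) rmorphM.
by rewrite sumrB -mulr_sumr -!cwedge_suml cwedge_xx mulr0 subr0.
Qed.

(* [Some i] indexes the coefficient of e_i /\ xi; projecting e_i off xi does not change the bivector
   ([cwedge_proj]) and makes the orthogonality relations applicable. *)
Definition kterm xi z o k eta : R :=
  J k z * (if o is Some i then dotE (proj_delta xi i) eta * (D k).[dotE xi eta]
           else (C k).[dotE xi eta]).

Definition kvec xi o : clif R m := if o is Some i then cwedge (delta_mx 0 i) xi else 1.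

(* The average of [kterm xi z1 o k * kterm zeta z2 o' k], up to the factor J k z1 * J k z2 * lam / (k + lam). *)
Definition kpair xi zeta o o' k : R :=
  let w := dotE xi zeta in
  match o, o' with
  | None, None => (C k).[w]
  | None, Some j => dotE (proj_delta zeta j) xi * (D k).[w]
  | Some i, None => dotE (proj_delta xi i) zeta * (D k).[w]
  | Some i, Some j => dotE (proj_delta xi i) (proj_delta zeta j) * (D k).[w] +
      dotE (proj_delta zeta j) xi * dotE (proj_delta xi i) zeta * (D2 k).[w]
  end.

Lemma cwedgeDl x y z : cwedge (x + y) z = cwedge x z + cwedge y z.
Proof.
rewrite 3!(cwedge_suml _ z) -big_split; apply: eq_bigr => i _.
by rewrite mxE rmorphD rmorphD/= mulrDl.
Qed.

Lemma cwedgeZl (e : R) x z : cwedge (e *: x) z = csc m e%:C * cwedge x z.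
Proof.
rewrite 2!(cwedge_suml _ z) mulr_sumr; apply: eq_bigr => i _.
by rewrite mxE rmorphM rmorphM/= mulrA.
Qed.

Lemma nice_kterm xi z o k : nice (kterm xi z o k).
Proof.
apply: niceM; first exact: nice_cst.
case: o => [i|]; last by apply: nice_poly; exact: nice_dot.
by apply: niceM; [exact: nice_dot|apply: nice_poly; exact: nice_dot].
Qed.

Let kterm_sform xi zeta z1 z2 o o' j k :
  sph_avg (fun eta => kterm xi z1 o j eta * kterm zeta z2 o' k eta) =
  J j z1 * J k z2 * sform ((if o is Some i then [:: proj_delta xi i] else [::]) ++
     (if o' is Some i then [:: proj_delta zeta i] else [::])) xi zeta
     (if o is Some _ then D j else C j) (if o' is Some _ then D k else C k).
Proof.
rewrite /sform -sph_avgZ; last exact: nice_sform.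
congr sph_avg; apply/funext => eta; rewrite /kterm; case: o => [i|]; case: o' => [i'|] /=;
  rewrite ?big_cons ?big_nil ?mulr1 ?mul1r;
  move: (J j z1) (J k z2) (horner _ (dotE xi eta)) (horner _ (dotE zeta eta)) => A B P Q; ring.
Qed.

Lemma kterm_orth xi zeta z1 z2 o o' j k : dotE xi xi = 1 -> dotE zeta zeta = 1 -> j != k ->
  sph_avg (fun eta => kterm xi z1 o j eta * kterm zeta z2 o' k eta) = 0.
Proof.
move=> hx hz jk; rewrite kterm_sform; case: o => [i|]; case: o' => [i'|] /=.
- by rewrite (sform_orth2 m_gt2 hx hz (proj_delta_orth i hx) (proj_delta_orth i' hz) jk) mulr0.
- by rewrite (sform_orth1 m_gt2 hx hz (proj_delta_orth i hx) jk) mulr0.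
- by rewrite sformC (sform_orth1 m_gt2 hz hx (proj_delta_orth i' hz)) ?mulr0// eq_sym.
- by rewrite (sform_orth0 m_gt2 hx hz jk) mulr0.
Qed.

Lemma kterm_diag xi zeta z1 z2 o o' k : dotE xi xi = 1 -> dotE zeta zeta = 1 ->
  sph_avg (fun eta => kterm xi z1 o k eta * kterm zeta z2 o' k eta) =
  J k z1 * J k z2 * (lam / (k%:R + lam)) * kpair xi zeta o o' k.
Proof.
move=> hx hz; rewrite kterm_sform -[RHS]mulrA; congr (_ * _); case: o => [i|]; case: o' => [i'|] /=.
- by rewrite (sform_diag2 m_gt2 hx hz (proj_delta_orth i hx) (proj_delta_orth i' hz)).
- by rewrite (sform_diag1 m_gt2 hx hz (proj_delta_orth i hx)) mulrA.
- by rewrite sformC (sform_diag1 m_gt2 hz hx (proj_delta_orth i' hz)) mulrA (dotEC zeta xi).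
- by rewrite (sform_diag0 m_gt2 hx hz k).1.
Qed.

Lemma sum_option (V : nmodType) (F : option 'I_m -> V) : \sum_o F o = F None + \sum_i F (Some i).
Proof.
rewrite (bigD1 None)//=; congr (_ + _).
rewrite (reindex_omap Some id) => [|[i|]]//=.
by apply: eq_bigl => i; rewrite eqxx.
Qed.

Variable alpha : R.
Let tau : R := sin alpha / (2 * lam).

(* [tau] arises from r|x| = z sin alpha and C_k' = 2 lam C_(k-1)^(lam+1); the sign is minus
   because both kernels are expanded along [cwedge (r *: eta) _] with coefficient [- csum (Bterm _)]. *)
Definition kcoef (a b : nat -> R[i]) o k : R[i] := if o is Some _ then (- tau)%:C * b k else a k.

Let cscM (c d : R[i]) : csc m (c * d) = csc m c * csc m d. Proof. exact: rmorphM. Qed.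
Let cscD (c d : R[i]) : csc m (c + d) = csc m c + csc m d. Proof. exact: rmorphD. Qed.
Let cscN (c : R[i]) : csc m (- c) = - csc m c. Proof. exact: rmorphN. Qed.

(** With X = zeta /\ xi, the mixed blocks are multiples of X, and the block of two bivectors splits
    into a scalar and a multiple of X. The claim then reduces to the two coefficient identities [k1]
    and [k2]. *)
Lemma kpair_sum a b k xi zeta : dotE xi xi = 1 -> dotE zeta zeta = 1 ->
  Nk m alpha a b k != 0 ->
  \sum_o \sum_o' csc m (kcoef (atil m alpha a b) (btil m alpha a b) o k * kcoef a b o' k *
     (kpair xi zeta o o' k)%:C) * (kvec xi o * kvec zeta o') =
  csc m ((kappa * (k%:R + lam) / lam) ^+ 2 * gegen lam k (dotE xi zeta))%:C.
Proof.
move=> hx hz hN.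
set w := dotE xi zeta.
set a' := atil m alpha a b; set b' := btil m alpha a b.
set X := cwedge zeta xi.
have T1 : \sum_j csc m (dotE (proj_delta zeta j) xi)%:C * cwedge (delta_mx 0 j) zeta = - X.
  by rewrite cwedge_proj cwedgeC.
have T2 : \sum_i csc m (dotE (proj_delta xi i) zeta)%:C * cwedge (delta_mx 0 i) xi = X.
  by rewrite cwedge_proj.
(* Contracting over i first turns the projected basis vector into cwedge with [proj_delta zeta j];
   the rest is [cwedge_sum_delta], and zeta /\ zeta = 0 removes the other term. *)
have T3 : \sum_i \sum_j csc m (dotE (proj_delta xi i) (proj_delta zeta j))%:C *
    (cwedge (delta_mx 0 i) xi * cwedge (delta_mx 0 j) zeta) =
    - csc m ((2 * lam + 1) * w)%:C - csc m (2 * lam)%:C * X.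
  rewrite exchange_big/=.
  transitivity (\sum_j (- (cwedge (delta_mx 0 j) xi * cwedge zeta (delta_mx 0 j)) -
      X * (csc m (zeta 0 j)%:C * cwedge (delta_mx 0 j) zeta))).
    apply: eq_bigr => j _.
    under eq_bigr do rewrite mulrA.
    rewrite -mulr_suml cwedge_proj {1}/proj_delta cwedgeDl cwedgeZl mulrDl.
    rewrite {1}(cwedgeC _ zeta) mulrN; congr (_ + _).
    by rewrite rmorphN rmorphN/= mulNr mulNr -/X -mulrA; congr (- _); rewrite !mulrA cscC.
  rewrite sumrB -mulr_sumr -cwedge_suml cwedge_xx mulr0 subr0 sumrN cwedge_sum_delta.
  rewrite (cwedgeC xi) -/X mulrN opprD opprK mE.
  by congr (- csc m (_ * _)%:C - csc m _%:C * _); ring.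
have T4 : \sum_i \sum_j csc m (dotE (proj_delta zeta j) xi * dotE (proj_delta xi i) zeta)%:C *
    (cwedge (delta_mx 0 i) xi * cwedge (delta_mx 0 j) zeta) = csc m (1 - w ^+ 2)%:C.
  transitivity (X * - X).
    rewrite -{1}T2 -T1 mulr_suml; apply: eq_bigr => i _; rewrite mulr_sumr; apply: eq_bigr => j _.
    by rewrite (mulrC (dotE _ xi)) rmorphM rmorphM/= -!mulrA; congr (_ * _); rewrite !mulrA cscC.
  by rewrite mulrN /X cwedge_sqr hx hz -rmorphN -rmorphN/= (dotEC zeta) opprB mulr1.
rewrite sum_option sum_option.
under [X in _ + X = _]eq_bigr do rewrite sum_option.
rewrite big_split/= -/w; set Cw := (C k).[w]; set Dw := (D k).[w]; set D2w := (D2 k).[w].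
have -> : \sum_j csc m (a' k * ((- tau)%:C * b k) * (dotE (proj_delta zeta j) xi * Dw)%:C) *
    (1 * cwedge (delta_mx 0 j) zeta) = csc m (a' k * b k * (- tau * Dw)%:C) * - X.
  rewrite -T1 mulr_sumr; apply: eq_bigr => j _; rewrite mul1r [in RHS]mulrA -cscM.
  by congr (csc m _ * _); rewrite !rmorphM/=; ring.
have -> : \sum_i csc m ((- tau)%:C * b' k * a k * (dotE (proj_delta xi i) zeta * Dw)%:C) *
    (cwedge (delta_mx 0 i) xi * 1) = csc m (b' k * a k * (- tau * Dw)%:C) * X.
  rewrite -T2 mulr_sumr; apply: eq_bigr => i _; rewrite mulr1 [in RHS]mulrA -cscM.
  by congr (csc m _ * _); rewrite !rmorphM/=; ring.
have -> : \sum_i \sum_j csc m ((- tau)%:C * b' k * ((- tau)%:C * b k) *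
     (dotE (proj_delta xi i) (proj_delta zeta j) * Dw +
      dotE (proj_delta zeta j) xi * dotE (proj_delta xi i) zeta * D2w)%:C) *
     (cwedge (delta_mx 0 i) xi * cwedge (delta_mx 0 j) zeta) =
   csc m (b' k * b k * (tau ^+ 2 * Dw)%:C) *
     (- csc m ((2 * lam + 1) * w)%:C - csc m (2 * lam)%:C * X) +
   csc m (b' k * b k * (tau ^+ 2 * D2w)%:C) * csc m (1 - w ^+ 2)%:C.
  rewrite -T3 -T4 !mulr_sumr -big_split; apply: eq_bigr => i _.
  rewrite !mulr_sumr -big_split; apply: eq_bigr => j _ /=.
  move: (cwedge _ xi * cwedge _ zeta) => E.
  rewrite 2![csc m _ * (csc m _ * E)]mulrA -!cscM -mulrDl -cscD; congr (csc m _ * _).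
  rewrite !(rmorphD, rmorphXn, rmorphM, rmorphN)/=; ring.
rewrite mulr1.
(* Turns the scalar part of the block of two bivectors into -tau^2 k(k + 2 lam) b' b C_k. *)
have ode : (1 - w ^+ 2) * D2w = (2 * lam + 1) * w * Dw - k%:R * (k%:R + 2 * lam) * Cw.
  have := congr1 (fun p => p.[w]) (gegP_ode lam k).
  by rewrite !hornerE => <-; rewrite /D2w; ring.
have l0 : lam%:C != 0 :> R[i] by rewrite fmorph_eq0 gt_eqF.
have kl0 : k%:R + lam%:C != 0 :> R[i].
  by rewrite -(rmorph_nat (real_complex R)) -rmorphD fmorph_eq0 gt_eqF// ltr_wpDl.
have tE : (2 * lam * tau)%:C = (sin alpha)%:C :> R[i].
  by congr _%:C; rewrite /tau mulrC divfK// mulf_neq0// gt_eqF.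
(* The coefficient of the bivector. It vanishes because the numerator of [atil] exceeds a by b sin
   alpha. *)
have k1 : a' k * b k - b' k * a k - (2 * lam * tau)%:C * (b' k * b k) = 0.
  by rewrite tE /a' /b' /atil /btil; field.
(* The coefficient of the scalar part. Up to a constant, the product of the two factors of N_k is (a
   + b sin alpha) a - tau^2 k(k + 2 lam) b^2, the numerator occurring here. *)
have k2 : a' k * a k - (tau ^+ 2 * (k%:R * (k%:R + 2 * lam)))%:C * (b' k * b k) =
    ((kappa * (k%:R + lam) / lam) ^+ 2)%:C.
  have NE : Nk m alpha a b k * ((kappa * (k%:R + lam) / lam) ^+ 2)%:C =
      (a k + b k * (sin alpha)%:C) * a k - (tau ^+ 2 * (k%:R * (k%:R + 2 * lam)))%:C * (b k * b k).
    rewrite /Nk -/lam (_ : 2 `^ (2 * lam) = (2 `^ lam) ^+ 2); last first.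
      by rewrite -powR_mulrn ?powR_ge0// -powRrM mulrC.
    rewrite /tau /kappa.
    have p0 : (2 `^ lam)%:C != 0 :> R[i] by rewrite fmorph_eq0 gt_eqF// powR_gt0.
    have g0 : (Gamma (lam + 1))%:C != 0 :> R[i].
      by rewrite fmorph_eq0 gt_eqF// Gamma_gt0//; move: lam_gt0; lra.
    move: p0 g0; move: (2 `^ lam) (Gamma _) (sin alpha) => P G S p0 g0.
    move: l0 kl0; move: (lam) => l l0 kl0.
    rewrite !(rmorphXn, rmorphM, fmorphV, rmorphD, rmorph_nat, rmorph1)/=.
    move: l0 kl0 p0 g0; move: l%:C P%:C G%:C S%:C (a k) (b k) (k%:R) => L P' G' S' A B K l0 kl0 p0 g0.
    field.
    by rewrite (addrC L) l0 kl0 p0 g0.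
  apply: (mulfI hN); rewrite NE /a' /b' /atil /btil mulrBr; field.
  exact: hN.
rewrite -gegPE -/Cw.
have ev (f g : clif R m) A : (f + g) A = f A + g A by rewrite ffunE.
have evN (f : clif R m) A : (- f) A = - f A by rewrite ffunE.
(* A zero multiple of X is added, to be replaced by the left side of [k1]. *)
have -> : csc m ((kappa * (k%:R + lam) / lam) ^+ 2 * Cw)%:C =
   csc m ((kappa * (k%:R + lam) / lam) ^+ 2 * Cw)%:C + csc m ((tau * Dw)%:C * 0) * X.
  by rewrite mulr0 rmorph0 mul0r addr0.
rewrite -k1 [((_ ^+ 2) * Cw)%:C]rmorphM/= -k2.
have [e1 csc1E] : exists e1 : {set 'I_m} -> R[i], forall c A, csc m c A = c * e1 A.
  by exists (fun A => (1 : clif R m) A) => c A; rewrite -cscE mulr1.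
rewrite !mulr1 mulrDr !mulrN.
apply/ffunP => A; rewrite !(ev, evN, cscE, csc1E).
move: ode; clear -tau; move: (tau) (lam) (k%:R : R) => t l kk ode.
have {ode} : (2 * l + 1)%:C * w%:C * Dw%:C - (1 - w%:C ^+ 2) * D2w%:C =
    (kk * (kk + 2 * l))%:C * Cw%:C :> R[i].
  have := congr1 (fun v => v%:C : R[i]) ode.
  move: (w) (D2w) (Dw) (Cw) => w1 d2 d1 c.
  rewrite !(rmorphXn, rmorphM, rmorphD, rmorphB, rmorphN, rmorph1)/= => ->; ring.
move: (e1 A) (X A) (a' k) (b' k) (a k) (b k) => U Y a1 b1 a2 b2.
move: (w) (D2w) (Dw) (Cw) => w1 d2 d1 c.
rewrite !(rmorphXn, rmorphM, rmorphD, rmorphB, rmorphN, rmorph1)/= => ode.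
transitivity (a1 * a2 * c%:C * U - t%:C ^+ 2 * (b1 * b2) * U * (kk%:C * (kk%:C + (1 + 1) * l%:C) * c%:C) +
  t%:C * d1%:C * (a1 * b2 - b1 * a2 - (1 + 1) * l%:C * t%:C * (b1 * b2)) * Y); last by ring.
rewrite -ode; ring.
Qed.

End Kernel.

(** * Decay of the coefficients and expansion of a kernel on the sphere *)

Section Expansion.
Variables (R : realType) (m : nat).
Hypothesis m_gt2 : (2 < m)%N.
Implicit Types (x y xi zeta eta : 'rV[R]_m) (k : nat) (o : option 'I_m) (c : nat -> R).
Let m_gt0 : (0 < m)%N. Proof. by case: m m_gt2. Qed.
Let lam : R := lamm R m.
Let lam_gt0 : 0 < lam := lamm_gt0 R m_gt2.
Let lam2_ge1 : 1 <= 2 * lam := lamm2_ge1 R m_gt2.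
Let kappa : R := 2 `^ lam * Gamma (lam + 1).
Let kappa_gt0' : 0 < kappa := kappa_gt0 lam_gt0.
Local Notation J k z := (zJ lam 0 k z).
Let gserE k z : gser lam k z = kappa * J k z := esym (zJ0E lam_gt0 k z).
Let J0 k : J k.+1 0 = 0.
Proof.
by apply: (mulfI (_ : kappa != 0)); rewrite ?gt_eqF// -gserE gser0 mulr0.
Qed.

Lemma cvg_series_bounded (u : nat -> R) : cvgn (series u) -> exists B, forall k, `|u k| <= B.
Proof.
move=> cu; have c0 : cvgn u by apply/cvg_ex; exists 0; exact: cvg_series_cvg_0.
have [M [_ HM]] := cvg_seq_bounded c0.
by exists (M + 1) => k; apply: HM => //; rewrite ltrDl.
Qed.

Variables (alpha : R).
Hypothesis sin_neq0 : sin alpha != 0.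
(** Twice the growth rate 4(1 + (lam + 1)) of the Gegenbauer polynomials of parameter lam + 1, which
    also covers parameter lam; the factor 2 leaves 2^-k. *)
Let rho : R := 8 * (2 + lam).
Let rho_gt0 : 0 < rho. Proof. by rewrite mulr_gt0// addr_gt0. Qed.

Definition decays c z := exists M, forall k, `|c k * J k z| * rho ^+ k <= M.

Let decays0 c : decays c 0.
Proof.
exists `|c 0%N * J 0 0| => -[|k]; first by rewrite mulr1.
by rewrite J0 mulr0 normr0 mul0r.
Qed.

Let decays_bounded c (P : nat -> R) z B : (forall k, 1 <= P k) ->
  (forall k, `|c k * (J k (rho * z) * P k)| <= B) -> decays c z.
Proof.
move=> P1 cB; have [|M HM] := @coef_bound R lam lam_gt0 c P z rho (kappa * B) rho_gt0 P1.
  move=> k; rewrite gserE.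
  have -> : c k * (kappa * J k (rho * z) * P k) = kappa * (c k * (J k (rho * z) * P k)).
    by move: (kappa) => t; ring.
  by rewrite normrM gtr0_norm// ler_wpM2l// ltW.
exists (kappa^-1 * M) => k; rewrite ler_pdivlMl//.
apply: le_trans (HM k); rewrite gserE; move: (kappa) kappa_gt0' => t t0.
by rewrite (mulrCA (c k)) [X in _ <= X * _]normrM (gtr0_norm t0) mulrA.
Qed.

(** Convergence at the larger radius [rho * t] with w = 1 bounds the terms there, and [coef_bound]
    converts this into decay at t. *)
Lemma decays_A c t : 0 <= t ->
  (forall t, 0 < t -> cvgn (series (fun k => c k * (J k (t / sin alpha) * gegen lam k 1)))) ->
  decays c (t / sin alpha).
Proof.
rewrite le_eqVlt => /predU1P[<- _|t0 hc]; first by rewrite mul0r; exact: decays0.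
have [|B HB] := cvg_series_bounded (hc (rho * t) _); first exact: mulr_gt0.
apply: (@decays_bounded _ (fun k => gegen lam k 1) _ B) => k; first exact: gegen_1_ge.
by rewrite (mulrA rho); exact: HB.
Qed.

Lemma decays_B c t : 0 <= t ->
  (forall t, 0 < t -> cvgn (series (fun k => c k.+1 * (zJ lam 1 k.+1 (t / sin alpha) * gegen (lam + 1) k 1)))) ->
  decays c (t / sin alpha).
Proof.
rewrite le_eqVlt => /predU1P[<- _|t0 hc]; first by rewrite mul0r; exact: decays0.
have [|B HB] := cvg_series_bounded (hc (rho * t) _); first exact: mulr_gt0.
pose P k := if k is k'.+1 then gegen (lam + 1) k' 1 else 1.
pose Z := rho * t / sin alpha.
have B0 : 0 <= B := le_trans (normr_ge0 _) (HB 0%N).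
(* The series B starts at index 1 and says nothing on c_0, whose term is added to the bound. The
   factor |Z| restores the power of z missing from z^(-lam-1) J_(k+lam)(z). *)
apply: (@decays_bounded _ P _ (`|Z| * B + `|c 0%N * J 0 Z|)) => -[|k]; rewrite /P.
- by [].
- by apply: gegen_1_ge; move: lam_gt0; lra.
- by rewrite mulr1 (mulrA rho) lerDr mulr_ge0.
rewrite (mulrA rho) -/Z -(zJ1E lam_gt0) -mulrA mulrCA normrM.
apply: (@le_trans _ _ (`|Z| * B)); last by rewrite lerDl.
by rewrite ler_wpM2l//; exact: HB.
Qed.

Lemma geo_kterm c z xi o : dotE xi xi = 1 -> decays c z ->
  geo_bounded (fun k eta => c k * kterm xi z o k eta).
Proof.
move=> hx [M HM].
have [B [B0 HB]] : exists B, 0 <= B /\ forall k eta, nrmE eta <= 1 ->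
   `|if o is Some i then dotE (proj_delta xi i) eta * ((gegP lam k)^`()).[dotE xi eta]
     else (gegP lam k).[dotE xi eta]| <= B * (rho / 2) ^+ k.
  have rE : rho / 2 = 4 * (2 + lam) by rewrite /rho; field.
  case: o => [i|]; last first.
    exists 1; split => // k eta he; rewrite gegPE mul1r.
    apply: le_trans (gegen_le lam_gt0 k (dotE_le1 hx he)) _.
    rewrite lerXn2r ?nnegrE ?rE//; move: lam_gt0; lra.
  have [_ [B HB]] := nice_dot (proj_delta xi i).
  have B0 : 0 <= B.
    apply: le_trans (normr_ge0 _) (HB 0 _).
    by rewrite (eqP (_ : nrmE 0 == 0)) ?nrmE_eq0.
  have l0 := ltW lam_gt0.
  have l20 : 0 <= 2 * lam by exact: mulr_ge0.
  have BL : 0 <= B * (2 * lam) by exact: mulr_ge0.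
  exists (B * (2 * lam)); split => //.
  move=> [|k] eta he.
    by rewrite gegP0 derivC horner0 mulr0 normr0 mulr1.
  rewrite gegP_deriv hornerM hornerC gegPE normrM -[leRHS]mulrA; apply: ler_pM => //.
    exact: HB.
  rewrite normrM (ger0_norm l20) ler_wpM2l//.
  have l1 : 0 < lam + 1 by rewrite addr_gt0.
  apply: le_trans (gegen_le l1 k (dotE_le1 hx he)) _.
  rewrite (_ : 4 * (1 + (lam + 1)) = rho / 2); last by rewrite rE; ring.
  by rewrite exprS ler_peMl ?exprn_ge0 ?rE//; move: lam_gt0; lra.
exists (M * B) => k eta he; rewrite /kterm mulrA normrM.
apply: (@le_trans _ _ (`|c k * J k z| * (B * (rho / 2) ^+ k))); first by rewrite ler_wpM2l// HB.
rewrite exprMn; have := HM k; move: `|c k * J k z| (rho ^+ k) => u v h.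
have -> : u * (B * (v * 2^-1 ^+ k)) = (u * v) * (B * 2^-1 ^+ k) by ring.
by rewrite -[leRHS]mulrA ler_wpM2r// mulr_ge0.
Qed.

(** At x = 0 a basis vector serves, so that the expansions below hold for vanishing arguments
    too. *)
Lemma unit_direction x : exists xi, dotE xi xi = 1 /\ x = nrmE x *: xi.
Proof.
have [->|x0] := eqVneq x 0.
  exists (delta_mx 0 (Ordinal m_gt0)); rewrite (eqP (_ : nrmE 0 == 0)) ?nrmE_eq0// scale0r.
  by rewrite dotE_delta mxE !eqxx.
exists ((nrmE x)^-1 *: x); split; last by rewrite scalerA mulfV ?scale1r// nrmE_eq0.
by rewrite -sqr_nrmE nrmE_unit// expr1n.
Qed.

(** Aligns the series B, indexed from 1, with expansions indexed from 0 whose first term C_0'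
    vanishes. *)
Lemma lim_shift (u v : nat -> R) (t : R) : cvgn (series u) -> v 0%N = 0 ->
  (forall k, v k.+1 = t * u k) -> limn (series v) = t * limn (series u).
Proof.
move=> cu v0 vu; apply: cvg_lim => //; rewrite -cvg_shiftS/=.
have h : t * series u n @[n --> \oo] --> t * limn (series u) by apply: cvgMr.
apply: cvg_trans h; apply: near_eq_cvg; apply: nearW => n.
rewrite /series/= big_nat_recl//= v0 add0r mulr_sumr.
by apply: eq_bigr => k _; rewrite vu.
Qed.

Lemma kernel_expand (a b : nat -> R[i]) x xi eta (r : R) : 0 < r ->
  dotE xi xi = 1 -> x = nrmE x *: xi -> nrmE eta = 1 ->
  ccvg (Bterm alpha b (r *: eta) x) ->
  csc m (csum (Aterm alpha a (r *: eta) x)) +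
    cwedge (r *: eta) x * csc m (- csum (Bterm alpha b (r *: eta) x)) =
  \sum_(o : option 'I_m)
    csc m (cball_sum (kcoef alpha a b o) (kterm xi (r * nrmE x / sin alpha) o) eta) * kvec xi o.
Proof.
move=> r0 hx xE he [cRe cIm].
set z := r * nrmE x / sin alpha.
have zE : ztil alpha (r *: eta) x = z by rewrite /ztil nrmEZ he mulr1 gtr0_norm.
have [z0 wE] : (nrmE x = 0 -> z = 0) /\ (nrmE x != 0 -> wcos (r *: eta) x = dotE xi eta).
  split; first by move=> h; rewrite /z h mulr0 mul0r.
  move=> x0; rewrite /wcos nrmEZ he mulr1 gtr0_norm// {1}xE dotEZl dotEZr (dotEC eta).
  by field; rewrite x0 gt_eqF.
have AE (c : nat -> R) : (fun k => c k * (zJ lam 0 k z * gegen lam k (wcos (r *: eta) x))) =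
    fun k => c k * kterm xi z None k eta.
  apply/funext => k; rewrite /kterm gegPE; congr (_ * _).
  (* For x = 0 the cosine [wcos] has a default value, but then z = 0 and only degree 0, where C_0 =
     1, survives. *)
  have [x0|x0] := eqVneq (nrmE x) 0; last by rewrite wE.
  by rewrite z0//; case: k => [|k]; rewrite ?gegen0// J0 !mul0r.
have he1 : nrmE eta <= 1 by rewrite he.
rewrite sum_option /kvec mulr1; congr (csc m _ + _).
  rewrite /csum /cball_sum !ball_sumE// /kcoef /Aterm zE -/lam.
  by congr (limn (series _) +i* limn (series _)); rewrite -AE; apply/funext => k;
    rewrite ?ReM ?ImM/= ?mulr0 ?subr0 ?add0r.
have wdE : cwedge (r *: eta) x = \sum_i csc m (r * nrmE x * dotE (proj_delta xi i) eta)%:C *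
    cwedge (delta_mx 0 i) xi.
  rewrite {1}xE (cwedgeC (r *: eta)) cwedgeZl -mulrN -cwedgeC cwedgeZl -(cwedge_proj xi eta) !mulr_sumr.
  by apply: eq_bigr => i _; rewrite !rmorphM/= !mulrA (cscC r%:C).
rewrite wdE mulr_suml; apply: eq_bigr => i _.
rewrite cscC mulrA -rmorphM; congr (csc m _ * _).
set du := dotE _ eta.
have key (e : R) k : - (sin alpha / (2 * lam)) * e * kterm xi z (Some i) k.+1 eta =
    - (r * nrmE x * du) * (e * (zJ lam 1 k.+1 z * gegen (lam + 1) k (wcos (r *: eta) x))).
  rewrite /kterm -/lam -/du gegP_deriv hornerM hornerC gegPE -(zJ1E lam_gt0).
  have [x0|x0] := eqVneq (nrmE x) 0; first by rewrite z0// x0; ring.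
  rewrite wE// {1}/z; have : lam != 0 by rewrite gt_eqF.
  move: (lam) (zJ _ _ _ _) (gegen _ _ _) => l j g l0.
  by field; rewrite l0 sin_neq0.
have k0 (e : R) : e * kterm xi z (Some i) 0 eta = 0.
  by rewrite /kterm gegP0 derivC horner0 !mulr0.
rewrite /cball_sum !ball_sumE//; apply: complex_eq; rewrite ?ReM ?ImM/= ?mulr0 ?subr0 ?add0r.
- rewrite [RHS](@lim_shift (fun k => Re (Bterm alpha b (r *: eta) x k)) _ (- (r * nrmE x * du)))//.
    by rewrite /csum/= !mulNr mulrC.
  by move=> k; rewrite ReM/= mul0r subr0 key /Bterm zE ReM/= mulr0 subr0.
- rewrite [RHS](@lim_shift (fun k => Im (Bterm alpha b (r *: eta) x k)) _ (- (r * nrmE x * du)))//.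
    by rewrite /csum/= !mulNr mulrC.
  by move=> k; rewrite ImM/= mul0r addr0 key /Bterm zE ImM/= mulr0 add0r.
Qed.

End Expansion.

(** * Pairing of the two kernels *)

Section Assembly.
Variables (R : realType) (m : nat).
Hypothesis m_gt2 : (2 < m)%N.
Implicit Types (x y xi zeta eta : 'rV[R]_m) (k : nat) (o : option 'I_m).
Let m_gt0 : (0 < m)%N. Proof. by case: m m_gt2. Qed.
Let lam : R := lamm R m.
Let lam_gt0 : 0 < lam := lamm_gt0 R m_gt2.
Let kappa : R := 2 `^ lam * Gamma (lam + 1).
Local Notation J k z := (zJ lam 0 k z).
Let gserE k z : gser lam k z = kappa * J k z := esym (zJ0E lam_gt0 k z).

(** Only even powers occur. This absorbs the sign of sin alpha, as the addition theorem delivers a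
    nonnegative square root. *)
Lemma gser0_sqr (z z' : R) : z ^+ 2 = z' ^+ 2 -> gser lam 0 z = gser lam 0 z'.
Proof.
move=> zz; rewrite /gser; congr (limn (series _)); apply/funext => j.
by rewrite /gterm addn0 !exprM !expr_div_n zz.
Qed.

Lemma cexpiD (s t : R) : cexpi s * cexpi t = cexpi (s + t).
Proof. by apply: complex_eq; rewrite ?ReM ?ImM/= ?cosD ?sinD//; ring. Qed.

Lemma sin_neq0 (alpha : R) : - pi < alpha < pi -> alpha != 0 -> sin alpha != 0.
Proof.
move=> /andP[h1 h2]; rewrite neq_lt => /orP[a0|a0].
  rewrite -[alpha]opprK sinN oppr_eq0 gt_eqF// sin_gt0_pi//.
  by rewrite oppr_gt0 a0 ltrNl.
by rewrite gt_eqF// sin_gt0_pi// a0.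
Qed.

Variable alpha : R.
Hypothesis sin_alpha : sin alpha != 0.

Lemma Aterm_sym c x y : Aterm alpha c x y = Aterm alpha c y x.
Proof. by apply/funext => k; rewrite /Aterm /ztil /wcos (mulrC (nrmE x)) (dotEC x). Qed.

Lemma Bterm_sym c x y : Bterm alpha c x y = Bterm alpha c y x.
Proof. by apply/funext => k; rewrite /Bterm /ztil /wcos (mulrC (nrmE x)) (dotEC x). Qed.

(** Collinear vectors reach every positive t with w = 1, where [gegen_1_ge] applies. *)
Let aligned (t : R) : 0 < t -> exists x y : 'rV[R]_m, ztil alpha x y = t / sin alpha /\ wcos x y = 1.
Proof.
move=> t0; pose e : 'rV[R]_m := delta_mx 0 (Ordinal m_gt0).
have ee : dotE e e = 1 by rewrite dotE_delta mxE !eqxx.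
have ne : nrmE e = 1 by rewrite /nrmE ee sqrtr1.
exists (t *: e), e; rewrite /ztil /wcos nrmEZ ne dotEZl ee !mulr1 gtr0_norm//.
by rewrite divff// gt_eqF.
Qed.

Let decays_kcoef (a b : nat -> R[i]) t o : 0 <= t ->
  (forall x y, ccvg (Aterm alpha a x y)) -> (forall x y, ccvg (Bterm alpha b x y)) ->
  decays m (fun k => Re (kcoef alpha a b o k)) (t / sin alpha) /\
  decays m (fun k => Im (kcoef alpha a b o k)) (t / sin alpha).
Proof.
move=> t0 ha hb; case: o => [i|]; rewrite /kcoef.
  have dZ (c : nat -> R) e z : decays m c z -> decays m (fun k => e * c k) z.
    move=> [M HM]; exists (`|e| * M) => k.
    by rewrite -(mulrA e) normrM -mulrA ler_wpM2l// HM.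
  have E1 : (fun k => Re ((- (sin alpha / (2 * lamm R m)))%:C * b k)) =
      fun k => - (sin alpha / (2 * lamm R m)) * Re (b k).
    by apply/funext => k; rewrite ReM/= mul0r subr0.
  have E2 : (fun k => Im ((- (sin alpha / (2 * lamm R m)))%:C * b k)) =
      fun k => - (sin alpha / (2 * lamm R m)) * Im (b k).
    by apply/funext => k; rewrite ImM/= mul0r addr0.
  rewrite E1 E2; split; apply: dZ; apply: decays_B => // s s0;
    have [x [y [zE wE]]] := aligned s0; have [h1 h2] := hb x y.
  - by move: h1; congr (cvgn (series _)); apply/funext => k; rewrite /Bterm zE wE ReM/= mulr0 subr0.
  - by move: h2; congr (cvgn (series _)); apply/funext => k; rewrite /Bterm zE wE ImM/= mulr0 add0r.
split; apply: decays_A => // s s0; have [x [y [zE wE]]] := aligned s0; have [h1 h2] := ha x y.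
- by move: h1; congr (cvgn (series _)); apply/funext => k; rewrite /Aterm zE wE ReM/= mulr0 subr0.
- by move: h2; congr (cvgn (series _)); apply/funext => k; rewrite /Aterm zE wE ImM/= mulr0 add0r.
Qed.

Lemma cgeo_kterm (a b : nat -> R[i]) xi t o : dotE xi xi = 1 -> 0 <= t ->
  (forall x y, ccvg (Aterm alpha a x y)) -> (forall x y, ccvg (Bterm alpha b x y)) ->
  cgeo_bounded (kcoef alpha a b o) (kterm xi (t / sin alpha) o).
Proof.
move=> hx t0 ha hb; have [d1 d2] := decays_kcoef o t0 ha hb.
by split; exact: geo_kterm.
Qed.

Let cscM (c d : R[i]) : csc m (c * d) = csc m c * csc m d. Proof. exact: rmorphM. Qed.

Section Sum.
Variables (a b : nat -> R[i]).
Hypothesis hN : forall k, Nk m alpha a b k != 0.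
Local Notation a' := (atil m alpha a b).
Local Notation b' := (btil m alpha a b).
Hypothesis hA : forall x y, ccvg (Aterm alpha a x y).
Hypothesis hB : forall x y, ccvg (Bterm alpha b x y).
Hypothesis hA' : forall x y, ccvg (Aterm alpha a' x y).
Hypothesis hB' : forall x y, ccvg (Bterm alpha b' x y).
Variables (xi zeta : 'rV[R]_m) (t1 t2 : R).
Hypothesis hxi : dotE xi xi = 1.
Hypothesis hzeta : dotE zeta zeta = 1.
Hypothesis t1_ge0 : 0 <= t1.
Hypothesis t2_ge0 : 0 <= t2.
Let z1 := t1 / sin alpha.
Let z2 := t2 / sin alpha.
Let phi o := cball_sum (kcoef alpha a' b' o) (kterm xi z1 o).
Let psi o := cball_sum (kcoef alpha a b o) (kterm zeta z2 o).

Lemma cnice_phi o : cnice (phi o).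
Proof. by apply: cnice_cball_sum => [k|]; [exact: nice_kterm|exact: cgeo_kterm]. Qed.

Lemma cnice_psi o : cnice (psi o).
Proof. by apply: cnice_cball_sum => [k|]; [exact: nice_kterm|exact: cgeo_kterm]. Qed.

(** In each Clifford component one series is summed in two ways: termwise averaging gives the left
    side, and by [kpair_sum] its terms are those of the addition theorem. *)
Lemma kernel_pairing :
  \sum_o \sum_o' csc m (csph_avg (fun eta => phi o eta * psi o' eta)) * (kvec xi o * kvec zeta o') =
  csc m (gser lam 0 (Num.sqrt (z1 ^+ 2 + z2 ^+ 2 - 2 * (z1 * z2) * dotE xi zeta)))%:C.
Proof.
have evalE (A : {set 'I_m}) (I : Type) (s : seq I) (f : I -> clif R m) :
    (\sum_(i <- s) f i) A = \sum_(i <- s) f i A.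
  by apply: (big_morph (fun f : clif R m => f A)) => [f1 f2|]; rewrite ffunE.
pose h o o' k := J k z1 * J k z2 * (lam / (k%:R + lam)) * kpair xi zeta o o' k.
have H o o' : has_csum (fun k => kcoef alpha a' b' o k * kcoef alpha a b o' k * (h o o' k)%:C)
    (csph_avg (fun eta => phi o eta * psi o' eta)).
  apply: csph_avg_cball_sum; try by [move=> k; exact: nice_kterm|exact: cgeo_kterm].
  - by move=> k; rewrite kterm_diag.
  - by move=> j k; exact: kterm_orth.
have K k : \sum_o \sum_o' csc m (kcoef alpha a' b' o k * kcoef alpha a b o' k * (h o o' k)%:C) *
      (kvec xi o * kvec zeta o') =
    csc m ((k%:R + lam) / lam * (gser lam k z1 * gser lam k z2) * gegen lam k (dotE xi zeta))%:C.
  transitivity (csc m (J k z1 * J k z2 * (lam / (k%:R + lam)))%:C *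
      \sum_o \sum_o' csc m (kcoef alpha a' b' o k * kcoef alpha a b o' k * (kpair xi zeta o o' k)%:C) *
      (kvec xi o * kvec zeta o')).
    rewrite mulr_sumr; apply: eq_bigr => o _; rewrite mulr_sumr; apply: eq_bigr => o' _.
    by rewrite [RHS]mulrA -cscM; congr (csc m _ * _); rewrite /h rmorphM/= mulrCA.
  rewrite (kpair_sum m_gt2 hxi hzeta (hN k)) -cscM -rmorphM; congr (csc m _%:C).
  rewrite !gserE -/lam -/kappa; have l0 : lam != 0 by rewrite gt_eqF.
  have kl0 : k%:R + lam != 0 by rewrite gt_eqF// ltr_wpDl.
  move: l0 kl0; move: (J k z1) (J k z2) (gegen lam k (dotE xi zeta)) (kappa) (lam) => j1 j2 g kp l l0 kl0.
  by field; rewrite l0 kl0.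
apply/ffunP => A.
apply: (@has_csum_uniq _ (fun k => (\sum_o \sum_o' csc m (kcoef alpha a' b' o k * kcoef alpha a b o' k *
    (h o o' k)%:C) * (kvec xi o * kvec zeta o')) A)).
  rewrite evalE (_ : (fun k => _) = fun k => \sum_o \sum_o' (kcoef alpha a' b' o k * kcoef alpha a b o' k *
    (h o o' k)%:C) * (kvec xi o * kvec zeta o') A); last first.
    apply/funext => k; rewrite evalE; apply: eq_bigr => o _; rewrite evalE.
    by apply: eq_bigr => o' _; rewrite cscE.
  apply: has_csum_sum => o; rewrite evalE; apply: has_csum_sum => o'.
  by rewrite cscE; apply: has_csumZr; exact: H.
rewrite (_ : (fun k => _) = fun k => ((k%:R + lam) / lam * (gser lam k z1 * gser lam k z2) *
   gegen lam k (dotE xi zeta))%:C * (1 : clif R m) A); last first.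
  by apply/funext => k; rewrite K -cscE mulr1.
rewrite -[csc m _]mulr1 cscE; apply: has_csumZr; apply: has_csum_real.
exact: gegenbauer_addition.
Qed.

End Sum.
End Assembly.

Unset Implicit Arguments.

Theorem theorem5 (R : realType) (m : nat) (alpha : R) (a b : nat -> R[i])
  (hm : (2 < m)%N)
  (halpha : - pi < alpha < pi) (halpha0 : alpha != 0)
  (hb0 : b 0%N = 0)
  (hN : forall k : nat, Nk m alpha a b k != 0)
  (hcvg : forall x y : 'rV[R]_m,
     [/\ ccvg (Aterm alpha a x y), ccvg (Bterm alpha b x y),
         ccvg (Aterm alpha (atil m alpha a b) x y)
       & ccvg (Bterm alpha (btil m alpha a b) x y)])
  (hpoly : exists (c : R) (N : nat), forall x y : 'rV[R]_m,
     `|csum (Aterm alpha a x y)| <= (c * (1 + nrmE x + nrmE y) ^+ N)%:C /\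
     `|csum (Bterm alpha b x y)| <= (c * (1 + nrmE x + nrmE y) ^+ N)%:C)
  (x y : 'rV[R]_m) (r : R) (hr : 0 < r) :
  sph_int (fun eta : 'rV[R]_m =>
             clmul (Ktil alpha a b (r *: eta) x) (Kfun alpha a b y (r *: eta)))
  = clsc m ((2 `^ lamm R m * Gamma (lamm R m + 1)
             * zJ (lamm R m) 0 0
                 (r / sin alpha
                  * Num.sqrt (nrmE x ^+ 2 + nrmE y ^+ 2 - 2 * dotE x y)))%:C
            * cexpi (- (cot alpha / 2) * (nrmE x ^+ 2 - nrmE y ^+ 2))).
Proof.
have m_gt0 : (0 < m)%N by exact: ltn_trans hm.
have sa := sin_neq0 halpha halpha0.
have hA (u v : 'rV[R]_m) : ccvg (Aterm alpha a u v) by have [] := hcvg u v.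
have hB (u v : 'rV[R]_m) : ccvg (Bterm alpha b u v) by have [] := hcvg u v.
have hA' (u v : 'rV[R]_m) : ccvg (Aterm alpha (atil m alpha a b) u v) by have [] := hcvg u v.
have hB' (u v : 'rV[R]_m) : ccvg (Bterm alpha (btil m alpha a b) u v) by have [] := hcvg u v.
have [xi [hxi xE]] := unit_direction hm x.
have [zeta [hzeta yE]] := unit_direction hm y.
have t1 : 0 <= r * nrmE x by rewrite mulr_ge0 ?nrmE_ge0// ltW.
have t2 : 0 <= r * nrmE y by rewrite mulr_ge0 ?nrmE_ge0// ltW.
(* The phases in r^2 of the two kernels are opposite and cancel; this one remains. *)
pose ph := cexpi (- (cot alpha / 2) * (nrmE x ^+ 2 - nrmE y ^+ 2)).
have cscM (c d : R[i]) : csc m (c * d) = csc m c * csc m d by exact: rmorphM.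
have cscN (c : R[i]) : csc m (- c) = - csc m c by exact: rmorphN.
have comm (S1 S2 : clif R m) (p1 p2 : R[i]) :
    S1 * csc m p1 * (S2 * csc m p2) = S1 * (S2 * csc m (p1 * p2)).
  by rewrite cscM -(mulrA S1) (mulrA (csc m p1)) -(cscC _ S2) -(mulrA S2).
have kf (s : R) A B (u v : 'rV[R]_m) : kernel_form alpha s A B u v =
    (csc m A + cwedge u v * csc m B) * csc m (cexpi (s * (cot alpha / 2) * (nrmE u ^+ 2 + nrmE v ^+ 2))).
  by rewrite /kernel_form cladd_ffun.
pose phi (o : option 'I_m) := cball_sum (kcoef alpha (atil m alpha a b) (btil m alpha a b) o)
     (kterm xi (r * nrmE x / sin alpha) o).
pose psi (o : option 'I_m) := cball_sum (kcoef alpha a b o) (kterm zeta (r * nrmE y / sin alpha) o).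
have FE (eta : 'rV[R]_m) : nrmE eta = 1 -> clmul (Ktil alpha a b (r *: eta) x) (Kfun alpha a b y (r *: eta)) =
    (\sum_o csc m (phi o eta) * kvec xi o) * (\sum_o csc m (psi o eta) * (kvec zeta o * csc m ph)).
  move=> he.
  have -> : \sum_o csc m (psi o eta) * (kvec zeta o * csc m ph) =
      (\sum_o csc m (psi o eta) * kvec zeta o) * csc m ph.
    by rewrite mulr_suml; apply: eq_bigr => o _; rewrite mulrA.
  (* In K(y, r eta) the arguments are exchanged: A and B are symmetric and the bivector changes
     sign, a sign passed on to B. Both kernels then have the shape required by [kernel_expand]. *)
  rewrite /Ktil /Kfun !kf (Aterm_sym _ _ y) (Bterm_sym _ _ y) (cwedgeC y).
  rewrite [- cwedge _ _ * _]mulNr -[- (cwedge _ _ * _)]mulrN -cscN.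
  rewrite (kernel_expand hm sa _ hr hxi xE he (hB' _ _)) (kernel_expand hm sa _ hr hzeta yE he (hB _ _)).
  set S1 := \sum_o _; set S2 := \sum_o _.
  transitivity (S1 * csc m (cexpi (-1 * (cot alpha / 2) * (nrmE (r *: eta) ^+ 2 + nrmE x ^+ 2))) *
    (S2 * csc m (cexpi (1 * (cot alpha / 2) * (nrmE y ^+ 2 + nrmE (r *: eta) ^+ 2))))) => //.
  by rewrite comm cexpiD /ph; congr (S1 * (S2 * csc m (cexpi _))); ring.
have nphi o : cnice (phi o) := cnice_phi hm hA' hB' hxi t1 o.
have npsi o : cnice (psi o) := cnice_psi hm hA hB hzeta t2 o.
have E := sph_int_bilinear m_gt0 (W := fun o => kvec zeta o * csc m ph) nphi npsi FE.
apply: (etrans E).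
transitivity ((\sum_o \sum_o' csc m (csph_avg (fun eta => phi o eta * psi o' eta)) *
    (kvec xi o * kvec zeta o')) * csc m ph).
  rewrite mulr_suml; apply: eq_bigr => o _; rewrite mulr_suml; apply: eq_bigr => o' _.
  by rewrite !mulrA.
rewrite (kernel_pairing hm hN hA hB hA' hB' hxi hzeta t1 t2) -cscM; congr (clsc m (_%:C * _)).
rewrite (zJ0E (lamm_gt0 R hm)); apply: gser0_sqr.
have dxy : dotE x y = nrmE x * nrmE y * dotE xi zeta.
  by rewrite {1}xE dotEZl {1}yE dotEZr mulrA.
have Q0 : 0 <= nrmE x ^+ 2 + nrmE y ^+ 2 - 2 * dotE x y.
  have := dotE_ge0 (x + (-1) *: y).
  rewrite !(dotEDl, dotEZl) !(dotEC _ (_ + _)) !(dotEDl, dotEZl) (dotEC y x) -!sqr_nrmE.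
  by move: (nrmE x ^+ 2) (nrmE y ^+ 2) (dotE x y) => p q w; lra.
have QE : (r * nrmE x / sin alpha) ^+ 2 + (r * nrmE y / sin alpha) ^+ 2 -
    2 * (r * nrmE x / sin alpha * (r * nrmE y / sin alpha)) * dotE xi zeta =
    (r / sin alpha) ^+ 2 * (nrmE x ^+ 2 + nrmE y ^+ 2 - 2 * dotE x y).
  by rewrite dxy; ring.
have QE0 : 0 <= (r / sin alpha) ^+ 2 * (nrmE x ^+ 2 + nrmE y ^+ 2 - 2 * dotE x y).
  by apply: mulr_ge0 => //; exact: sqr_ge0.
by rewrite QE (sqr_sqrtr QE0) [RHS]exprMn (sqr_sqrtr Q0).
Qed.
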